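(* The stability conditions on the heart $\mathrm{mod}\,A_3^{\otimes5}$ with central charges of quintic periods near the Gepner point deform into those near the large complex structure limit with wall-crossings of second kind that are different from ones of dilation and rotation. Explicitly: for every $\sigma\in\mathcal S_\infty$ there are $\sigma'\in\mathcal S_0$ and a deformation of stability conditions on the heart $\mathrm{mod}\,A_3^{\otimes 5}$ from $\sigma$ to $\sigma'$ such that there is a non-trivial wall-crossing of second kind between $\sigma$ and $\sigma'$ which is different from ones of dilation and rotation.
   Context: **Quiver.** $A_3^{\otimes5}$ is the quiver with vertices $s=\{s_1,\dots,s_5\}$, $0\le s_i\le3$, an arrow $s\to s'$ whenever $s'$ is obtained from $s$ by raising one $s_i$ by $1$, and all squares commuting; $\mathrm{mod}\,A_3^{\otimes5}$ is its category of finite-dimensional complex representations, a heart of $\mathcal T=D^b(\mathrm{mod}\,A_3^{\otimes5})\cong D^b_G(\mathrm{Coh}\,X)$, where $X$ is the Fermat quintic threefold and $G\cong\mathbb Z_5^5/\mathbb Z_5$ acts diagonally by fifth roots of unity. The simple representation at vertex $s$ is also written $s$; forgetting equivariance it becomes $\tau^{-\sum s_i}(\mathcal O_X)$, with $\tau(E)=\mathcal O(1)\otimes T_{\mathcal O_X}(E)$ ($T_{\mathcal O_X}$ the spherical twist). **Central charges.** Let $w(x,p)=\sum_{n\ge0}\frac{\Gamma(1+5(n+p))}{\Gamma(1+(n+p))^5}x^{n+p}$ and $w_k(x)=\partial_p^kw(x,p)|_{p=0}$. Let $\Pi_B={}^t(w^{(0)},w^{(1)},w^{(2)},w^{(3)})$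 with $w^{(0)}=w(x,0)$, $w^{(1)}=\frac{w_1}{2\pi i}$, $w^{(2)}=\frac{5w_2}{2!(2\pi i)^2}+\frac{11}2\frac{w_1}{2\pi i}$, $w^{(3)}=-\frac{5w_3}{3!(2\pi i)^3}-\frac{50}{12}\frac{w_1}{2\pi i}$, and $$M_\infty=\begin{pmatrix}1&0&0&-1\\-1&1&0&1\\-3&-5&1&3\\5&-8&1&-4\end{pmatrix}.$$ Near $x=0$: $Z_x(s)=(M_\infty^{\sum s_i}\Pi_B(x))[4]$, where $[j]$ denotes the $j$-th component; up to an overall sign common to all objects this is $\int_X\mathrm{ch}(s)\,w(x,\frac J{2\pi i})\,\mathrm{Todd}\,X$, $J$ the hyperplane class. Near $x=\infty$, by analytic continuation: with $\xi=e^{2\pi i/5}$, $\tilde\omega_k(x)=-\frac15\frac1{(2\pi i)^4}\sum_{N\ge0}\frac{\Gamma(N+k/5)^5}{\Gamma(5N+k)}x^{-N-k/5}$, $\omega_j^\infty=\sum_{k=1}^5(1-\xi^k)^4\xi^{kj}\tilde\omega_k$, $Z_x(s)=\omega^\infty_{j}(x)-\omega^\infty_{j+1}(x)$ where $j=\sum s_i$ and indices are modulo $5$. **Stability condition.** A stability condition on $\mathcal T$ consists of a heart $\mathcal A$ of a bounded $t$-structure and a homomorphism $Z:K(\mathcal T)\to\mathbb C$, with a family of nonzero semistable objects of $\mathcal A$ such that: (1) each semistable $Q$ has $Z(Q)=m(Q)\exp(\phi_Qi)$, $m(Q)>0$, phase $\phi_Q\in\mathbb R$; (2) $\mathrm{Ext}^1(Q,Q')\neq0$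 for semistable $Q,Q'$ implies $|\phi_Q-\phi_{Q'}|<\pi$; (3) $\phi_{Q'}>\phi_Q$ implies $\mathrm{Hom}(Q',Q)=0$; (4) each nonzero $E\in\mathcal A$ has a filtration $0=E_n\subset\dots\subset E_0=E$ in $\mathcal A$ with semistable $Q_i=E_i/E_{i+1}$ and $\phi_{Q_{i+1}}>\phi_{Q_i}$. Stable means semistable and not a non-trivial extension of semistable objects of the same phase. **The families.** $\mathcal S_0$ (resp. $\mathcal S_\infty$) is the set of stability conditions on the heart $\mathrm{mod}\,A_3^{\otimes5}$ with central charge $Z_x$ for $x\ne0$ close to the large complex structure limit $x=0$ (resp. $x$ close to the Gepner point $x=\infty$), whose stable objects are the simple representations $s$, with phases depending only on $\sum s_i$ and strictly increasing in $\sum s_i$. **Deformation, wall-crossing.** A deformation from $\sigma$ to $\sigma'$ on a heart $\mathcal A$ is a family $\sigma_t$, $t\in[0,1]$, of stability conditions on $\mathcal A$ with $\sigma_0=\sigma$, $\sigma_1=\sigma'$, whose central charges and phases of stable objects vary continuously. For a stability condition $\sigma$ on $\mathcal A$ and $\phi\in\mathbb R$, $\mathcal A^\sigma_\phi$ is the heart given by the extension-closed full subcategory of $\mathcal T$ generated by semistable $Q\in\mathcal A$ with $\phi_Q>\phi$ and $Q[1]$ for semistable $Q\in\mathcal A$ with $\phi_Q\le\phi$. There is a non-trivial wall-crossing of second kind between $\sigma$ and $\sigma'$ if $\mathcal A^\sigma_\phi\ne\mathcal A^{\sigma'}_\phi$ for some $\phi$. Dilation and rotation by $re^{i\theta}$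 ($r>0,\theta\in\mathbb R$) replaces $Z$ by $re^{i\theta}Z$ and each phase $\phi_Q$ by $\phi_Q+\theta$, keeping heart and semistable objects. The wall-crossing is different from ones of dilation and rotation if, for every dilation and rotation $\sigma''$ of $\sigma$, there is still some $\phi$ with $\mathcal A^{\sigma''}_\phi\neq\mathcal A^{\sigma'}_\phi$. *)

(* Defs.v *)
From HB Require Import structures.
From mathcomp Require Import all_boot all_order all_algebra.
From mathcomp Require Import ring zify complex.
From mathcomp Require Import all_classical all_reals all_analysis.
Set Implicit Arguments.
Unset Strict Implicit.
Unset Printing Implicit Defensive.
Import Order.TTheory GRing.Theory Num.Theory.
Import numFieldNormedType.Exports.
Local Open Scope classical_set_scope.
Local Open Scope complex_scope.
Local Open Scope ring_scope.

Definition vertex := {ffun 'I_5 -> 'I_4}.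

Definition level (s : vertex) : nat := \sum_(i < 5) s i.

Definition arrow (s s' : vertex) : bool :=
  [exists i, (s' i == (s i).+1 :> nat) && [forall j, (j != i) ==> (s' j == s j)]].

(* Between two vertices there is at most one arrow, and two paths
   v -> a -> w and v -> b -> w of length two with a != b are exactly the two
   sides of a square of the quiver. *)
Record rep (R : realType) := Rep {
  rep_sp :> vertex -> vectType R[i];
  rep_map : forall v w, arrow v w -> 'Hom(rep_sp v, rep_sp w);
  rep_square : forall v a b w (va : arrow v a) (aw : arrow a w)
                 (vb : arrow v b) (bw : arrow b w) (x : rep_sp v),
    rep_map aw (rep_map va x) = rep_map bw (rep_map vb x) }.

Record rhom (R : realType) (M N : rep R) := RHom {
  rhom_fun :> forall v, 'Hom(M v, N v);
  rhom_comm : forall v w (a : arrow v w) (x : M v),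
    rhom_fun w (rep_map M a x) = rep_map N a (rhom_fun v x) }.

Section Representations.
Variable R : realType.
Local Notation C := R[i].
Implicit Types M N Q E : rep R.

Definition rep_zero M := forall v (x : M v), x = 0.

Definition rep_iso M N := exists f : rhom M N, forall v, bijective (f v).

Definition rep_exact M E N (f : rhom M E) (g : rhom E N) :=
  forall v, [/\ injective (f v), (forall z, exists y, g v y = z)
    & forall y, g v y = 0 <-> exists x, y = f v x].

Definition rep_ext M E N :=
  exists (f : rhom M E) (g : rhom E N), rep_exact f g.

(* Yoneda's Ext^1(Q, Q') is nonzero: some extension of Q by Q' is not split. *)
Definition Ext1_neq0 Q Q' :=
  exists E (f : rhom Q' E) (g : rhom E Q), rep_exact f g /\
    ~ exists h : rhom Q E, forall v x, g v (h v x) = x.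

Definition Hom_eq0 M N := forall (f : rhom M N) v x, f v x = 0.

Fact null_rep_square (d : vertex -> nat) v a b w
  (va : arrow v a) (aw : arrow a w) (vb : arrow v b) (bw : arrow b w)
  (x : 'rV[C]_(d v)) :
  (0 : 'Hom('rV[C]_(d a), 'rV[C]_(d w)))
     ((0 : 'Hom('rV[C]_(d v), 'rV[C]_(d a))) x) =
  (0 : 'Hom('rV[C]_(d b), 'rV[C]_(d w)))
     ((0 : 'Hom('rV[C]_(d v), 'rV[C]_(d b))) x).
Proof. by rewrite !lfunE. Qed.

Definition null_rep (d : vertex -> nat) : rep R :=
  @Rep R (fun v => 'rV[C]_(d v)) (fun _ _ _ => 0) (@null_rep_square d).

Definition rep0 : rep R := null_rep (fun=> 0%N).

Definition simple (s : vertex) : rep R := null_rep (fun v => v == s).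

Fact rhom0_comm M N v w (a : arrow v w) (x : M v) :
  (0 : 'Hom(M w, N w)) (rep_map M a x) =
  rep_map N a ((0 : 'Hom(M v, N v)) x).
Proof. by rewrite !lfunE /= linear0. Qed.

Definition rhom0 M N : rhom M N := RHom (@rhom0_comm M N).

Fact rhomN_comm M N (f : rhom M N) v w (a : arrow v w) (x : M v) :
  (- f w) (rep_map M a x) = rep_map N a ((- f v) x).
Proof. by rewrite !lfunE /= rhom_comm linearN. Qed.

Definition rhomN M N (f : rhom M N) : rhom M N := RHom (rhomN_comm f).

Definition pair_map (U V U' V' : vectType C)
  (f : 'Hom(U, U')) (g : 'Hom(V, V')) (p : U * V) : U' * V' := (f p.1, g p.2).

Fact pair_map_linear U V U' V' f g : linear (@pair_map U V U' V' f g).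
Proof. by move=> k x y; rewrite /pair_map /= !linearP. Qed.

HB.instance Definition _ (U V U' V' : vectType C) f g :=
  GRing.isLinear.Build C (U * V)%type (U' * V')%type _ _
    (@pair_map_linear U V U' V' f g).

Fact rep_sum_square M N v a b w
  (va : arrow v a) (aw : arrow a w) (vb : arrow v b) (bw : arrow b w)
  (x : M v * N v) :
  linfun (pair_map (rep_map M aw) (rep_map N aw))
    (linfun (pair_map (rep_map M va) (rep_map N va)) x) =
  linfun (pair_map (rep_map M bw) (rep_map N bw))
    (linfun (pair_map (rep_map M vb) (rep_map N vb)) x).
Proof.
by rewrite !lfunE /=; congr (_, _); exact: rep_square.
Qed.

Definition rep_sum M N : rep R :=
  @Rep R (fun v => (M v * N v)%type)
    (fun _ _ a => linfun (pair_map (rep_map M a) (rep_map N a)))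
    (@rep_sum_square M N).

End Representations.

Record cplx (R : realType) := Cplx {
  cobj :> int -> rep R;
  cdiff : forall n : int, rhom (cobj n) (cobj (n + 1));
  cdiff2 : forall n v (x : cobj n v), cdiff (n + 1) v (cdiff n v x) = 0;
  cbounded : exists N : nat, forall n : int, (N < `|n|)%N -> rep_zero (cobj n) }.

Record chom (R : realType) (X Y : cplx R) := CHom {
  chom_fun :> forall n : int, rhom (X n) (Y n);
  chom_comm : forall n v (x : X n v),
    chom_fun (n + 1) v (cdiff X n v x) = cdiff Y n v (chom_fun n v x) }.

Section DerivedCategory.
Variable R : realType.
Local Notation C := R[i].
Implicit Types X Y W A B : cplx R.

(* The induced maps on H^{n+1} are injective and surjective for all n. *)
Definition quasi_iso X Y (f : chom X Y) := forall (n : int) v,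
  (forall x, cdiff X (n + 1) v x = 0 ->
     (exists y, f (n + 1) v x = cdiff Y n v y) -> exists x', x = cdiff X n v x')
  /\ (forall y, cdiff Y (n + 1) v y = 0 ->
     exists2 x, cdiff X (n + 1) v x = 0
       & exists y', y - f (n + 1) v x = cdiff Y n v y').

(* Isomorphism in the derived category: a roof X <- W -> Y both of whose legs
   are quasi-isomorphisms. *)
Definition T_iso X Y :=
  exists W (f : chom W X) (g : chom W Y), quasi_iso f /\ quasi_iso g.

Fact stalk_diff2 (Q : int -> rep R) (n : int) v (x : Q n v) :
  rhom0 (Q (n + 1)) (Q (n + 1 + 1)) v (rhom0 (Q n) (Q (n + 1)) v x) = 0.
Proof. by rewrite /= !lfunE. Qed.

Fact stalk_bounded (Q : rep R) : exists N : nat, forall n : int,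
  (N < `|n|)%N -> rep_zero (if n == 0 then Q else rep0 R).
Proof.
exists 0%N => n; rewrite absz_gt0 => /negPf -> v x.
by apply/matrixP => i [].
Qed.

Definition stalk (Q : rep R) : cplx R :=
  Cplx (@stalk_diff2 (fun n => if n == 0 then Q else rep0 R)) (stalk_bounded Q).

Fact shift_diff2 X (n : int) v (x : X (n + 1) v) :
  rhomN (cdiff X (n + 1 + 1)) v (rhomN (cdiff X (n + 1)) v x) = 0.
Proof. by rewrite /= !lfunE /= !linearN /= cdiff2 oppr0 oppr0. Qed.

Fact shift_bounded X : exists N : nat, forall n : int,
  (N < `|n|)%N -> rep_zero (X (n + 1)).
Proof.
have [N HN] := cbounded X; exists N.+1 => n Hn; apply: HN.
by lia.
Qed.

(* (X[1])^n = X^{n+1}, with differential -d. *)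
Definition shift X : cplx R :=
  @Cplx R (fun n => X (n + 1)) (fun n => rhomN (cdiff X (n + 1)))
    (@shift_diff2 X) (shift_bounded X).

Section Cone.
Variables (A B : cplx R) (f : chom A B).

Definition cone_fun (n : int) v (p : A (n + 1) v * B n v) :
    A (n + 1 + 1) v * B (n + 1) v :=
  (- cdiff A (n + 1) v p.1, f (n + 1) v p.1 + cdiff B n v p.2).

Fact cone_fun_linear n v : linear (@cone_fun n v).
Proof.
move=> k x y; congr (_, _) => /=.
  by rewrite linearP opprD scalerN.
by rewrite !linearP addrACA scalerDr.
Qed.

HB.instance Definition _ (n : int) v :=
  GRing.isLinear.Build C (A (n + 1)%R v * B n v)%type
    (A (n + 1 + 1)%R v * B (n + 1)%R v)%type _ _ (@cone_fun_linear n v).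

Fact cone_comm (n : int) v w (a : arrow v w)
    (x : rep_sum (A (n + 1)) (B n) v) :
  linfun (@cone_fun n w) (rep_map (rep_sum (A (n + 1)) (B n)) a x) =
  rep_map (rep_sum (A (n + 1 + 1)) (B (n + 1))) a (linfun (@cone_fun n v) x).
Proof.
rewrite /= !lfunE /= /cone_fun /pair_map /= !rhom_comm linearN.
by rewrite [in RHS]linearD.
Qed.

Definition cone_diff (n : int) :
    rhom (rep_sum (A (n + 1)) (B n)) (rep_sum (A (n + 1 + 1)) (B (n + 1))) :=
  @RHom R (rep_sum (A (n + 1)) (B n)) (rep_sum (A (n + 1 + 1)) (B (n + 1)))
    (fun v => linfun (@cone_fun n v)) (@cone_comm n).

Fact cone_diff2 (n : int) v (x : rep_sum (A (n + 1)) (B n) v) :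
  cone_diff (n + 1) v (cone_diff n v x) = 0.
Proof.
rewrite /= !lfunE /= /cone_fun /= !linearN /= cdiff2 !oppr0 linearD /= cdiff2.
by rewrite chom_comm addr0 addNr.
Qed.

Fact cone_bounded : exists N : nat, forall n : int,
  (N < `|n|)%N -> rep_zero (rep_sum (A (n + 1)) (B n)).
Proof.
have [N HN] := shift_bounded A; have [M HM] := cbounded B.
exists (maxn N M) => n; rewrite gtn_max => /andP[/HN hA /HM hB] v [x y].
by rewrite (hA v x) (hB v y).
Qed.

Definition cone : cplx R := Cplx cone_diff2 cone_bounded.

End Cone.

(* There is a distinguished triangle X -> Y -> W -> X[1]: up to rotation and
   isomorphism in the derived category it is B -> cone f -> A[1] for some
   chain map f : A -> B. *)
Definition triangle X Y W := exists A B (f : chom A B),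
  [/\ T_iso B X, T_iso (cone f) Y & T_iso (shift A) W].

(* A homomorphism K(T) -> C, as a function of the class of the object. *)
Definition K_hom (Z : cplx R -> C) :=
  forall X Y W, triangle X Y W -> Z Y = Z X + Z W.

End DerivedCategory.

Definition cexp (R : realType) (z : R[i]) : R[i] :=
  (expR (complex.Re z))%:C * (cos (complex.Im z) +i* sin (complex.Im z)).

(* Only the values of the phase on semistable objects are meaningful. Families
   of objects are families of isomorphism classes, hence ss_iso. *)
Record stability (R : realType) := Stability {
  charge : cplx R -> R[i];
  ss : rep R -> Prop;
  phase : rep R -> R;
  charge_K : K_hom charge;
  ss_neq0 : forall Q, ss Q -> ~ rep_zero Q;
  ss_iso : forall Q Q', ss Q -> rep_iso Q Q' -> ss Q';
  ss_charge : forall Q, ss Q ->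
    exists2 m : R, 0 < m & charge (stalk Q) = m%:C * cexp (0 +i* phase Q);
  ss_ext1 : forall Q Q', ss Q -> ss Q' -> Ext1_neq0 Q Q' ->
    `|phase Q - phase Q'| < pi;
  ss_hom : forall Q Q', ss Q -> ss Q' -> phase Q < phase Q' -> Hom_eq0 Q' Q;
  ss_filtration : forall E, ~ rep_zero E ->
    exists (n : nat) (F Q : nat -> rep R),
      [/\ F 0%N = E, rep_zero (F n),
          (forall i, (i < n)%N -> rep_ext (F i.+1) (F i) (Q i) /\ ss (Q i))
        & forall i, (i.+1 < n)%N -> phase (Q i) < phase (Q i.+1)] }.

Section Stability.
Variable R : realType.
Local Notation C := R[i].
Implicit Types sigma tau : stability R.

(* Semistable objects being nonzero, any extension of two of them is
   non-trivial. *)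
Definition stable sigma (Q : rep R) := ss sigma Q /\
  ~ exists Q' Q'', [/\ ss sigma Q', ss sigma Q'',
      phase sigma Q' = phase sigma Q, phase sigma Q'' = phase sigma Q
    & rep_ext Q' Q Q''].

Inductive tilt sigma (phi : R) : cplx R -> Prop :=
| tilt_zero : tilt sigma phi (stalk (rep0 R))
| tilt_gt Q : ss sigma Q -> phi < phase sigma Q -> tilt sigma phi (stalk Q)
| tilt_le Q : ss sigma Q -> phase sigma Q <= phi ->
    tilt sigma phi (shift (stalk Q))
| tilt_ext X Y W : tilt sigma phi X -> tilt sigma phi W -> triangle X Y W ->
    tilt sigma phi Y.

Definition second_kind_wall_crossing sigma tau :=
  exists phi : R, ~ forall X, tilt sigma phi X <-> tilt tau phi X.

Section DilationRotation.
Variables (sigma : stability R) (r theta : R) (r_gt0 : 0 < r).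

Let charge' X := r%:C * cexp (0 +i* theta) * charge sigma X.
Let phase' Q := phase sigma Q + theta.

Fact dilrot_K : K_hom charge'.
Proof.
by move=> X Y W /(@charge_K R sigma) e; rewrite /charge' e mulrDr.
Qed.

Fact dilrot_charge Q : ss sigma Q ->
  exists2 m : R, 0 < m & charge' (stalk Q) = m%:C * cexp (0 +i* phase' Q).
Proof.
case/ss_charge => m m0 e; exists (r * m); first exact: mulr_gt0.
rewrite /charge' e /cexp /phase' /= expR0 cosD sinD.
by apply/eqP; rewrite eq_complex /=; apply/andP;
  split; apply/eqP; ring.
Qed.

Fact dilrot_ext1 Q Q' : ss sigma Q -> ss sigma Q' -> Ext1_neq0 Q Q' ->
  `|phase' Q - phase' Q'| < pi.
Proof. by rewrite /phase' opprD addrACA subrr addr0; exact: ss_ext1. Qed.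

Fact dilrot_hom Q Q' : ss sigma Q -> ss sigma Q' -> phase' Q < phase' Q' ->
  Hom_eq0 Q' Q.
Proof. by rewrite /phase' ltrD2r; exact: ss_hom. Qed.

Fact dilrot_filtration E : ~ rep_zero E ->
  exists (n : nat) (F Q : nat -> rep R),
    [/\ F 0%N = E, rep_zero (F n),
        (forall i, (i < n)%N -> rep_ext (F i.+1) (F i) (Q i) /\ ss sigma (Q i))
      & forall i, (i.+1 < n)%N -> phase' (Q i) < phase' (Q i.+1)].
Proof.
case/(@ss_filtration R sigma) => n [F [Q [F0 Fn FQ lt]]].
by exists n, F, Q; split=> // i /lt; rewrite /phase' ltrD2r.
Qed.

Definition dilation_rotation : stability R :=
  Stability dilrot_K (@ss_neq0 R sigma) (@ss_iso R sigma)
    dilrot_charge dilrot_ext1 dilrot_hom dilrot_filtration.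

End DilationRotation.

Definition deformation sigma tau (sigma_ : R -> stability R) :=
  [/\ sigma_ 0 = sigma, sigma_ 1 = tau,
      (forall X, {within `[0, 1], continuous (fun t => complex.Re (charge (sigma_ t) X))}
        /\ {within `[0, 1], continuous (fun t => complex.Im (charge (sigma_ t) X))})
    & forall Q, {within [set t | 0 <= t <= 1 /\ stable (sigma_ t) Q],
        continuous (fun t => phase (sigma_ t) Q)}].

End Stability.

(* Periods are multivalued in x. They are written as functions of u = log x,
   a point of the universal cover of the punctured line: x = cexp u and
   x^e = cexp (e u). *)
Section Periods.
Variable R : realType.
Local Notation C := R[i].

Definition Gamma (s : R) : R :=
  (\int[lebesgue_measure]_(t in `]0, +oo[) (t `^ (s - 1) * expR (- t)))%R.

Definition xpow (u : C) (e : R) : C := cexp (e%:C * u).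

Definition csum (f : nat -> C) : C :=
  limn (series (fun n => complex.Re (f n))) +i* limn (series (fun n => complex.Im (f n))).

Definition cderiv (k : nat) (f : R -> C) (p : R) : C :=
  derive1n k (fun q => complex.Re (f q)) p +i*
  derive1n k (fun q => complex.Im (f q)) p.

Definition w (u : C) (p : R) : C := csum (fun n =>
  (Gamma (1 + 5 * (n%:R + p)) / Gamma (1 + (n%:R + p)) ^+ 5)%:C * xpow u (n%:R + p)).

Definition w_ (k : nat) (u : C) : C := cderiv k (w u) 0.

Definition twopii : C := 0 +i* (2 * pi).

Definition Pi_B (u : C) : 'cV[C]_4 := \col_i nth 0 [::
    w u 0;
    w_ 1 u / twopii;
    5 * w_ 2 u / (2`!%:R * twopii ^+ 2) + 11 / 2 * (w_ 1 u / twopii);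
    - (5 * w_ 3 u / (3`!%:R * twopii ^+ 3)) - 50 / 12 * (w_ 1 u / twopii)] i.

Definition M_inf : 'M[C]_4 := \matrix_(i, j) nth 0 (nth [::] [::
    [::  1;  0; 0; -1];
    [:: -1;  1; 0;  1];
    [:: -3; -5; 1;  3];
    [::  5; -8; 1; -4]] i) j.

(* Near x = 0, Z_x(s) depends only on j = level s. *)
Definition Z_lcsl (u : C) (j : nat) : C := (M_inf ^+ j *m Pi_B u) ord_max 0.

Definition xi : C := cexp (0 +i* (2 * pi / 5)).

Definition omega_tilde (k : nat) (u : C) : C :=
  - (1 / 5) * (1 / twopii ^+ 4) * csum (fun N =>
    (Gamma (N%:R + k%:R / 5) ^+ 5 / Gamma (5 * N%:R + k%:R))%:C *
      xpow u (- N%:R - k%:R / 5)).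

(* As xi^5 = 1, this only depends on j modulo 5. *)
Definition omega_inf (j : nat) (u : C) : C :=
  \sum_(1 <= k < 6) (1 - xi ^+ k) ^+ 4 * xi ^+ (k * j) * omega_tilde k u.

(* Near x = oo, Z_x(s) depends only on j = level s. *)
Definition Z_gepner (u : C) (j : nat) : C := omega_inf j u - omega_inf j.+1 u.

Definition quintic_type (Zx : nat -> C) (sigma : stability R) :=
  [/\ (forall s, charge sigma (stalk (simple R s)) = Zx (level s)),
      (forall Q, stable sigma Q <-> exists s, rep_iso Q (simple R s)),
      (forall s s', level s = level s' ->
         phase sigma (simple R s) = phase sigma (simple R s'))
    & (forall s s', (level s < level s')%N ->
         phase sigma (simple R s) < phase sigma (simple R s'))].

(* S_0 with "close to 0" meaning |x| < eps, and S_oo with "close to oo"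
   meaning B < |x|; here |x| = expR (Re u). *)
Definition S_0 (eps : R) (sigma : stability R) :=
  exists2 u : C, expR (complex.Re u) < eps & quintic_type (Z_lcsl u) sigma.

Definition S_inf (B : R) (sigma : stability R) :=
  exists2 u : C, B < expR (complex.Re u) & quintic_type (Z_gepner u) sigma.

End Periods.

(* Main.v *)
(* Any family of masses m_j > 0 and increasing phases phi_j with
   phi_{j+1} - phi_j < pi, j = 0, .., 15, defines a stability condition whose
   semistable objects are the representations concentrated in one level j, with
   phase phi_j; the space of such families is convex. A stability condition
   sigma near the Gepner point gives such a family, the bound on the steps
   coming from Ext^1(s, s') != 0 along an arrow s -> s', and by devissage its
   central charge is the one of the family. Near x = 0, along x = e^y with
   y -> -oo, w_k ~ c y^k gives Im(conj Z_j Z_{j+1}) > 0 for all j, so the charges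
   lift to such a family as well, and linear interpolation is a deformation.

   As X runs over the tilted heart at phi, the Euler characteristics of X at the
   vertices of level j are >= 0 if phi_j > phi and <= 0 otherwise, so equality of
   all tilted hearts forces equality of the phases. Since
   arg(Z_5 / Z_4) -> 0 as y -> -oo, the point x can be chosen such that
   the step phi_5 - phi_4 differs from that of sigma, which is unchanged by
   rotation. *)
Require Import Defs.
From HB Require Import structures.
From mathcomp Require Import all_boot all_order all_algebra.
From mathcomp Require Import ring lra zify complex.
From mathcomp Require Import all_classical all_reals all_analysis.
From mathcomp Require Import measurable_realfun.
Set Implicit Arguments.
Unset Strict Implicit.
Unset Printing Implicit Defensive.
Import Order.TTheory GRing.Theory Num.Theory.
Import numFieldNormedType.Exports.
Import VectorInternalTheory.
Local Open Scope classical_set_scope.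
Local Open Scope ring_scope.

(** * The Gamma function *)

(** Most of the analysis goes into [w_k ~ c y^k]: [w_ k] is a derivative in p of a limit of a series
    whose coefficients are quotients of integrals. For real y = log x the series equals exp (q y) *
    [gratio] q * H(q) near q = 0. Here [gratio] is its coefficient at n = 0, and H is a power series
    in exp y whose coefficients are rational in q, with derivatives bounded geometrically in n. So
    Gamma has to be differentiated only near 1, sum and derivative are exchanged only for rational
    functions, and y^k comes from k derivatives falling on exp (q y).

    Levels 4 and 5 are singled out by the coefficients of the dominant period w^(3) in Z_0, .., Z_5,
    which are 1, -4, 6, -4, 1, 1: only the last two neighbours have equal sign, so only that step
    tends to 0, while at a change of sign consecutive charges become opposite.

    A given sigma is not identified with a member of the convex space: its semistable objects are
    never determined, and its phase is arbitrary on other objects. The comparison uses only charges,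
    stable objects and their phases, and the path takes the value sigma at t = 0 alone. *)

Section GammaFunction.
Variable R : realType.
Local Notation mu := (@lebesgue_measure R).
Local Notation D := (`]0%R, +oo[%classic : set R).

Definition gpow (s t : R) : R := t `^ (s - 1) * expR (- t).

Lemma gpow_ge0 s t : 0 <= gpow s t.
Proof. by rewrite mulr_ge0 ?powR_ge0 ?expR_ge0. Qed.

Lemma measurable_gpow (E : set R) s : measurable_fun E (gpow s).
Proof.
apply: measurable_funTS; apply: measurable_funM.
  exact: measurable_powR.
by apply: measurableT_comp => //; exact: measurable_funN.
Qed.

Lemma is_derive_gpow (s t : R) : 0 < t ->
  is_derive t 1 (gpow (s + 1)) (s * gpow s t - gpow (s + 1) t).
Proof.
move=> t0; rewrite /gpow addrK.
have e : is_derive t 1 (fun x : R => expR (- x)) (- expR (- t)).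
  by apply: is_derive_eq; rewrite /GRing.scale/=; ring.
have p := is_derive1_powR s t0.
apply: is_derive_eq; rewrite /GRing.scale /=; ring.
Qed.

Lemma continuous_gpow s (t : R) : 0 < t -> {for t, continuous (gpow s)}.
Proof.
move=> t0; apply: differentiable_continuous.
by apply/derivable1_diffP; have := is_derive_gpow (s - 1) t0; rewrite subrK => h.
Qed.

Lemma within_continuous_gpow s (a b : R) : 0 < a ->
  {within `[a, b], continuous (gpow s)}.
Proof.
move=> a0; apply: derivable_within_continuous => t; rewrite in_itv => /= /andP[at_ _].
by have := is_derive_gpow (s - 1) (lt_le_trans a0 at_); rewrite subrK => h.
Qed.

(** The inequality ln x <= x at x = t / (2a), with a = s - 1, bounds a ln t by t / 2 + a ln (2a);
    hence the constant (2a)^a. *)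
Lemma gpow_le_expR s : 1 < s -> exists2 C : R, 0 < C &
  forall t, 0 < t -> gpow s t <= C * expR (- (t / 2)).
Proof.
move=> s1; pose a := s - 1; have a0 : 0 < a by rewrite subr_gt0.
exists (expR (a * ln (2 * a))) => [|t t0]; first exact: expR_gt0.
rewrite /gpow /powR gt_eqF// -!expRD ler_expR -/a.
have x0 : 0 < t / (2 * a) by rewrite divr_gt0// mulr_gt0.
have lnle : ln (t / (2 * a)) <= t / (2 * a).
  have := @le_ln1Dx R (t / (2 * a) - 1); rewrite addrCA subrr addr0 => h.
  apply: le_trans (h _) _; first by rewrite ltrDr.
  by rewrite gerBl.
have -> : ln t = ln (t / (2 * a)) + ln (2 * a).
  have a2 : 0 < 2 * a by rewrite mulr_gt0.
  by rewrite -lnM ?posrE//; congr ln; field; rewrite gt_eqF.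
have h2 : a * ln (t / (2 * a)) <= t / 2.
  have -> : t / 2 = a * (t / (2 * a)) by field; rewrite gt_eqF.
  by rewrite ler_pM2l.
rewrite mulrDr; lra.
Qed.

Lemma cvg_expR_half : expR (- (t / 2)) @[t --> +oo] --> (0 : R).
Proof.
have h2 : 0 < 2^-1 :> R by rewrite invr_gt0.
have h := @gt0_cvgMly R (pinfty_nbhs R) _ 2^-1 id h2 (@cvg_id _ _).
exact: (cvg_comp _ _ (h _) (@cvgr_expR R)).
Qed.

Lemma integrable_expR_half : mu.-integrable D (EFin \o (fun t => expR (- (t / 2)))).
Proof.
have dF (t : R) : is_derive t 1 (fun x : R => - 2 * expR (- (x / 2))) (expR (- (t / 2))).
  by apply: is_derive_eq; rewrite /GRing.scale /=; field.
have cF : continuous (fun x : R => - 2 * expR (- (x / 2))).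
  by move=> t; apply: differentiable_continuous; apply/derivable1_diffP.
have cf : continuous (fun x : R => expR (- (x / 2))).
  by move=> t; apply: differentiable_continuous; apply/derivable1_diffP.
apply: (@integrableS _ _ _ mu `[0%R, +oo[%classic) => //.
  by move=> t; rewrite /= !in_itv/= !andbT => /ltW.
apply/integrableP; split.
  by apply/measurable_EFinP; apply: measurable_funTS; exact: continuous_measurable_fun.
under eq_integral do rewrite /= ger0_norm ?expR_ge0//.
rewrite (@ge0_continuous_FTC2y _ _ (fun t : R => - 2 * expR (- (t / 2))) 0 0).
- by rewrite -EFinB ltry.
- by move=> *; exact: expR_ge0.
- exact: continuous_subspaceT.
- rewrite -[X in _ --> X](mulr0 (- 2)); apply: cvgMr.
  exact: cvg_expR_half.
- by move=> t _; exact: ex_derive.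
- by apply: cvg_at_right_filter; exact: cF.
- by move=> t _; rewrite derive1E; exact: derive_val.
Qed.

Lemma integrable_gpow1 s : 1 < s -> mu.-integrable D (EFin \o gpow s).
Proof.
move=> /gpow_le_expR[C C0 h].
apply: (@le_integrable _ _ _ mu _ _ _ (fun t : R => (C * expR (- (t / 2)))%:E)) => //.
- by apply/measurable_EFinP; exact: measurable_gpow.
- move=> t; rewrite /= in_itv/= andbT => t0.
  by rewrite lee_fin !ger0_norm ?gpow_ge0 ?mulr_ge0 ?expR_ge0 ?(ltW C0)// h.
- have mD : measurable (D : set (measurableTypeR R)) by exact: measurable_itv.
  exact: (@integrableZl _ _ _ mu D mD C _ integrable_expR_half).
Qed.

(** Integration by parts: [s * gpow s - gpow (s + 1)] is the derivative of [gpow (s + 1)]. The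
    interval stays away from 0, where [gpow s] may be unbounded. *)
Lemma integral_gpow_itv s (a b : R) : 0 < a -> a < b ->
  (\int[mu]_(t in `[a, b]) (s * gpow s t)%:E =
   (gpow (s + 1) b - gpow (s + 1) a)%:E +
   \int[mu]_(t in `[a, b]) (gpow (s + 1) t)%:E)%E.
Proof.
move=> a0 ab.
pose f := fun t : R => s * gpow s t - gpow (s + 1) t.
have cf : {within `[a, b], continuous f}.
  apply: derivable_within_continuous => t; rewrite in_itv => /= /andP[at_ _].
  have := is_derive_gpow s (lt_le_trans a0 at_).
  by have := is_derive_gpow (s - 1) (lt_le_trans a0 at_); rewrite subrK => h1 h2; rewrite /f.
have if_ : mu.-integrable `[a, b] (EFin \o f).
  by apply: continuous_compact_integrable => //; exact: segment_compact.
have ig : mu.-integrable `[a, b] (EFin \o gpow (s + 1)).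
  apply: continuous_compact_integrable; first exact: segment_compact.
  exact: within_continuous_gpow.
have dF (t : R) : 0 < t -> is_derive t 1 (gpow (s + 1)) (f t) by exact: is_derive_gpow.
have -> : (fun t => (s * gpow s t)%:E) = ((EFin \o f) \+ (EFin \o gpow (s + 1)))%E.
  by apply/funext => t /=; rewrite -EFinD /f subrK.
rewrite integralD//; congr (_ + _)%E.
rewrite (@continuous_FTC2 _ _ (gpow (s + 1)))//.
- split.
  + move=> t; rewrite in_itv/= => /andP[at_ _].
    by have := dF _ (lt_trans a0 at_) => h.
  + by apply: cvg_at_right_filter; exact: continuous_gpow.
  + by apply: cvg_at_left_filter; apply: continuous_gpow; exact: lt_trans ab.
- move=> t; rewrite in_itv/= => /andP[at_ _].
  by rewrite derive1E; have := dF _ (lt_trans a0 at_) => h; exact: derive_val.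
Qed.

(** Compact intervals exhausting the open half-line. The offset 2 makes the left end strictly
    smaller than the right one already at n = 0. *)
Let E_ (n : nat) : set R := `[n.+2%:R^-1, n.+2%:R].

Let E_bigcup : D = \bigcup_n E_ n.
Proof.
apply/seteqP; split=> [t|t [n _]].
  rewrite /= in_itv/= andbT => t0.
  have [n hn] : exists n : nat, Num.max t t^-1 < n%:R.
    by exists (Num.truncn (Num.max t t^-1)).+1; exact: truncnS_gt.
  exists n => //; rewrite /E_ /= in_itv/=.
  move: hn; rewrite gt_max => /andP[h1 h2].
  have hn2 : (n%:R <= n.+2%:R :> R) by rewrite ler_nat leqW.
  rewrite (ltW (lt_le_trans h1 hn2)) andbT.
  rewrite -[t]invrK lef_pV2 ?posrE ?invr_gt0 ?ltr0n//.
  exact: ltW (lt_le_trans h2 hn2).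
rewrite /E_ /= !in_itv/= andbT => /andP[h _].
by apply: lt_le_trans h; rewrite invr_gt0 ltr0n.
Qed.

Let cvg_int_E (f : R -> R) : (forall t, 0 <= f t) -> (forall A, measurable_fun A f) ->
  (\int[mu]_(t in E_ n) (f t)%:E @[n --> \oo] --> \int[mu]_(t in D) (f t)%:E)%E.
Proof.
move=> f0 mf; rewrite E_bigcup; apply: ge0_nondecreasing_set_cvg_integral.
- move=> m n mn; apply/subsetPset => t; rewrite /E_ /= !in_itv/= => /andP[h1 h2].
  apply/andP; split.
    by apply: le_trans h1; rewrite lef_pV2 ?posrE ?ltr0n// ler_nat !ltnS.
  by apply: le_trans h2 _; rewrite ler_nat !ltnS.
- by move=> n; exact: measurable_itv.
- by move=> n; apply/measurable_EFinP; exact: mf.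
- by move=> n t _; rewrite lee_fin.
Qed.

Lemma cvg_gpow_pinfty s : 1 < s -> gpow s n.+2%:R @[n --> \oo] --> (0 : R).
Proof.
move=> /gpow_le_expR[C C0 h].
apply: (@squeeze_cvgr _ _ _ _ (cst 0) (fun n => C * expR (- (n.+2%:R / 2)))).
- by apply: nearW => n; rewrite gpow_ge0/= h.
- exact: cvg_cst.
- rewrite -[X in _ --> X](mulr0 C); apply: cvgMr.
  have : (n.+2%:R : R) @[n --> \oo] --> +oo%R.
    have := @cvgr_idn R; rewrite -(@cvg_shiftn 2 _ (fun n : nat => n%:R : R)).
    by under eq_fun do rewrite addn2.
  by move=> hn; exact: (cvg_comp _ _ hn cvg_expR_half).
Unshelve. all: by end_near. Qed.

Lemma cvg_gpow_0 s : 1 < s -> gpow s n.+2%:R^-1 @[n --> \oo] --> (0 : R).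
Proof.
move=> s1.
apply: (@squeeze_cvgr _ _ _ _ (cst 0) (fun n => (n.+2%:R^-1 : R) `^ (s - 1))).
- apply: nearW => n; rewrite gpow_ge0/= /gpow ler_piMr ?powR_ge0//.
- exact: cvg_cst.
- have := @powR_cvg0 R (s - 1); rewrite subr_gt0 => /(_ s1).
  move/cvg_at_rightP => /(_ (fun n => n.+2%:R^-1)); apply; split => //.
  have := @cvg_harmonic R; rewrite -(@cvg_shiftn 1 _ (@harmonic R)).
  by under eq_fun do rewrite addn1.
Qed.

(** The boundary terms vanish at both ends because s + 1 > 1. Both sides are extended real integrals
    of nonnegative functions, so the identity is available before integrability is known. *)
Lemma integral_gpowS s : 0 < s ->
  (\int[mu]_(t in D) (s * gpow s t)%:E = \int[mu]_(t in D) (gpow (s + 1) t)%:E)%E.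
Proof.
move=> s0.
have s1 : 1 < s + 1 by rewrite ltrDr.
have h1 : (\int[mu]_(t in E_ n) (s * gpow s t)%:E @[n --> \oo] -->
           \int[mu]_(t in D) (s * gpow s t)%:E)%E.
  apply: cvg_int_E => [t|A]; first by rewrite mulr_ge0 ?gpow_ge0 ?ltW.
  by apply: measurable_funM => //; exact: measurable_gpow.
have h2 : (\int[mu]_(t in E_ n) (gpow (s + 1) t)%:E @[n --> \oo] -->
           \int[mu]_(t in D) (gpow (s + 1) t)%:E)%E.
  by apply: cvg_int_E => [t|A]; [exact: gpow_ge0|exact: measurable_gpow].
apply: (cvg_unique _ h1) => //.
have -> : (fun n => \int[mu]_(t in E_ n) (s * gpow s t)%:E)%E =
   (fun n => (gpow (s + 1) n.+2%:R - gpow (s + 1) n.+2%:R^-1)%:E +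
   \int[mu]_(t in E_ n) (gpow (s + 1) t)%:E)%E.
  apply/funext => n; rewrite -integral_gpow_itv ?invr_gt0 ?ltr0n//.
  by rewrite invf_plt ?posrE ?ltr0n// (@lt_trans _ _ 1)// ?invf_lt1 ?ltr1n.
suff : (((gpow (s + 1) n.+2%:R - gpow (s + 1) n.+2%:R^-1)%:E +
   \int[mu]_(t in E_ n) (gpow (s + 1) t)%:E)%E @[n --> \oo] -->
   (0%:E + \int[mu]_(t in D) (gpow (s + 1) t)%:E)%E) by rewrite add0e.
apply: cvgeD => //.
apply: cvg_EFin; first exact: nearW.
rewrite /comp /= -[X in _ --> X](subr0 (0 : R)).
by apply: cvgB; [exact: cvg_gpow_pinfty|exact: cvg_gpow_0].
Qed.

(** The functional equation carries finiteness of the integral from s + 1 > 1, where the exponential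
    bound applies, down to s > 0. *)
Lemma integrable_gpow s : 0 < s -> mu.-integrable D (EFin \o gpow s).
Proof.
move=> s0; apply/integrableP; split.
  by apply/measurable_EFinP; exact: measurable_gpow.
have s1 : 1 < s + 1 by rewrite ltrDr.
have norm_gpow a : (\int[mu]_(t in D) `|(EFin \o gpow a) t| = \int[mu]_(t in D) (gpow a t)%:E)%E.
  by under eq_integral do rewrite /= ger0_norm ?gpow_ge0//.
have /integrableP[_] := integrable_gpow1 s1.
rewrite !norm_gpow -integral_gpowS//.
under eq_integral do rewrite EFinM.
rewrite ge0_integralZl ?lee_fin ?ltW//; last 2 first.
- by apply/measurable_EFinP; exact: measurable_gpow.
- by move=> t _; rewrite lee_fin gpow_ge0.
rewrite !ltey; apply: contra => /eqP ->.
by rewrite gt0_muley ?lte_fin.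
Qed.

Lemma GammaE (s : R) : Gamma s = \int[mu]_(t in D) gpow s t.
Proof. by []. Qed.

Lemma GammaS (s : R) : 0 < s -> Gamma (s + 1) = s * Gamma s.
Proof.
move=> s0; rewrite !GammaE -RintegralZl//; last exact: integrable_gpow.
by rewrite /Rintegral integral_gpowS.
Qed.

(** For an argument at least 1 the integrand is at least exp (-2) on [1, 2]; the functional equation
    moves every s > 0 into that range. *)
Lemma Gamma_gt0 (s : R) : 0 < s -> 0 < Gamma s.
Proof.
suff h (a : R) : 1 <= a -> 0 < Gamma a.
  move=> s0; have := h (s + 1); rewrite lerDr (ltW s0) => /(_ isT).
  by rewrite GammaS// pmulr_rgt0.
move=> a1; have a0 : 0 < a by exact: lt_le_trans a1.
rewrite GammaE /Rintegral -lte_fin fineK; last first.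
  exact: integrable_fin_num (integrable_gpow a0).
apply: (@lt_le_trans _ _ (\int[mu]_(t in `[1%R, 2%R]) (expR (- 2))%:E)%E).
  rewrite integral_cst//= lebesgue_measure_itv/= lte_fin ltrDl ltr01.
  by rewrite -EFinB -EFinM lte_fin mulr_gt0 ?expR_gt0// addrK.
apply: (@le_trans _ _ (\int[mu]_(t in `[1%R, 2%R]) (gpow a t)%:E)%E).
  apply: ge0_le_integral => //.
  - by apply/measurable_EFinP; exact: measurable_gpow.
  - move=> t /=; rewrite in_itv/= => /andP[t1 t2].
    rewrite lee_fin /gpow -[leLHS]mul1r ler_pM ?expR_ge0 ?ler_expR ?lerN2//.
    by rewrite -[X in X <= _](powRr0 t) ler_powR// subr_ge0.
apply: ge0_subset_integral => //.
- by apply/measurable_EFinP; exact: measurable_gpow.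
- by move=> t _; rewrite lee_fin gpow_ge0.
- by move=> t /=; rewrite !in_itv/= andbT => /andP[t1 _]; exact: lt_le_trans t1.
Qed.

(** The k-th derivative of [gpow s t] in s. *)
Definition lngpow k s t : R := ln t ^+ k * gpow s t.

Lemma ln_expr_le k (e : R) : 0 < e -> exists2 C : R, 0 < C &
  forall t, 0 < t -> `|ln t| ^+ k <= C * (t `^ e + t `^ (- e)).
Proof.
move=> e0; exists (k`!%:R / e ^+ k) => [|t t0].
  by rewrite divr_gt0 ?ltr0n ?fact_gt0// exprn_gt0.
have h (x : R) : 0 <= x -> x ^+ k <= k`!%:R * expR x.
  case: k => [|k] x0; first by rewrite expr0 fact0 mul1r -expR0 ler_expR.
  rewrite mulrC -ler_pdivrMr ?ltr0n ?fact_gt0//.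
  by apply: le_trans (expR_ge1Dxn k x0); rewrite lerDr.
have := h (e * `|ln t|); rewrite mulr_ge0 ?(ltW e0)// => /(_ isT).
rewrite exprMn => {}h.
rewrite mulrAC ler_pdivlMr ?exprn_gt0// mulrC.
apply: le_trans h _; rewrite ler_pM2l ?ltr0n ?fact_gt0//.
rewrite /powR gt_eqF//.
have [l0|l0] := leP 0 (ln t).
  by rewrite ger0_norm// lerDl expR_ge0.
by rewrite ltr0_norm// mulrN mulNr lerDr expR_ge0.
Qed.

(** A power of t is monotone in the exponent, increasing for t >= 1 and decreasing for t < 1, so one
    of the two extreme exponents dominates. *)
Lemma gpow_le_add (u v s t : R) : 0 < t -> u <= s -> s <= v ->
  gpow s t <= gpow u t + gpow v t.
Proof.
move=> t0 us sv; rewrite /gpow -mulrDl ler_pM2r ?expR_gt0//.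
have [t1|t1] := leP 1 t.
  by rewrite -[leLHS]add0r lerD ?powR_ge0// ler_powR// lerD2r.
by rewrite -[leLHS]addr0 lerD ?powR_ge0// ger_powR ?t0 ?(ltW t1)// lerD2r.
Qed.

(** A majorant uniform in s on [u, v], as needed to differentiate under the integral: the power of
    ln t costs a factor t^(u/2) or t^(-u/2), which keeps the parameter between u / 2 > 0 and v + u /
    2. *)
Lemma lngpow_bound k (u v : R) : 0 < u -> u <= v -> exists2 C : R, 0 < C &
  forall s t, 0 < t -> u <= s <= v ->
    `|lngpow k s t| <= C * (gpow (u / 2) t + gpow (v + u / 2) t).
Proof.
move=> u0 uv; have e0 : 0 < u / 2 by rewrite divr_gt0.
have [C C0 h] := ln_expr_le k e0.
exists (C * 2) => [|s t t0 /andP[us sv]]; first by rewrite mulr_gt0.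
rewrite normrM normrX (ger0_norm (gpow_ge0 _ _)).
have hp a : t `^ a * gpow s t = gpow (s + a) t.
  rewrite /gpow mulrA -powRD; last by rewrite [t == 0]gt_eqF//= implybT.
  by congr (_ `^ _ * _); ring.
apply: le_trans (ler_wpM2r (gpow_ge0 _ _) (h t t0)) _.
rewrite -!mulrA ler_pM2l// mulrDl !hp.
have h1 : gpow (s + u / 2) t <= gpow (u / 2) t + gpow (v + u / 2) t.
  by apply: gpow_le_add => //; lra.
have h2 : gpow (s - u / 2) t <= gpow (u / 2) t + gpow (v + u / 2) t.
  by apply: gpow_le_add => //; lra.
by rewrite [2 * _]mulr_natl mulr2n lerD.
Qed.

Lemma integrable_lngpow k s : 0 < s -> mu.-integrable D (EFin \o lngpow k s).
Proof.
move=> s0; have [C C0 h] := lngpow_bound k s0 (lexx s).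
have mlg : measurable_fun D (lngpow k s).
  apply: measurable_funM; last exact: measurable_gpow.
  by apply: measurable_funX; apply: measurable_funTS; exact: measurable_ln.
apply: (@le_integrable _ _ _ mu _ _ _
    (fun t : R => C%:E * ((gpow (s / 2) t)%:E + (gpow (s + s / 2) t)%:E))%E) => //.
- exact/measurable_EFinP.
- move=> t; rewrite /= in_itv/= andbT => t0.
  rewrite lee_fin; apply: le_trans (h s t t0 _) _; first by rewrite lexx.
  by rewrite ler_norm.
- have mD : measurable (D : set (measurableTypeR R)) by exact: measurable_itv.
  apply: (@integrableZl _ _ _ mu D mD C).
  by apply: integrableD => //; apply: integrable_gpow; lra.
Qed.

Definition dGamma k s : R := \int[mu]_(t in D) lngpow k s t.

Lemma dGamma0 s : dGamma 0 s = Gamma s.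
Proof. by apply: eq_Rintegral => t _; rewrite /lngpow expr0 mul1r. Qed.

Lemma is_derive_lngpow k (s t : R) : 0 < t ->
  is_derive s 1 (fun s => lngpow k s t) (lngpow k.+1 s t).
Proof.
move=> t0.
have -> : (fun s => lngpow k s t) = (fun s => (ln t ^+ k * expR (- t)) * expR ((s - 1) * ln t)).
  by apply/funext => x; rewrite /lngpow /gpow /powR gt_eqF// mulrA mulrAC.
apply: is_derive_eq; rewrite /lngpow /gpow /powR gt_eqF// /GRing.scale/= exprS; ring.
Qed.

Lemma is_derive_dGamma k (s : R) : 0 < s -> is_derive s 1 (dGamma k) (dGamma k.+1 s).
Proof.
move=> s0; pose u := s / 2; pose v := s + 1.
have u0 : 0 < u by rewrite divr_gt0.
have uv : u <= v by rewrite /u /v; lra.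
have [C C0 h] := lngpow_bound k.+1 u0 uv.
pose G t := C * (gpow (u / 2) t + gpow (v + u / 2) t).
have G0 t : 0 <= G t by rewrite mulr_ge0 ?addr_ge0 ?gpow_ge0 ?ltW.
have mD : measurable (D : set (measurableTypeR R)) by exact: measurable_itv.
have iG : mu.-integrable D (EFin \o G).
  apply: (@integrableZl _ _ _ mu D mD C
    (fun t => (gpow (u / 2) t)%:E + (gpow (v + u / 2) t)%:E)%E).
  by apply: integrableD => //; apply: integrable_gpow; rewrite /u /v; lra.
have I_s : `]u, v[%classic s by rewrite /= in_itv/= /u /v; lra.
have Ipos x : `]u, v[%classic x -> 0 < x /\ u <= x <= v.
  by rewrite /= in_itv/= => /andP[ux xv]; split; [exact: lt_trans ux|rewrite !ltW].
have intf x : `]u, v[%classic x -> mu.-integrable D (EFin \o lngpow k x).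
  by move=> /Ipos[x0 _]; exact: integrable_lngpow.
have derf (x t : R) : `]u, v[%classic x -> D t -> derivable (fun s => lngpow k s t) x 1.
  by move=> _; rewrite /= in_itv/= andbT => /(is_derive_lngpow k x) => i.
have partE (x t : R) : D t -> partial1of2 (lngpow k) x t = lngpow k.+1 x t.
  rewrite /= in_itv/= andbT => /(is_derive_lngpow k x) => i.
  by rewrite partial1of2E; exact: derive_val.
have Gub (x t : R) : `]u, v[%classic x -> D t -> `|partial1of2 (lngpow k) x t| <= G t.
  move=> /Ipos[_ xuv] Dt; rewrite partE//.
  by apply: h => //; move: Dt; rewrite /= in_itv/= andbT.
apply: DeriveDef.
  exact: (@derivable_under_integral _ _ _ mu (lngpow k) D mD s u v I_s intf derf G G0 iG Gub).
rewrite -derive1E.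
rewrite (@differentiation_under_integral _ _ _ mu (lngpow k) D mD s u v I_s intf derf G G0 iG Gub).
by apply: eq_Rintegral => t; rewrite inE => /partE.
Qed.

End GammaFunction.

(** * Derivatives of function series *)

Section Jets.
Variable R : realType.
Implicit Types (f : R -> R) (g h : nat -> R -> R) (r : R).

(* [g i] stands for the i-th derivative of [g 0]. *)
Definition jet (N : nat) r g := forall i (q : R), (i < N)%N -> `|q| < r ->
  is_derive q 1 (g i) (g i.+1 q).

Definition jet_le (N : nat) r (A : R) g := forall i (q : R), (i <= N)%N -> `|q| < r ->
  `|g i q| <= A.

(** The Leibniz formula for the k-th derivative of a product. *)
Definition jmul g h (k : nat) (q : R) : R :=
  \sum_(i < k.+1) 'C(k, i)%:R * (g i q * h (k - i)%N q).

Lemma jmul0 g h q : jmul g h 0%N q = g 0%N q * h 0%N q.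
Proof. by rewrite /jmul big_ord_recl big_ord0 addr0 bin0 mul1r subnn. Qed.

Lemma jmulS g h k q : jmul g h k.+1 q =
  \sum_(i < k.+1) 'C(k, i)%:R *
    (g i.+1 q * h (k - i)%N q + g i q * h (k - i).+1 q).
Proof.
rewrite /jmul big_ord_recl bin0 mul1r subn0.
under eq_bigr => i _ do rewrite lift0 subSS binS natrD mulrDl.
rewrite big_split /= addrA.
under [RHS]eq_bigr => i _ do rewrite mulrDr.
rewrite [RHS]big_split /= [RHS]addrC; congr (_ + _).
rewrite big_ord_recr /= bin_small// mul0r addr0.
rewrite [in RHS]big_ord_recl/= bin0 mul1r subn0; congr (_ + _).
apply: eq_bigr => i _; rewrite /bump /= add1n; congr (_ * (_ * h _ q)).
by rewrite subnS prednK// subn_gt0.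
Qed.

Lemma jet_mul N r g h : jet N r g -> jet N r h -> jet N r (jmul g h).
Proof.
move=> jg jh k q kN qr; rewrite jmulS.
have -> : jmul g h k = \sum_(i < k.+1) (fun q => 'C(k, i)%:R * (g i q * h (k - i)%N q)).
  by apply/funext => x; rewrite fct_sumE.
apply: is_derive_sum => i.
have ik : (i < N)%N by rewrite (leq_ltn_trans _ kN)// -ltnS.
have kik : (k - i < N)%N by rewrite (leq_ltn_trans _ kN)// leq_subr.
have d1 := jg _ _ ik qr; have d2 := jh _ _ kik qr.
by apply: is_derive_eq; rewrite /GRing.scale/=; ring.
Qed.

(** The binomial coefficients add up to 2^k <= 2^N. One such factor per multiplication keeps the
    bounds on n-fold products geometric in n. *)
Lemma jet_le_mul N r A B g h : jet_le N r A g -> jet_le N r B h ->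
  jet_le N r (2 ^+ N * (A * B)) (jmul g h).
Proof.
move=> bg bh k q kN qr.
have A0 : 0 <= A by apply: le_trans (bg 0%N q _ qr).
have B0 : 0 <= B by apply: le_trans (bh 0%N q _ qr).
apply: le_trans (ler_norm_sum _ _ _) _.
apply: (@le_trans _ _ (\sum_(i < k.+1) 'C(k, i)%:R * (A * B))).
  apply: ler_sum => i _; rewrite !normrM ger0_norm// ler_wpM2l// ler_pM//.
    by apply: bg => //; rewrite (leq_trans _ kN)// -ltnS.
  by apply: bh => //; rewrite (leq_trans _ kN)// leq_subr.
rewrite -mulr_suml ler_wpM2r ?mulr_ge0//.
have -> : \sum_(i < k.+1) 'C(k, i)%:R = 2 ^+ k :> R.
  rewrite -natr_sum -natrX -[2%N]/(1 + 1)%N Pascal; congr _%:R.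
  by apply: eq_bigr => i _; rewrite !exp1n !muln1.
by rewrite ler_weXn2l// ler1n.
Qed.

(** Derivatives are local, so agreement on the ball suffices; this identifies [derive1n] of a limit
    of series that is controlled only near 0. *)
Lemma derive1n_jet N r g f : jet N r g -> (forall q : R, `|q| < r -> f q = g 0%N q) ->
  forall k (q : R), (k <= N)%N -> `|q| < r -> derive1n k f q = g k q.
Proof.
move=> jg fg; elim=> [|k IH] q kN qr; first exact: fg.
rewrite derive1nS derive1E.
have d := jg _ _ kN qr.
rewrite -(@derive_val _ _ _ _ _ _ _ d).
apply: near_eq_derive.
have : \forall x \near q, `|x| < r.
  have h : {for q, continuous (fun x : R => `|x|)} by exact: norm_continuous.
  exact: (cvgr_lt _ h).
by apply: filterS => x xr; apply: IH => //; exact: ltnW.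
Qed.

(** Quadratic remainder bounds, unlike difference quotients, can be added up over the terms of a
    series; derivatives of sums are recovered from them. *)
Lemma is_derive_quad f (q d K e : R) : 0 < e ->
  (forall x, `|x| < e -> `|f (q + x) - f q - x * d| <= K * x ^+ 2) ->
  is_derive q 1 f d.
Proof.
move=> e0 H; have K0 : 0 <= K.
  have e2 : 0 < (e / 2) ^+ 2 by rewrite exprn_gt0// divr_gt0.
  rewrite -(pmulr_lge0 _ e2); apply: le_trans (H (e / 2) _) => //.
  by rewrite ger0_norm ?ltW ?divr_gt0//; lra.
have L : h^-1 *: (f (h *: (1 : R) + q) - f q) @[h --> 0^'] --> d.
  apply/cvgrPdist_le => eps eps0; near=> x.
  have x0 : x != 0 by near: x; exact: nbhs_dnbhs_neq.
  have xe : `|x| < e by near: x; apply: dnbhs0_lt.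
  have xe2 : `|x| < eps / (K + 1).
    by near: x; apply: dnbhs0_lt; rewrite divr_gt0// ltr_wpDl.
  rewrite /GRing.scale/= mulr1 [x + q]addrC.
  have -> : d - x^-1 * (f (q + x) - f q) = - x^-1 * (f (q + x) - f q - x * d).
    by field.
  rewrite normrM normrN normfV ler_pdivrMl ?normr_gt0//.
  apply: le_trans (H x xe) _; rewrite -real_normK ?num_real// expr2 mulrA mulrC.
  rewrite ler_wpM2l//.
  apply: (@le_trans _ _ ((K + 1) * `|x|)); first by rewrite ler_wpM2r// lerDl.
  by rewrite mulrC -ler_pdivlMr ?ltr_wpDl// ltW.
by apply: DeriveDef; [apply/cvg_ex; exists d|exact/cvg_lim].
Unshelve. all: by end_near. Qed.

(** The mean value inequality, with a and b in either order. *)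
Lemma lipschitz_segment f (f' : R -> R) (a b K : R) :
  (forall x, `|x - a| <= `|b - a| -> is_derive x 1 f (f' x) /\ `|f' x| <= K) ->
  `|f b - f a| <= K * `|b - a|.
Proof.
move=> H.
have seg c d x : ((c = a /\ d = b) \/ (c = b /\ d = a)) -> c <= x <= d -> `|x - a| <= `|b - a|.
  by case=> -[-> ->] /andP[h1 h2]; rewrite ler_norml; apply/andP; split;
     have := ler_norm (b - a); have := ler_norm (a - b); rewrite (distrC a b); lra.
suff G c d : ((c = a /\ d = b) \/ (c = b /\ d = a)) -> c <= d -> `|f d - f c| <= K * `|d - c|.
  have [ab|/ltW ba] := leP a b; first exact: G (or_introl _ _) ab.
  rewrite distrC [`|b - a|]distrC; exact: G (or_intror _ _) ba.
move=> cd_ cd.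
have [||x xcd ->] := @MVT_segment R f f' c d cd.
- move=> x; rewrite in_itv/= => /andP[h1 h2].
  by have [] := H x (seg c d x cd_ (introT andP (conj (ltW h1) (ltW h2)))).
- apply: derivable_within_continuous => x; rewrite in_itv/= => h.
  by have [] := H x (seg c d x cd_ h).
by move: xcd; rewrite in_itv/= => h; rewrite normrM ler_wpM2r//; have [] := H x (seg c d x cd_ h).
Qed.

(** The mean value inequality applied twice: to the derivative of order i + 1, then to [g i] minus
    its linear part. *)
Lemma jet_taylor2 N r g (B : R) i (q x : R) : jet N r g -> jet_le N r B g ->
  (i.+2 <= N)%N -> `|q| + `|x| < r ->
  `|g i (q + x) - g i q - x * g i.+1 q| <= B * x ^+ 2.
Proof.
move=> jg bg iN qxr.
have ball y : `|y - q| <= `|x| -> `|y| < r.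
  move=> h; apply: le_lt_trans qxr; rewrite -[y](subrK q) addrC.
  by apply: le_trans (ler_normD _ _) _; rewrite lerD2l.
have xE : q + x - q = x by rewrite addrC addKr.
have l1 y : `|y - q| <= `|x| -> `|g i.+1 y - g i.+1 q| <= B * `|x|.
  move=> yx; apply: (@le_trans _ _ (B * `|y - q|)).
    apply: (@lipschitz_segment _ (g i.+2)) => z zy.
    have zr := ball z (le_trans zy yx).
    by split; [exact: jg|exact: bg].
  rewrite ler_wpM2l//; apply: le_trans (bg 0%N q _ _) => //; apply: ball.
  by rewrite subrr normr0.
have := @lipschitz_segment (fun y => g i y - y * g i.+1 q) (fun y => g i.+1 y - g i.+1 q)
  q (q + x) (B * `|x|).
rewrite xE => H.
have -> : g i (q + x) - g i q - x * g i.+1 q =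
  g i (q + x) - (q + x) * g i.+1 q - (g i q - q * g i.+1 q) by ring.
rewrite -real_normK ?num_real// expr2 mulrA; apply: H => y yx; split; last exact: l1.
have d := jg i y (ltnW iN) (ball y yx).
by apply: is_derive_eq; rewrite /GRing.scale/=; ring.
Qed.

(** * Termwise differentiation of power series with parameter *)

Section Series.
Variables (N : nat) (r A x : R) (g : nat -> nat -> R -> R).
Hypotheses (jg : forall n, jet N r (g n)) (bg : forall n, jet_le N r (A ^+ n) (g n)).
Hypotheses (A0 : 0 <= A) (x0 : 0 <= x) (Ax : A * x <= 1 / 2).

Definition jseries i q : R := limn (series (fun n => g n i q * x ^+ n)).

Let half_cvg : cvgn (series (geometric (1 : R) (1 / 2))).
Proof. by apply: is_cvg_geometric_series; rewrite ger0_norm// ltr_pdivrMr// mul1r ltr1n. Qed.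

Let lim_half : limn (series (geometric (1 : R) (1 / 2))) = 2.
Proof.
have h := @cvg_geometric_series R 1 (1 / 2).
rewrite (cvg_lim _ (h _))//; first by field.
by rewrite ger0_norm// ltr_pdivrMr// mul1r ltr1n.
Qed.

Let half_le (v : R^nat) B : (forall n, `|v n| <= B * (1 / 2) ^+ n) ->
  cvgn (series v) /\ `|limn (series v)| <= B * 2.
Proof.
move=> vB.
have B0 : 0 <= B by have := vB 0%N; rewrite expr0 mulr1; exact: le_trans.
have cB : cvgn (series (fun n => B * geometric (1 : R) (1 / 2) n)).
  exact: (@is_cvg_seriesZ _ _ B half_cvg).
have eB : limn (series (fun n => B * geometric (1 : R) (1 / 2) n)) = B * 2.
  by rewrite -[in RHS]lim_half; exact: (lim_seriesZ B half_cvg).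
have h n : `|v n| <= B * geometric (1 : R) (1 / 2) n by rewrite /geometric /= [1 * _ ^+ _]mul1r.
have cn : cvgn [normed series v].
  apply: (series_le_cvg _ _ h cB) => n; first exact: normr_ge0.
  exact: le_trans (h n).
split; first exact: normed_cvg.
apply: le_trans (lim_series_norm cn) _; rewrite -eB.
exact: (lim_series_le cn cB h).
Qed.

Let Axn n : A ^+ n * x ^+ n <= (1 / 2) ^+ n.
Proof.
by rewrite -exprMn; case: n => [|n]; rewrite ?expr0// ler_pXn2r ?nnegrE ?mulr_ge0.
Qed.

Let le_half u B n : 0 <= B -> `|u| <= B * A ^+ n -> `|u * x ^+ n| <= B * (1 / 2) ^+ n.
Proof.
move=> B0 uB; rewrite normrM [`|x ^+ n|]ger0_norm ?exprn_ge0//.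
apply: le_trans (ler_wpM2r _ uB) _; first by rewrite exprn_ge0.
by rewrite -mulrA ler_wpM2l// Axn.
Qed.

Lemma cvg_jseries i q : (i <= N)%N -> `|q| < r ->
  cvgn (series (fun n => g n i q * x ^+ n)).
Proof. by move=> iN qr; apply: (@half_le _ 1 _).1 => n; apply: le_half => //; rewrite mul1r; exact: bg. Qed.

(** The quadratic remainder of the n-th term is at most A^n x^n y^2, and A x <= 1 / 2 makes their
    sum at most 2 y^2. This uses the derivative of order i + 2, hence the loss of one order. *)
Lemma jet_jseries : jet N.-1 r jseries.
Proof.
move=> i q iN qr; have iN2 : (i.+2 <= N)%N by case: N iN.
have e0 : 0 < r - `|q| by rewrite subr_gt0.
apply: (@is_derive_quad _ _ _ 2 _ e0) => y ye.
have qyr : `|q| + `|y| < r by rewrite addrC -ltrBrDr.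
have qy : `|q + y| < r by exact: le_lt_trans (ler_normD _ _) qyr.
have c1 := cvg_jseries (ltnW (ltnW iN2)) qy.
have c2 := cvg_jseries (ltnW (ltnW iN2)) qr.
have c3 := cvg_jseries (ltnW iN2) qr.
have c3' := @is_cvg_seriesZ _ _ y c3.
have e3 : y * jseries i.+1 q = limn (series (y *: (fun n => g n i.+1 q * x ^+ n))).
  exact/esym/(lim_seriesZ y c3).
rewrite e3 /jseries -lim_seriesB// -lim_seriesB//; last first.
  exact: is_cvg_seriesB.
have -> : (fun n => g n i (q + y) * x ^+ n) - (fun n => g n i q * x ^+ n)
   - y *: (fun n => g n i.+1 q * x ^+ n) =
   (fun n => (g n i (q + y) - g n i q - y * g n i.+1 q) * x ^+ n).
  by apply/funext => n; rewrite !fctE /GRing.scale/=; ring.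
rewrite mulrC; apply: (@half_le _ (y ^+ 2) _).2 => n.
apply: le_half; first exact: sqr_ge0.
by rewrite [leRHS]mulrC; exact: (jet_taylor2 (jg n) (bg n)).
Qed.

(** Every term but the zeroth carries a factor A x, so the sum tends to its zeroth term as x tends
    to 0. *)
Lemma jseries_sub i q : (i <= N)%N -> `|q| < r ->
  `|jseries i q - g 0%N i q| <= 4 * A * x.
Proof.
move=> iN qr; have c := cvg_jseries iN qr.
pose d (n : nat) : R := (n == 0)%:R * g 0%N i q.
have d_cvg : series d n @[n --> \oo] --> g 0%N i q.
  apply: cvg_near_cst; exists 1%N => // n n1; rewrite /series/= big_ltn//.
  by rewrite big_nat_cond big1 ?addr0 /d ?mul1r// => -[]// k _; rewrite mul0r.
have -> : g 0%N i q = limn (series d) by exact/esym/cvg_lim.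
have dc : cvgn (series d) by apply/cvg_ex; exists (g 0%N i q).
rewrite -lim_seriesB// (_ : 4 * A * x = 2 * (A * x) * 2); last by ring.
apply: (half_le _).2 => -[|n]; rewrite !fctE /d /=.
  by rewrite !expr0 !mulr1 !mul1r subrr normr0 !mulr_ge0.
rewrite mul0r subr0 normrM [`|x ^+ n.+1|]ger0_norm ?exprn_ge0//.
apply: le_trans (ler_wpM2r _ (@bg n.+1 i q iN qr)) _; first by rewrite exprn_ge0.
rewrite !exprS mulrACA (_ : 2 * (A * x) * (1 / 2 * (1 / 2) ^+ n) = A * x * (1 / 2) ^+ n).
  by rewrite ler_wpM2l// mulr_ge0.
by field.
Qed.

End Series.

(** Differentiability to order N with no control on the size of the derivatives; enough for
    [gratio], a single factor independent of the summation index. *)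
Fixpoint smooth (N : nat) r f : Prop := if N is N'.+1 then
  exists2 f' : R -> R, (forall q : R, `|q| < r -> is_derive q 1 f (f' q)) & smooth N' r f'
  else True.

Lemma smoothW N r f : smooth N.+1 r f -> smooth N r f.
Proof.
elim: N f => [//|N IH] f [f' df sf]; exists f' => //; exact: IH.
Qed.

Lemma smooth_jet N r f : smooth N r f -> exists2 g, g 0%N = f & jet N r g.
Proof.
elim: N f => [f _|N IH f [f' df /IH[g g0 jg]]]; first by exists (fun=> f).
exists (fun i => if i is j.+1 then g j else f) => // -[|i] q iN qr; last exact: jg.
by rewrite g0; exact: df.
Qed.

Lemma smooth_cst N r (c : R) : smooth N r (fun=> c).
Proof.
elim: N c => // N IH c; exists (fun=> 0); last exact: IH.
by move=> q _; exact: is_derive_cst.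
Qed.

Lemma smooth_add N r f (h : R -> R) : smooth N r f -> smooth N r h -> smooth N r (fun q => f q + h q).
Proof.
elim: N f h => // N IH f h [f' df sf] [h' dh sh].
exists (fun q => f' q + h' q); last exact: IH.
by move=> q qr; have d1 := df q qr; have d2 := dh q qr; exact: is_deriveD.
Qed.

Lemma smooth_mul N r f (h : R -> R) : smooth N r f -> smooth N r h -> smooth N r (fun q => f q * h q).
Proof.
elim: N f h => // N IH f h sf sh; have := (smoothW sf, smoothW sh).
case: sf sh => [f' df sf] [h' dh sh] [sf0 sh0].
exists (fun q => f' q * h q + f q * h' q).
  move=> q qr; have d1 := df q qr; have d2 := dh q qr.
  by apply: is_derive_eq; rewrite /GRing.scale/=; ring.
by apply: smooth_add; exact: IH.
Qed.

Lemma smooth_inv N r f : (forall q, `|q| < r -> f q != 0) -> smooth N r f ->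
  smooth N r (fun q => (f q)^-1).
Proof.
move=> f0; elim: N => // N IH sf; have sV := IH (smoothW sf).
case: sf => [f' df sf].
exists (fun q => (- 1) * f' q * ((f q)^-1 * (f q)^-1)).
  move=> q qr; have d1 := df q qr; have d2 := is_deriveV (f0 q qr) d1.
  apply: is_derive_eq; rewrite /GRing.scale/= ; field; exact: f0.
apply: smooth_mul; last exact: smooth_mul.
by apply: smooth_mul => //; exact: smooth_cst.
Qed.

End Jets.

(** * The periods near the large complex structure limit *)

Section HypergeometricSeries.
Variable R : realType.
(** For |q| < 1 / 10 the number 1 + 5 q exceeds 1 / 2, so Gamma is evaluated at positive arguments
    only. *)
Local Notation rad := (1 / 10 : R).

(* The jet of 5 - c / (m + q) = (5 (m + q) - c) / (m + q). *)
Definition linfrac (c m : R) (i : nat) (q : R) : R :=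
  (i == 0)%:R * 5 - c * ((-1) ^+ i * i`!%:R / (q + m) ^+ i.+1).

Let mq_gt (m q : R) : 1 <= m -> `|q| < rad -> 1 / 2 < q + m.
Proof. by move=> m1; rewrite ltr_norml => /andP[q1 q2]; lra. Qed.

Lemma jet_linfrac N c m : 1 <= m -> jet N rad (linfrac c m).
Proof.
move=> m1 i q _ qr.
have mq0 : q + m != 0 by rewrite gt_eqF// (lt_trans _ (mq_gt m1 qr)).
have X0 : (q + m) ^+ i.+1 != 0 by rewrite expf_neq0.
rewrite /linfrac.
have d1 : is_derive q 1 (fun q : R => (q + m) ^+ i.+1) (i.+1%:R * (q + m) ^+ i).
  have d0 : is_derive q 1 (fun q : R => q + m) 1.
    by apply: is_derive_eq; rewrite addr0.
  have := @is_deriveX _ _ (fun q : R => q + m) i.+1 q 1 1 d0.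
  by rewrite exprfctE /GRing.scale/= mulr1.
pose h (q : R) := (q + m) ^+ i.+1.
have hq0 : h q != 0 by [].
have d2 := is_deriveV hq0 d1.
rewrite -/(h _).
apply: is_derive_eq; rewrite /h /GRing.scale/= factS natrM !exprS.
move: X0; rewrite exprS mulf_eq0 negb_or => /andP[_ X0].
field; by rewrite X0 mq0.
Qed.

(** Here 4 bounds c, 24 = 4! bounds the factorial, and 32 = 2^5 bounds the inverse power because q +
    m > 1 / 2. The order is 4 since summation loses one order and [w_ 3] takes three derivatives. *)
Lemma jet_le_linfrac c m : 0 <= c <= 4 -> 1 <= m ->
  jet_le 4 rad (5 + 4 * (24 * 32)) (linfrac c m).
Proof.
move=> /andP[c0 c4] m1 i q i4 qr; rewrite /linfrac.
have mq := mq_gt m1 qr; have mq0 : 0 < q + m by lra.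
apply: le_trans (ler_normB _ _) _.
apply: lerD; first by case: eqP => _; rewrite ?mul1r ?mul0r ?normr0// ger0_norm.
rewrite normrM (ger0_norm c0) ler_pM// normrM normrM normrX normrN1 expr1n mul1r.
rewrite ler_pM//.
  by rewrite ger0_norm// (ler_nat _ _ 24); case: i i4 => [|[|[|[|[|]]]]].
rewrite ger0_norm; last by rewrite invr_ge0 exprn_ge0// ltW.
apply: (@le_trans _ _ (2 ^+ i.+1)).
  rewrite -exprVn ler_pXn2r ?nnegrE ?invr_ge0 ?(ltW mq0)//.
  by rewrite invf_ple ?posrE//; lra.
apply: (@le_trans _ _ (2 ^+ 5)); last by rewrite -natrX ler_nat.
by rewrite ler_weXn2l// ler1n.
Qed.

Definition block (m : R) : nat -> R -> R :=
  jmul (jmul (jmul (jmul (linfrac 0 m) (linfrac 1 m)) (linfrac 2 m)) (linfrac 3 m)) (linfrac 4 m).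

(* The quotient of the n-th by the 0-th coefficient of w(x, q): from n-1 to n,
   Gamma(1+5(n+q)) gains the factors 5(n+q) - c, c = 0, .., 4, and
   Gamma(1+(n+q))^5 the factor (n+q)^5. *)
Fixpoint pochratio (n : nat) : nat -> R -> R :=
  if n is n'.+1 then jmul (pochratio n') (block n%:R) else fun i _ => (i == 0)%:R.

Lemma jet_pochratio N n : jet N rad (pochratio n).
Proof.
elim: n => [|n IH] /=; first by move=> i q _ _; exact: is_derive_cst.
have n1 : 1 <= n.+1%:R :> R by rewrite ler1n.
by apply: (jet_mul IH (jet_mul (jet_mul (jet_mul (jet_mul _ _) _) _) _)); exact: jet_linfrac.
Qed.

(** All factors [block m] with m >= 1 share one bound, so each of the n multiplications costs the
    same constant. *)
Lemma jet_le_pochratio : exists2 B : R, 0 <= B &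
  forall n, jet_le 4 rad (B ^+ n) (pochratio n).
Proof.
have [A A0 lfA] : exists2 A : R, 0 <= A & forall c m, 0 <= c <= 4 -> 1 <= m ->
    jet_le 4 rad A (linfrac c m).
  exists (5 + 4 * (24 * 32)); last exact: jet_le_linfrac.
  by rewrite addr_ge0// !mulr_ge0.
have K0 : 0 <= 2 ^+ 4 :> R by rewrite exprn_ge0.
have [B B0 blockB] : exists2 B : R, 0 <= B & forall m, 1 <= m -> jet_le 4 rad B (block m).
  exists (2 ^+ 4 * (2 ^+ 4 * (2 ^+ 4 * (2 ^+ 4 * (A * A) * A) * A) * A)).
    by do 9?[apply: mulr_ge0 => //].
  move=> m m1.
  have lf (k : nat) : (k <= 4)%N -> jet_le 4 rad A (linfrac k%:R m).
    by move=> k4; apply: lfA => //; rewrite ler0n ler_nat.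
  exact: (jet_le_mul (jet_le_mul (jet_le_mul (jet_le_mul
    (lf 0%N _) (lf 1%N _)) (lf 2%N _)) (lf 3%N _)) (lf 4%N _)).
exists (2 ^+ 4 * B) => [|n]; first exact: mulr_ge0.
elim: n => [|n IH] /=.
  by move=> i q _ _; rewrite expr0; case: eqP => _; rewrite ?normr0 ?normr1.
suff -> : (2 ^+ 4 * B) ^+ n.+1 = 2 ^+ 4 * ((2 ^+ 4 * B) ^+ n * B).
  by apply: jet_le_mul IH (blockB _ _); rewrite ler1n.
by rewrite exprS; ring.
Qed.

Lemma Gamma_add5 (s : R) : 0 < s ->
  Gamma (s + 5) = (s + 4) * (s + 3) * (s + 2) * (s + 1) * s * Gamma s.
Proof.
move=> s0.
have -> : s + 5 = s + 1 + 1 + 1 + 1 + 1 by ring.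
by rewrite !GammaS ?addr_gt0//; ring.
Qed.

Definition gratio (q : R) : R := Gamma (1 + 5 * q) / Gamma (1 + q) ^+ 5.

(** Separates Gamma, which remains only in [gratio], from n, which remains only in a product of
    rational functions of q. *)
Lemma pochratioE n (q : R) : `|q| < rad ->
  Gamma (1 + 5 * (n%:R + q)) / Gamma (1 + (n%:R + q)) ^+ 5 = gratio q * pochratio n 0%N q.
Proof.
move=> qr; elim: n => [|n IH] /=; first by rewrite !add0r mulr1.
have n0 : 0 <= n%:R :> R by [].
have nq : 0 < 1 + (n%:R + q) by have := mq_gt (lexx (1 : R)) qr; lra.
have nq5 : 0 < 1 + 5 * (n%:R + q) by move: qr; rewrite ltr_norml => /andP[q1 q2]; lra.
have -> : 1 + 5 * (n.+1%:R + q) = 1 + 5 * (n%:R + q) + 5 by rewrite -natr1; ring.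
have -> : 1 + (n.+1%:R + q) = 1 + (n%:R + q) + 1 by rewrite -natr1; ring.
rewrite Gamma_add5// GammaS// /block !jmul0 mulrA -IH /linfrac /= !expr1 expr0 fact0 -[n.+1%:R]natr1.
have G0 := Gamma_gt0 nq.
have h : q + (n%:R + 1) != 0 by rewrite gt_eqF//; lra.
field.
by rewrite h !gt_eqF.
Qed.

(** Stated for all k and all scalars b because differentiation raises k and multiplies b by a, so
    the family is stable under it. *)
Lemma smooth_dGamma N k (a b : R) : 0 <= a <= 5 -> smooth N rad (fun q => b * dGamma k (1 + a * q)).
Proof.
elim: N k b => // N IH k b a5.
exists (fun q => (b * a) * dGamma k.+1 (1 + a * q)); last exact: IH.
move=> q qr.
have p : 0 < 1 + a * q.
  move: qr a5; rewrite ltr_norml => /andP[q1 q2] /andP[a0 a5]; nra.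
have d : is_derive (1 + a * q) 1 (@dGamma R k) (dGamma k.+1 (1 + a * q)) by exact: is_derive_dGamma.
have d2 : is_derive q 1 (fun q : R => 1 + a * q) a.
  by apply: is_derive_eq; rewrite /GRing.scale/=; ring.
have d3 : is_derive q 1 (dGamma k \o (fun q => 1 + a * q)) (dGamma k.+1 (1 + a * q) * a).
  by apply: is_derive1_comp.
have -> : (fun q0 => b * dGamma k (1 + a * q0)) = b \*: (dGamma k \o (fun q => 1 + a * q)) by [].
apply: is_derive_eq; rewrite /GRing.scale/=; ring.
Qed.

Lemma smooth_gratio N : smooth N rad gratio.
Proof.
have h a : 0 <= a <= 5 -> smooth N rad (fun q => Gamma (1 + a * q)).
  move=> a5; have := @smooth_dGamma N 0%N a 1 a5.
  by congr (smooth _ _ _); apply/funext => q; rewrite mul1r dGamma0.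
have h1 := h 1 _; have h5 := h 5 _.
have G1 : smooth N rad (fun q : R => (Gamma (1 + q))^-1).
  apply: smooth_inv.
    move=> q qr; rewrite gt_eqF// Gamma_gt0//.
    by have := mq_gt (lexx (1 : R)) qr; lra.
  have : smooth N rad (fun q : R => Gamma (1 + 1 * q)) by apply: h1; rewrite ler01 ler1n.
  by congr (smooth _ _ _); apply/funext => q; rewrite mul1r.
have -> : gratio = (fun q => Gamma (1 + 5 * q) * ((Gamma (1 + q))^-1 * ((Gamma (1 + q))^-1 *
   ((Gamma (1 + q))^-1 * ((Gamma (1 + q))^-1 * (Gamma (1 + q))^-1))))).
  by apply/funext => q; rewrite /gratio -exprVn; congr (_ * _); ring.
apply: smooth_mul; first by apply: h5; rewrite ler0n lexx.
by do 4![apply: smooth_mul => //].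
Qed.

Lemma gratio0_gt0 : 0 < gratio 0.
Proof. by rewrite /gratio mulr0 addr0 divr_gt0 ?exprn_gt0// Gamma_gt0. Qed.

Let norm0 : `|0 : R| < rad.
Proof. by rewrite normr0 divr_gt0. Qed.

Lemma derive1n_cst0 k (q : R) : derive1n k (fun=> 0 : R) q = 0.
Proof.
elim: k q => // k IH q; rewrite derive1nS.
have -> : derive1n k (fun=> 0 : R) = cst 0 by apply/funext.
by rewrite derive1_cst.
Qed.

Lemma cvg_bigsum (I : Type) (T : Type) (F : set_system T) {FF : Filter F} (r : seq I)
    (u : I -> T -> R) (l : I -> R) :
  (forall i, u i x @[x --> F] --> l i) ->
  \sum_(i <- r) u i x @[x --> F] --> \sum_(i <- r) l i.
Proof.
move=> ul; elim: r => [|i r IH].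
  rewrite big_nil; under eq_fun do rewrite big_nil; exact: cvg_cst.
rewrite big_cons; under eq_fun do rewrite big_cons; exact: cvgD.
Qed.

Definition wterm (y q : R) (n : nat) : R :=
  Gamma (1 + 5 * (n%:R + q)) / Gamma (1 + (n%:R + q)) ^+ 5 * expR ((n%:R + q) * y).

Lemma w_real (y q : R) : w (y%:C)%C q = ((limn (series (wterm y q)))%:C)%C.
Proof.
have hx e : xpow (y%:C)%C e = ((expR (e * y))%:C)%C.
  rewrite /xpow /cexp -(rmorphM (real_complex R)) /= cos0 sin0; exact: mulr1.
rewrite /w /csum; congr (_ +i* _)%C.
  congr (limn (series _)); apply/funext => n; rewrite hx /wterm.
  by rewrite -(rmorphM (real_complex R)).
rewrite (_ : (fun n => _) = (fun=> 0 : R)); last first.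
  by apply/funext => n; rewrite hx -(rmorphM (real_complex R)).
have -> : series (fun=> 0 : R) = cst 0.
  by apply/funext => n; rewrite /series/= big1.
exact: lim_cst.
Qed.

Lemma w_k_real k (y : R) :
  w_ k (y%:C)%C = ((derive1n k (fun q => limn (series (wterm y q))) 0)%:C)%C.
Proof.
rewrite /w_ /cderiv.
have -> : (fun q => complex.Re (w (y%:C)%C q)) = (fun q => limn (series (wterm y q))).
  by apply/funext => q; rewrite w_real.
have -> : (fun q => complex.Im (w (y%:C)%C q)) = (fun=> 0).
  by apply/funext => q; rewrite w_real.
by rewrite derive1n_cst0.
Qed.

(** The Leibniz rule at q = 0 for exp (q y) * [gratio] q * H(q), where H sums the [pochratio] series
    in exp y; f and S are the derivatives of [gratio] and H. As exp y tends to 0, H and its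
    derivatives tend to those of the constant 1. *)
Lemma w_k_jet : exists2 f : nat -> R -> R, f 0%N = gratio & exists2 B : R, 0 <= B &
  forall y, B * expR y <= 1 / 2 -> exists2 S : nat -> R,
    (forall i, (i <= 3)%N -> `|S i - (i == 0)%:R| <= 4 * B * expR y) &
    forall k, (k <= 3)%N -> w_ k (y%:C)%C =
     ((\sum_(i < k.+1) 'C(k, i)%:R *
       (y ^+ i * \sum_(j < (k - i).+1) 'C(k - i, j)%:R * (f j 0 * S (k - i - j)%N)))%:C)%C.
Proof.
have [f f0 jf] := smooth_jet (smooth_gratio 3).
exists f => //; have [B B0 bB] := jet_le_pochratio; exists B => // y By.
pose H := jseries (expR y) pochratio.
have jH : jet 3 rad H.
  apply: (@jet_jseries R 4 rad B (expR y) pochratio) => //.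
  by move=> n; exact: jet_pochratio.
pose E (i : nat) (q : R) := y ^+ i * expR (y * q).
have jE : jet 3 rad E.
  move=> i q _ _; rewrite /E.
  by apply: is_derive_eq; rewrite /GRing.scale/= exprS; ring.
exists (fun i => H i 0) => [i i3|k k3].
  exact: (jseries_sub bB B0 (expR_ge0 y) By (leqW i3) norm0).
rewrite w_k_real; congr (_%:C)%C.
have jP := jet_mul jE (jet_mul jf jH).
rewrite (derive1n_jet jP _ k3 norm0).
  rewrite /jmul /E mulr0 expR0.
  by apply: eq_bigr => i _; rewrite mulr1.
move=> q qr; rewrite !jmul0 /E expr0 mul1r f0 /H.
have c := cvg_jseries bB B0 (expR_ge0 y) By (leq0n _) qr.
rewrite mulrA -[RHS](lim_seriesZ _ c); congr (limn (series _)); apply/funext => n.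
rewrite /wterm pochratioE// fctE /GRing.scale/=.
by rewrite mulrDl expRD -expRM_natl [q * y]mulrC; ring.
Qed.

(** Only the Leibniz term with all k derivatives on exp (q y) has order y^k, and its coefficient
    tends to [gratio 0]. The limit is taken along y = - (n + 1). *)
Lemma w_asymp : exists2 c : R, 0 < c &
  forall k, (k <= 3)%N -> exists2 W : nat -> R,
    (\forall n \near \oo, w_ k ((- n.+1%:R)%:C)%C = ((W n * (- n.+1%:R) ^+ k)%:C)%C)
    & W n @[n --> \oo] --> c.
Proof.
have [f f0 [B B0 H]] := w_k_jet.
exists (gratio 0) => [|k k3]; first exact: gratio0_gt0.
pose y (n : nat) : R := - n.+1%:R.
have expy : expR (y n) @[n --> \oo] --> (0 : R).
  apply: (cvg_comp _ _ _ (@cvgr_expR R)).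
  have := @cvgr_idn R; rewrite -(@cvg_shiftn 1 _ (fun n : nat => n%:R : R)).
  by under eq_fun do rewrite addn1.
have Bexp : \forall n \near \oo, B * expR (y n) <= 1 / 2.
  have : B * expR (y n) @[n --> \oo] --> (B * 0 : R) by exact: cvgMr.
  by rewrite mulr0 => h; apply: (cvgr_le _ h); rewrite divr_gt0.
(* The derivatives S depend on y, hence on n; indices at which exp y is still too large get the
   default 0. *)
have /boolp.choice[S HS] : forall n, exists S : nat -> R, B * expR (y n) <= 1 / 2 ->
    (forall i, (i <= 3)%N -> `|S i - (i == 0)%:R| <= 4 * B * expR (y n)) /\
    forall k, (k <= 3)%N -> w_ k ((y n)%:C)%C =
     ((\sum_(i < k.+1) 'C(k, i)%:R *
       (y n ^+ i * \sum_(j < (k - i).+1) 'C(k - i, j)%:R * (f j 0 * S (k - i - j)%N)))%:C)%C.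
  move=> n; have [/H[S h1 h2]|h] := boolP (B * expR (y n) <= 1 / 2); first by exists S.
  by exists (fun=> 0).
have cS i : (i <= 3)%N -> S n i @[n --> \oo] --> ((i == 0)%:R : R).
  move=> i3; apply/cvgrPdist_le => e e0.
  have : 4 * B * expR (y n) @[n --> \oo] --> (4 * B * 0 : R) by exact: cvgMr.
  rewrite mulr0 => h; near=> n; rewrite distrC.
  have Bn : B * expR (y n) <= 1 / 2 by near: n.
  apply: le_trans ((HS n Bn).1 i i3) _.
  by near: n; exact: (cvgr_le _ h).
pose T j n := \sum_(l < j.+1) 'C(j, l)%:R * (f l 0 * S n (j - l)%N).
pose t j := \sum_(l < j.+1) 'C(j, l)%:R * (f l 0 * ((j - l == 0)%N)%:R).
have cT j : (j <= 3)%N -> T j n @[n --> \oo] --> t j.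
  move=> j3; apply: cvg_bigsum => l; apply: cvgMr; apply: cvgMr.
  by apply: cS; rewrite (leq_trans (leq_subr _ _)).
exists (fun n => \sum_(i < k.+1) 'C(k, i)%:R * ((y n)^-1 ^+ (k - i) * T (k - i)%N n)).
  near=> n; have Bn : B * expR (y n) <= 1 / 2 by near: n.
  rewrite ((HS n Bn).2 k k3); congr (_%:C)%C.
  rewrite mulr_suml; apply: eq_bigr => i _; rewrite -/(y n) -/(T _ n).
  have yn0 : y n != 0 by rewrite oppr_eq0 pnatr_eq0.
  have ik : (i <= k)%N by rewrite -ltnS.
  have -> : y n ^+ k = y n ^+ (k - i) * y n ^+ i by rewrite -exprD subnK.
  move: (T _ _) => Tn; rewrite exprVn -!mulrA; congr (_ * _).
  by rewrite [Tn * _]mulrC !mulrA mulVf ?mul1r// expf_neq0.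
have -> : gratio 0 = \sum_(i < k.+1) 'C(k, i)%:R * (0 ^+ (k - i) * t (k - i)%N).
  rewrite big_ord_recr big1 /=; last first.
    by move=> i _; rewrite expr0n subn_eq0 leqNgt ltn_ord mul0r mulr0.
  rewrite add0r subnn binn expr0 !mul1r /t big_ord_recl big_ord0 bin0 subnn f0.
  by rewrite !mulr1 mul1r addr0.
apply: cvg_bigsum => i; apply: cvgMr; apply: cvgM.
  have cy : (y n)^-1 @[n --> \oo] --> (0 : R).
    have -> : (fun n => (y n)^-1) = - (@harmonic R).
      by apply/funext => n; rewrite fctE /harmonic /= /y invrN.
    by rewrite -oppr0; apply: cvgN; exact: cvg_harmonic.
  elim: (k - i)%N => [|m IH]; first by rewrite expr0; exact: cvg_cst.
  by rewrite exprS; under eq_fun do rewrite exprS; exact: cvgM.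
by apply: cT; rewrite (leq_trans (leq_subr _ _)).
Unshelve. all: by end_near. Qed.

End HypergeometricSeries.

(** * Asymptotics of the central charges at the large complex structure limit *)

Section LargeComplexStructure.
Variable R : realType.
Local Notation C := R[i].

(** Only the last row of the power of [M_inf] enters [Z_lcsl]; recorded as a functional, it can be
    updated without computing matrix powers. *)
Definition last_row (j : nat) (a b d e : C) := forall P : 'cV[C]_4,
  (M_inf R ^+ j *m P) ord_max 0 = a * P 0 0 + b * P 1 0 + d * P (inord 2) 0 + e * P ord_max 0.

Lemma last_rowS j a b d e : last_row j a b d e ->
  last_row j.+1 (a - b - 3 * d + 5 * e) (b - 5 * d - 8 * e) (d + e) (- a + b + 3 * d - 4 * e).
Proof.
move=> H P; rewrite exprSr -mulmxE -mulmxA H !mxE !big_ord_recl !big_ord0 !mxE.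
have -> : inord 2 = lift ord0 (lift ord0 ord0) :> 'I_4 by apply/val_inj; rewrite /= inordK.
have -> : ord_max = lift ord0 (lift ord0 (lift ord0 ord0)) :> 'I_4 by apply/val_inj.
have -> : 1 = lift ord0 ord0 :> 'I_4 by apply/val_inj.
have -> : 0 = ord0 :> 'I_4 by apply/val_inj.
rewrite /=; ring.
Qed.

Lemma last_row0 : last_row 0 0 0 0 1.
Proof. by move=> P; rewrite expr0 mul1mx !mul0r !add0r mul1r. Qed.

(** Five updates compose to the identity: the monodromy [M_inf] has order five. *)
Lemma last_row_add5 j a b d e : last_row j a b d e -> last_row (j + 5) a b d e.
Proof.
move=> /last_rowS/last_rowS/last_rowS/last_rowS/last_rowS.
rewrite -[j.+1.+4]/(5 + j)%N addnC; congr last_row; ring.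
Qed.

Lemma Z_lcslE j a b d e u : last_row j a b d e -> Z_lcsl u j =
  a * w u 0 + b * (w_ 1 u / twopii R)
  + d * (5 * w_ 2 u / (2`!%:R * twopii R ^+ 2) + 11 / 2 * (w_ 1 u / twopii R))
  + e * (- (5 * w_ 3 u / (3`!%:R * twopii R ^+ 3)) - 50 / 12 * (w_ 1 u / twopii R)).
Proof. by move=> H; rewrite /Z_lcsl H !mxE /= inordK. Qed.

(** Dividing a real number by an odd power of 2 pi i gives an imaginary number and by an even power
    a real one; so w0 and w2 make up the real part, w1 and w3 the imaginary part. *)
Lemma Z_lcsl_real j (a b d e : R) u (w0 w1 w2 w3 : R) :
  last_row j (a%:C)%C (b%:C)%C (d%:C)%C (e%:C)%C ->
  w u 0 = (w0%:C)%C -> w_ 1 u = (w1%:C)%C -> w_ 2 u = (w2%:C)%C -> w_ 3 u = (w3%:C)%C ->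
  Z_lcsl u j = ((a * w0 - 5 * d * w2 / (8 * pi ^+ 2)) +i*
    (- (b * w1 / (2 * pi)) - 11 * d * w1 / (4 * pi)
     + e * (- (5 * w3 / (48 * pi ^+ 3)) + 50 * w1 / (24 * pi))))%C.
Proof.
move=> /Z_lcslE -> -> -> -> ->.
have p0 : (pi : R) != 0 by rewrite gt_eqF// pi_gt0.
have inv_uniq (x z : C) : x * z = 1 -> x^-1 = z.
  move=> xz; have x0 : x != 0.
    by apply: contra_eq_neq xz => ->; rewrite mul0r eq_sym oner_eq0.
  by apply: (mulfI x0); rewrite mulfV.
pose k : R := (2 * pi)^-1.
have nC m : (m%:R : C) = ((m%:R : R)%:C)%C by rewrite (rmorph_nat (real_complex R)).
have f1 : (twopii R)^-1 = (0 +i* - k)%C.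
  apply: inv_uniq; apply/eqP; rewrite eq_complex /= /k.
  move: (@pi R) p0 => p pn0.
  by apply/andP; split; apply/eqP; field.
have f2 : (2`!%:R * twopii R ^+ 2)^-1 = ((- k ^+ 2 / 2)%:C)%C.
  apply: inv_uniq; rewrite (_ : 2`! = 2%N)// nC; apply/eqP; rewrite eq_complex /= /k.
  move: (@pi R) p0 => p pn0.
  by apply/andP; split; apply/eqP; field.
have f3 : (3`!%:R * twopii R ^+ 3)^-1 = (0 +i* (k ^+ 3 / 6))%C.
  apply: inv_uniq; rewrite (_ : 3`! = 6%N)// nC; apply/eqP; rewrite eq_complex /= /k.
  move: (@pi R) p0 => p pn0.
  by apply/andP; split; apply/eqP; field.
have q1 : 11 / 2 = ((11 / 2 : R)%:C)%C by rewrite !nC -fmorphV -rmorphM.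
have q2 : 50 / 12 = ((50 / 12 : R)%:C)%C by rewrite !nC -fmorphV -rmorphM.
have q3 : 5 = ((5 : R)%:C)%C by rewrite nC.
rewrite f1 f2 f3 q1 q2 q3 /k; apply/eqP; rewrite eq_complex /=.
move: (@pi R) p0 {f1 f2 f3 k} => p pn0.
by apply/andP; split; apply/eqP; field.
Qed.

(* With y = log x -> -oo, w_k ~ c y^k, so the last two periods dominate: the
   real part has order y^2 and the imaginary part order y^3. *)
Lemma asymp_charge : exists2 c : R, 0 < c &
  forall j (a b d e : R), last_row j (a%:C)%C (b%:C)%C (d%:C)%C (e%:C)%C ->
  exists al be : nat -> R, [/\
    \forall n \near \oo, Z_lcsl ((- n.+1%:R)%:C)%C j =
       (al n * (- n.+1%:R) ^+ 2 +i* (be n * (- n.+1%:R) ^+ 3))%C,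
    al n @[n --> \oo] --> - (d * c) & be n @[n --> \oo] --> - (e * c / (6 * pi))].
Proof.
have [c c0 H] := w_asymp R.
have p0 : 0 < (pi : R) by exact: pi_gt0.
have p0' : (pi : R) != 0 by rewrite gt_eqF.
(* Normalized by w^(2) ~ - c y^2 for the new c; then w^(3) ~ - i c y^3 / (6 pi). *)
exists (5 * c / (8 * pi ^+ 2)).
  by rewrite divr_gt0 ?mulr_gt0 ?exprn_gt0.
move=> j a b d e rowj.
have [W0 e0 c0'] := H 0%N isT; have [W1 e1 c1'] := H 1%N isT.
have [W2 e2 c2'] := H 2%N isT; have [W3 e3 c3'] := H 3%N isT.
pose y (n : nat) : R := - n.+1%:R.
have cy : (y n)^-1 @[n --> \oo] --> (0 : R).
  have -> : (fun n => (y n)^-1) = - (@harmonic R).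
    by apply/funext => n; rewrite fctE /harmonic /= /y invrN.
  by rewrite -oppr0; apply: cvgN; exact: cvg_harmonic.
exists (fun n => a * W0 n * ((y n)^-1 * (y n)^-1) - 5 * d * W2 n / (8 * pi ^+ 2)).
exists (fun n => (- (b / (2 * pi)) - 11 * d / (4 * pi) + e * 50 / (24 * pi)) * W1 n * ((y n)^-1 * (y n)^-1)
  - e * 5 * W3 n / (48 * pi ^+ 3)).
split.
- near=> n; rewrite -/(y n).
  have E0 : w_ 0 ((y n)%:C)%C = ((W0 n * (y n) ^+ 0)%:C)%C by near: n.
  have E1 : w_ 1 ((y n)%:C)%C = ((W1 n * (y n) ^+ 1)%:C)%C by near: n.
  have E2 : w_ 2 ((y n)%:C)%C = ((W2 n * (y n) ^+ 2)%:C)%C by near: n.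
  have E3 : w_ 3 ((y n)%:C)%C = ((W3 n * (y n) ^+ 3)%:C)%C by near: n.
  have E0' : w ((y n)%:C)%C 0 = ((W0 n * (y n) ^+ 0)%:C)%C.
    by rewrite -E0 w_k_real w_real.
  rewrite (Z_lcsl_real rowj E0' E1 E2 E3).
  have y0 : y n != 0 by rewrite oppr_eq0 pnatr_eq0.
  clear E0 E1 E2 E3 E0'; move: (y n) y0 (W0 n) (W1 n) (W2 n) (W3 n) => Y Y0 V0 V1 V2 V3.
  move: (@pi R) p0' => p pn0.
  by congr (_ +i* _)%C; field; rewrite ?pn0 ?Y0.
- have -> : - (d * (5 * c / (8 * pi ^+ 2))) = a * c * (0 * 0) - 5 * d * c / (8 * pi ^+ 2).
    by move: (@pi R) p0' => p pn0; field.
  apply: cvgB; last by apply: cvgMl; apply: cvgMr.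
  by apply: cvgM; [exact: cvgMr|exact: cvgM].
- have -> : - (e * (5 * c / (8 * pi ^+ 2)) / (6 * pi)) =
    (- (b / (2 * pi)) - 11 * d / (4 * pi) + e * 50 / (24 * pi)) * c * (0 * 0)
    - e * 5 * c / (48 * pi ^+ 3).
    by move: (@pi R) p0' => p pn0; field.
  apply: cvgB; last by apply: cvgMl; apply: cvgMr.
  by apply: cvgM; [exact: cvgMr|exact: cvgM].
Unshelve. all: by end_near. Qed.

(** [cross] and [dot] are the imaginary and real parts of conj(z) z'. Positivity of [cross] means
    that z' is reached from z by a counterclockwise turn of less than pi. *)
Definition cross (z z' : C) : R := complex.Re z * complex.Im z' - complex.Im z * complex.Re z'.
Definition dot (z z' : C) : R := complex.Re z * complex.Re z' + complex.Im z * complex.Im z'.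

(** Orders y^2 and y^3 multiply to y^5, with coefficient tending to (d e' - e d') c^2 / (6 pi); as y
    < 0, the sign is that of d' e - d e'. *)
Lemma asymp_cross j (a b d e a' b' d' e' : R) :
  last_row j (a%:C)%C (b%:C)%C (d%:C)%C (e%:C)%C ->
  last_row j.+1 (a'%:C)%C (b'%:C)%C (d'%:C)%C (e'%:C)%C -> 0 < d' * e - d * e' ->
  \forall n \near \oo, 0 < cross (Z_lcsl ((- n.+1%:R)%:C)%C j) (Z_lcsl ((- n.+1%:R)%:C)%C j.+1).
Proof.
move=> r r' de; have [c c0 H] := asymp_charge.
have [al [be [E ca cb]]] := H _ _ _ _ _ r.
have [al' [be' [E' ca' cb']]] := H _ _ _ _ _ r'.
have p0 : 0 < (pi : R) by exact: pi_gt0.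
have lim : be n * al' n - al n * be' n @[n --> \oo] -->
   - (e * c / (6 * pi)) * - (d' * c) - - (d * c) * - (e' * c / (6 * pi)).
  by apply: cvgB; apply: cvgM.
have pos : 0 < - (e * c / (6 * pi)) * - (d' * c) - - (d * c) * - (e' * c / (6 * pi)).
  have -> : - (e * c / (6 * pi)) * - (d' * c) - - (d * c) * - (e' * c / (6 * pi)) =
    (d' * e - d * e') * (c ^+ 2 / (6 * pi)) by ring.
  by rewrite mulr_gt0// divr_gt0 ?exprn_gt0// mulr_gt0.
have near_pos : \forall n \near \oo, 0 < be n * al' n - al n * be' n by exact: (cvgr_gt _ lim).
near=> n.
have -> : Z_lcsl ((- n.+1%:R)%:C)%C j = (al n * (- n.+1%:R) ^+ 2 +i* (be n * (- n.+1%:R) ^+ 3))%C by near: n.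
have -> : Z_lcsl ((- n.+1%:R)%:C)%C j.+1 =
  (al' n * (- n.+1%:R) ^+ 2 +i* (be' n * (- n.+1%:R) ^+ 3))%C by near: n.
rewrite /cross /=.
have -> : al n * (- n.+1%:R) ^+ 2 * (be' n * (- n.+1%:R) ^+ 3) -
   be n * (- n.+1%:R) ^+ 3 * (al' n * (- n.+1%:R) ^+ 2) =
   (be n * al' n - al n * be' n) * n.+1%:R ^+ 5 by ring.
rewrite mulr_gt0 ?exprn_gt0 ?ltr0n//.
by near: n.
Unshelve. all: by end_near. Qed.

(** [cross] has order at most |y|^5 while [dot] grows like e e' y^6, so the angle between the two
    charges eventually drops below the angle in ]0, pi[ with cotangent t / s. *)
Lemma asymp_dot j (a b d e a' b' d' e' s t : R) :
  last_row j (a%:C)%C (b%:C)%C (d%:C)%C (e%:C)%C ->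
  last_row j.+1 (a'%:C)%C (b'%:C)%C (d'%:C)%C (e'%:C)%C -> 0 < e * e' -> 0 < s ->
  \forall n \near \oo,
    cross (Z_lcsl ((- n.+1%:R)%:C)%C j) (Z_lcsl ((- n.+1%:R)%:C)%C j.+1) * t <
    dot (Z_lcsl ((- n.+1%:R)%:C)%C j) (Z_lcsl ((- n.+1%:R)%:C)%C j.+1) * s.
Proof.
move=> r r' ee s0; have [c c0 H] := asymp_charge.
have [al [be [E ca cb]]] := H _ _ _ _ _ r.
have [al' [be' [E' ca' cb']]] := H _ _ _ _ _ r'.
have p0 : 0 < (pi : R) by exact: pi_gt0.
pose y (n : nat) : R := - n.+1%:R.
have cy : (y n)^-1 @[n --> \oo] --> (0 : R).
  have -> : (fun n => (y n)^-1) = - (@harmonic R).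
    by apply/funext => n; rewrite fctE /harmonic /= /y invrN.
  by rewrite -oppr0; apply: cvgN; exact: cvg_harmonic.
pose g n := s * (al n * al' n * ((y n)^-1 * (y n)^-1) + be n * be' n)
  - t * ((al n * be' n - be n * al' n) * (y n)^-1).
have lim : g n @[n --> \oo] -->
  s * (- (d * c) * - (d' * c) * (0 * 0) + - (e * c / (6 * pi)) * - (e' * c / (6 * pi)))
  - t * ((- (d * c) * - (e' * c / (6 * pi)) - - (e * c / (6 * pi)) * - (d' * c)) * 0).
  apply: cvgB; apply: cvgMr.
    by apply: cvgD; apply: cvgM => //; apply: cvgM.
  by apply: cvgM => //; apply: cvgB; apply: cvgM.
have near_pos : \forall n \near \oo, 0 < g n.
  apply: (cvgr_gt _ lim); rewrite !mulr0 subr0 add0r.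
  have -> : - (e * c / (6 * pi)) * - (e' * c / (6 * pi)) = (e * e') * (c / (6 * pi)) ^+ 2 by ring.
  by rewrite mulr_gt0// mulr_gt0// exprn_gt0// divr_gt0// mulr_gt0.
near=> n.
have -> : Z_lcsl ((- n.+1%:R)%:C)%C j = (al n * (y n) ^+ 2 +i* (be n * (y n) ^+ 3))%C by near: n.
have -> : Z_lcsl ((- n.+1%:R)%:C)%C j.+1 = (al' n * (y n) ^+ 2 +i* (be' n * (y n) ^+ 3))%C by near: n.
have y0 : y n != 0 by rewrite oppr_eq0 pnatr_eq0.
rewrite -subr_gt0 /cross /dot /=.
have -> : (al n * y n ^+ 2 * (al' n * y n ^+ 2) + be n * y n ^+ 3 * (be' n * y n ^+ 3)) * s -
  (al n * y n ^+ 2 * (be' n * y n ^+ 3) - be n * y n ^+ 3 * (al' n * y n ^+ 2)) * t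
  = g n * y n ^+ 6.
  by rewrite /g; move: (y n) y0 => Y Y0; field.
rewrite mulr_gt0//; first by near: n.
by rewrite exprn_even_gt0.
Unshelve. all: by end_near. Qed.

Lemma last_rows : [/\ last_row 1 5 (- 8) 1 (- 4), last_row 2 (- 10) 19 (- 3) 6,
  last_row 3 10 (- 14) 3 (- 4), last_row 4 (- 5) 3 (- 1) 1 & last_row 5 0 0 0 1].
Proof.
have r1 : last_row 1 5 (- 8) 1 (- 4) by have := last_rowS last_row0; congr last_row; ring.
have r2 : last_row 2 (- 10) 19 (- 3) 6 by have := last_rowS r1; congr last_row; ring.
have r3 : last_row 3 10 (- 14) 3 (- 4) by have := last_rowS r2; congr last_row; ring.
have r4 : last_row 4 (- 5) 3 (- 1) 1 by have := last_rowS r3; congr last_row; ring.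
split=> //; exact: (last_row_add5 last_row0).
Qed.

Lemma Z_lcsl_add5 (u : C) j : Z_lcsl u (j + 5) = Z_lcsl u j.
Proof.
have [a [b [d [e r]]]] : exists a b d e, last_row j a b d e.
  elim: j => [|j [a [b [d [e r]]]]]; first by exists 0, 0, 0, 1; exact: last_row0.
  by do 4!eexists; exact: last_rowS r.
by rewrite (Z_lcslE _ r) (Z_lcslE _ (last_row_add5 r)).
Qed.

Lemma cross_periodic (Z : nat -> C) : (forall j, Z (j + 5)%N = Z j) ->
  [/\ 0 < cross (Z 0%N) (Z 1%N), 0 < cross (Z 1%N) (Z 2%N), 0 < cross (Z 2%N) (Z 3%N),
      0 < cross (Z 3%N) (Z 4%N) & 0 < cross (Z 4%N) (Z 5%N)] ->
  forall j, 0 < cross (Z j) (Z j.+1).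
Proof.
move=> Z5 [H0 H1 H2 H3 H4] j.
have base : forall k, (k < 5)%N -> 0 < cross (Z k) (Z k.+1).
  by case=> [|[|[|[|[|//]]]]] _.
have [k] := ubnP j; elim: k j => // k IH j jk.
have [/base//|j5] := ltnP j 5.
by rewrite -(subnK j5) -addSn !Z5; apply: IH; lia.
Qed.

Lemma lcsl_phases (eps s t : R) : 0 < eps -> 0 < s -> exists u : C,
  [/\ expR (complex.Re u) < eps,
      forall j, 0 < cross (Z_lcsl u j) (Z_lcsl u j.+1) &
      cross (Z_lcsl u 4) (Z_lcsl u 5) * t < dot (Z_lcsl u 4) (Z_lcsl u 5) * s].
Proof.
move=> eps0 s0.
(* [p0] to [p4] are the determinants d' e - d e' of the five steps, equal to 1, 6, 6, 1, 1; [p5] is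
   the product e e' for the step from level 4 to level 5. *)
have p0 : 0 < 1 * 1 - 0 * (- 4) :> R by lra.
have p1 : 0 < (- 3) * (- 4) - 1 * 6 :> R by lra.
have p2 : 0 < 3 * 6 - (- 3) * (- 4) :> R by lra.
have p3 : 0 < (- 1) * (- 4) - 3 * 1 :> R by lra.
have p4 : 0 < 0 * 1 - (- 1) * 1 :> R by lra.
have p5 : 0 < 1 * 1 :> R by lra.
have [] := last_rows.
have nC k : (k%:R : C) = ((k%:R : R)%:C)%C by rewrite (rmorph_nat (real_complex R)).
have NC x : (- (x%:C)%C : C) = ((- x)%:C)%C by rewrite (rmorphN (real_complex R)).
have c0 : (0 : C) = ((0 : R)%:C)%C by [].
have c1 : (1 : C) = ((1 : R)%:C)%C by [].
have r0 := last_row0; move: r0; rewrite !nC c0 c1 !NC => r0 r1 r2 r3 r4 r5.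
have h0 := asymp_cross r0 r1 p0; have h1 := asymp_cross r1 r2 p1.
have h2 := asymp_cross r2 r3 p2; have h3 := asymp_cross r3 r4 p3.
have h4 := asymp_cross r4 r5 p4; have h5 := asymp_dot t r4 r5 p5 s0.
have hexp : \forall n \near \oo, expR (- n.+1%:R) < eps.
  have : expR (- n.+1%:R) @[n --> \oo] --> (0 : R).
    apply: (cvg_comp _ _ _ (@cvgr_expR R)).
    have := @cvgr_idn R; rewrite -(@cvg_shiftn 1 _ (fun n : nat => n%:R : R)).
    by under eq_fun do rewrite addn1.
  by move=> h; exact: (cvgr_lt _ h).
have [n [H [H0 [H1 [H2 [H3 [H4 H5]]]]]]] := filter_ex (filterI hexp (filterI h0 (filterI h1
  (filterI h2 (filterI h3 (filterI h4 h5)))))).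
exists ((- n.+1%:R)%:C)%C; split; [exact: H| |exact: H5].
by apply: cross_periodic (Z_lcsl_add5 _) _ ; split; [exact: H0|exact: H1|exact: H2|exact: H3|exact: H4].
Qed.

End LargeComplexStructure.

(** * Representations and complexes *)

Section LinearAlgebra.
Variable K : fieldType.
Implicit Types V W : vectType K.

Lemma vspace_dim_eq0 V : \dim {:V} = 0%N <-> forall x : V, x = 0.
Proof.
split=> [/eqP|h]; last first.
  by apply/eqP; rewrite dimv_eq0 -subv0; apply/subvP => x _; rewrite (h x) memv0.
by rewrite dimv_eq0 => /eqP e x; apply/eqP; rewrite -memv0 -e memvf.
Qed.

Lemma bijective_of_dim V W : \dim {:V} = \dim {:W} ->
  exists f : 'Hom(V, W), bijective f.
Proof.
rewrite !dimvf => e.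
pose f := linfun (r2v \o mulmxr (pid_mx (dim V) : 'M[K]_(dim V, dim W)) \o v2r).
pose g := linfun (r2v \o mulmxr (pid_mx (dim W) : 'M[K]_(dim W, dim V)) \o v2r).
exists f; exists g => x; rewrite !lfunE /= r2vK -mulmxA mul_pid_mx.
  by rewrite -e !minnn pid_mx_1 mulmx1 v2rK.
by rewrite e !minnn pid_mx_1 mulmx1 v2rK.
Qed.

Lemma dim_exact V (E : vectType K) W (f : 'Hom(V, E)) (g : 'Hom(E, W)) :
  injective f -> (forall z, exists y, g y = z) ->
  (forall y, g y = 0 <-> exists x, y = f x) ->
  \dim {:E} = (\dim {:V} + \dim {:W})%N.
Proof.
move=> fi gs fg.
have kf : lker f = 0%VS by apply/eqP/lker0P.
have gE : limg g = fullv.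
  apply/eqP; rewrite eqEsubv subvf; apply/subvP => z _.
  by have [y <-] := gs z; exact: memv_img (memvf y).
have kg : lker g = limg f.
  apply/vspaceP => y; rewrite memv_ker; apply/eqP/memv_imgP.
    by move=> /fg[x ->]; exists x => //; exact: memvf.
  by move=> [x _ ->]; apply/fg; exists x.
have := limg_ker_dim g fullv; rewrite capfv kg gE => <-.
by rewrite limg_dim_eq// kf capv0.
Qed.

(* Equality of the dimensions of [ZV / BV] and [ZW / BW], with both sides moved
   so that no subtraction occurs. *)
Lemma dim_quasi_iso V W (f : 'Hom(V, W)) (ZV BV : {vspace V}) (ZW BW : {vspace W}) :
  (BV <= ZV)%VS -> (BW <= ZW)%VS ->
  (forall x, x \in ZV -> f x \in ZW) -> (forall x, x \in BV -> f x \in BW) ->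
  (forall x, x \in ZV -> f x \in BW -> x \in BV) ->
  (forall y, y \in ZW -> exists2 x, x \in ZV & y - f x \in BW) ->
  (\dim ZW + \dim BV = \dim ZV + \dim BW)%N.
Proof.
move=> BZV BZW fZ fB finj fsurj.
have e1 : (f @: ZV + BW)%VS = ZW.
  apply/eqP; rewrite eqEsubv subv_add BZW andbT; apply/andP; split.
    by apply/subvP => y /memv_imgP[x xZ ->]; exact: fZ.
  apply/subvP => y /fsurj[x xZ yx]; rewrite -(subrK (f x) y) [X in X \in _]addrC.
  by apply: memv_add => //; exact: memv_img.
have e2 : (f @: ZV :&: BW)%VS = (f @: BV)%VS.
  apply/vspaceP => y; rewrite memv_cap; apply/andP/idP.
    by move=> [/memv_imgP[x xZ ->] fx]; apply: memv_img; exact: finj.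
  move=> /memv_imgP[x xB ->]; split; last exact: fB.
  by apply: memv_img; exact: subvP BZV _ xB.
have e3 : (ZV :&: lker f)%VS = (BV :&: lker f)%VS.
  apply/eqP; rewrite eqEsubv (capvS BZV (subvv _)) andbT; apply/subvP => x.
  rewrite !memv_cap => /andP[xZ fx]; rewrite fx andbT; apply: finj => //.
  by move: fx; rewrite memv_ker => /eqP ->; exact: mem0v.
have := dimv_sum_cap (f @: ZV) BW; rewrite e1 e2.
rewrite -(limg_ker_dim f ZV) -(limg_ker_dim f BV) e3; lia.
Qed.

(** The quotient of V by U is modelled on the complement of U, an element going to its component
    there. *)
Definition coset_map V (U : {vspace V}) (y : V) : subvs_of U^C :=
  vsproj (U^C) (y - projv U y).

Lemma coset_map_is_linear V (U : {vspace V}) : linear (coset_map U).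
Proof.
move=> k x y; rewrite /coset_map -linearP; congr vsproj.
by rewrite linearP /= scalerBr opprD addrACA.
Qed.

HB.instance Definition _ V (U : {vspace V}) :=
  GRing.isLinear.Build K V (subvs_of U^C) _ _ (@coset_map_is_linear V U).

Lemma vsval_coset V (U : {vspace V}) y : vsval (coset_map U y) = y - projv U y.
Proof. by rewrite /coset_map vsprojK// memv_projC. Qed.

Lemma coset_eq0 V (U : {vspace V}) y : coset_map U y = 0 <-> y \in U.
Proof.
split=> [/(congr1 vsval)|yU]; last first.
  by apply/val_inj; rewrite /= vsval_coset projv_id// subrr.
by rewrite vsval_coset /= => /eqP; rewrite subr_eq0 => /eqP ->; exact: memv_proj.
Qed.

Lemma coset_val V (U : {vspace V}) (z : subvs_of U^C) : coset_map U (vsval z) = z.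
Proof.
apply/val_inj; rewrite /= vsval_coset.
have /eqP -> : projv U (vsval z) == 0 by rewrite -memv_ker lker_proj subvsP.
by rewrite subr0.
Qed.

Lemma coset_sub V (U : {vspace V}) y : y - vsval (coset_map U y) \in U.
Proof. by rewrite vsval_coset opprB addrC subrK memv_proj. Qed.

Definition hyper V : {vspace V} := (<[vpick {:V}]>^C)%VS.

Lemma dim_hyper V : \dim (hyper V) = (\dim {:V}).-1.
Proof.
rewrite /hyper dimv_compl dim_vline vpick0 -dimv_eq0.
by case: (\dim _) => // n; rewrite subn1.
Qed.

End LinearAlgebra.

(** * Subrepresentations, quotients and dimension vectors *)

Section RepConstructions.
Variable R : realType.
Local Notation C := R[i].
Implicit Types M N E : rep R.

Definition rdim M v := \dim {:M v}.

Lemma rep_zeroP M : rep_zero M <-> forall v, rdim M v = 0%N.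
Proof. by split=> h v; apply/vspace_dim_eq0; exact: h. Qed.

Section Subquotient.
Variables (M : rep R) (U : forall v, {vspace M v}).
Hypothesis closed : forall v w (a : arrow v w) x, x \in U v -> rep_map M a x \in U w.

Definition sub_map v w (a : arrow v w) : 'Hom(subvs_of (U v), subvs_of (U w)) :=
  linfun (vsproj (U w) \o rep_map M a \o vsval).

Lemma sub_mapE v w (a : arrow v w) x : vsval (sub_map a x) = rep_map M a (vsval x).
Proof. by rewrite lfunE /= vsprojK// closed// subvsP. Qed.

Fact sub_square v a b w (va : arrow v a) (aw : arrow a w)
  (vb : arrow v b) (bw : arrow b w) (x : subvs_of (U v)) :
  sub_map aw (sub_map va x) = sub_map bw (sub_map vb x).
Proof. by apply/val_inj; rewrite /= !sub_mapE; exact: rep_square. Qed.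

Definition subrep : rep R :=
  @Rep R (fun v => subvs_of (U v)) sub_map sub_square.

Fact sub_incl_comm v w (a : arrow v w) (x : subrep v) :
  linfun vsval (rep_map subrep a x) = rep_map M a (linfun (vsval : subvs_of (U v) -> M v) x).
Proof.
transitivity (vsval (sub_map a x)); first by rewrite lfunE.
by rewrite sub_mapE; congr (rep_map M a _); rewrite lfunE.
Qed.

Definition sub_incl : rhom subrep M :=
  @RHom R subrep M (fun v => linfun (vsval : subvs_of (U v) -> M v)) sub_incl_comm.

Definition quo_map v w (a : arrow v w) : 'Hom(subvs_of (U v)^C, subvs_of (U w)^C) :=
  linfun (coset_map (U w) \o rep_map M a \o vsval).

Lemma quo_mapE v w (a : arrow v w) y :
  quo_map a (coset_map (U v) y) = coset_map (U w) (rep_map M a y).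
Proof.
rewrite lfunE /=; apply/esym/eqP; rewrite -subr_eq0 -!linearB /=; apply/eqP/coset_eq0.
by apply: closed; exact: coset_sub.
Qed.

Fact quo_square v a b w (va : arrow v a) (aw : arrow a w)
  (vb : arrow v b) (bw : arrow b w) (x : subvs_of (U v)^C) :
  quo_map aw (quo_map va x) = quo_map bw (quo_map vb x).
Proof. by rewrite -(coset_val x) !quo_mapE; congr coset_map; exact: rep_square. Qed.

Definition quorep : rep R :=
  @Rep R (fun v => subvs_of (U v)^C) quo_map quo_square.

Fact quo_proj_comm v w (a : arrow v w) (x : M v) :
  linfun (coset_map (U w)) (rep_map M a x) = rep_map quorep a (linfun (coset_map (U v)) x).
Proof.
transitivity (quo_map a (coset_map (U v) x)); first by rewrite lfunE quo_mapE.
by congr (quo_map a _); rewrite lfunE.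
Qed.

Definition quo_proj : rhom M quorep :=
  @RHom R M quorep (fun v => linfun (coset_map (U v))) quo_proj_comm.

Lemma sub_quo_exact : rep_exact sub_incl quo_proj.
Proof.
move=> v; split.
- by move=> x y; rewrite /= !lfunE; exact: val_inj.
- by move=> z; exists (vsval z); rewrite /= lfunE; exact: coset_val.
- move=> y; rewrite /= lfunE; split.
    move=> /coset_eq0 yU; exists (vsproj (U v) y).
    by rewrite lfunE /= vsprojK.
  by move=> [x ->]; apply/coset_eq0; rewrite lfunE; exact: subvsP.
Qed.

Lemma rdim_sub v : rdim subrep v = \dim (U v).
Proof. by rewrite /rdim dimvf. Qed.

End Subquotient.

Lemma rdim_exact M E N (f : rhom M E) (g : rhom E N) : rep_exact f g ->
  forall v, rdim E v = (rdim M v + rdim N v)%N.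
Proof. by move=> fg v; have [fi gs fgv] := fg v; exact: (dim_exact fi gs fgv). Qed.

Lemma rdim_quo M (U : forall v, {vspace M v})
    (closed : forall v w (a : arrow v w) x, x \in U v -> rep_map M a x \in U w) v :
  rdim (quorep closed) v = (rdim M v - \dim (U v))%N.
Proof. by rewrite (rdim_exact (sub_quo_exact closed)) rdim_sub addKn. Qed.

Lemma rdim_null (d : vertex -> nat) v : rdim (null_rep R d) v = d v.
Proof. by rewrite /rdim dimvf /dim /= mul1n. Qed.

(** When all arrows act by zero, any bijections at the vertices commute with them. *)
Lemma rep_iso_of_dim M N : (forall v w (a : arrow v w) x, rep_map M a x = 0) ->
  (forall v w (a : arrow v w) x, rep_map N a x = 0) ->
  (forall v, rdim M v = rdim N v) -> rep_iso M N.
Proof.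
move=> M0 N0 MN.
have f v : {f : 'Hom(M v, N v) | bijective f} := cid (bijective_of_dim (MN v)).
have fc v w (a : arrow v w) (x : M v) : sval (f w) (rep_map M a x) = rep_map N a (sval (f v) x).
  by rewrite M0 N0 linear0.
by exists (RHom fc) => v; exact: (svalP (f v)).
Qed.

Lemma rdim_iso M N : rep_iso M N -> forall v, rdim M v = rdim N v.
Proof.
move=> [f fb] v; have [g fK gK] := fb v.
have i : injective (f v) := can_inj fK.
have kf : lker (f v) = 0%VS by apply/eqP/lker0P.
have : limg (f v) = fullv.
  apply/eqP; rewrite eqEsubv subvf; apply/subvP => z _.
  by rewrite -(gK z); exact: memv_img (memvf _).
by rewrite /rdim => <-; rewrite limg_dim_eq// kf capv0.
Qed.

End RepConstructions.

(** * Complexes up to quasi-isomorphism and additive functions on them *)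

Section Complexes.
Variable R : realType.
Local Notation C := R[i].
Implicit Types X Y W A B : cplx R.

Lemma quasi_iso_bij X Y (f : chom X Y) : (forall n v, bijective (f n v)) -> quasi_iso f.
Proof.
move=> fb n v; have [g fK gK] := fb n v; have [g1 fK1 gK1] := fb (n + 1) v.
have [g2 fK2 gK2] := fb (n + 1 + 1) v; split.
- move=> x dx [y e]; exists (g y); apply: (can_inj fK1).
  by rewrite e chom_comm gK.
- move=> y dy; exists (g1 y).
    by apply: (can_inj fK2); rewrite chom_comm gK1 dy linear0.
  by exists 0; rewrite gK1 subrr linear0.
Qed.

Fact id_rhom_comm (M : rep R) v w (a : arrow v w) (x : M v) :
  (\1 : 'End(M w))%VF (rep_map M a x) = rep_map M a ((\1 : 'End(M v))%VF x).
Proof. by rewrite !id_lfunE. Qed.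

Definition id_rhom (M : rep R) : rhom M M := RHom (@id_rhom_comm M).

Fact cid_hom_comm X n v (x : X n v) :
  id_rhom (X (n + 1)) v (cdiff X n v x) = cdiff X n v (id_rhom (X n) v x).
Proof. by rewrite /= !id_lfunE. Qed.

Definition cid_hom X : chom X X := CHom (@cid_hom_comm X).

Lemma quasi_iso_id X : quasi_iso (cid_hom X).
Proof. by apply: quasi_iso_bij => n v; exists id => x /=; rewrite id_lfunE. Qed.

Lemma T_iso_refl X : T_iso X X.
Proof. by exists X, (cid_hom X), (cid_hom X); split; exact: quasi_iso_id. Qed.

Lemma T_iso_of_dim X Y :
  (forall n v w (a : arrow v w) x, rep_map (X n) a x = 0) ->
  (forall n v w (a : arrow v w) x, rep_map (Y n) a x = 0) ->
  (forall n v x, cdiff X n v x = 0) -> (forall n v x, cdiff Y n v x = 0) ->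
  (forall n v, rdim (X n) v = rdim (Y n) v) -> T_iso X Y.
Proof.
move=> X0 Y0 dX dY XY.
have f n v : {f : 'Hom(X n v, Y n v) | bijective f} := cid (bijective_of_dim (XY n v)).
have fc n v w (a : arrow v w) (x : X n v) :
    sval (f n w) (rep_map (X n) a x) = rep_map (Y n) a (sval (f n v) x).
  by rewrite X0 Y0 linear0.
have fd n v (x : X n v) : RHom (fc (n + 1)) v (cdiff X n v x) = cdiff Y n v (RHom (fc n) v x).
  by rewrite dX dY linear0.
exists X, (cid_hom X), (CHom fd); split; first exact: quasi_iso_id.
by apply: quasi_iso_bij => n v; exact: (svalP (f n v)).
Qed.

Section NullComplex.
Variable d : int -> vertex -> nat.
Hypothesis db : exists N : nat, forall n : int, (N < `|n|)%N -> forall v, d n v = 0%N.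

Fact nullc_diff2 (n : int) v (x : null_rep R (d n) v) :
  rhom0 (null_rep R (d (n + 1))) (null_rep R (d (n + 1 + 1))) v
    (rhom0 (null_rep R (d n)) (null_rep R (d (n + 1))) v x) = 0.
Proof. by rewrite /= !lfunE. Qed.

Fact nullc_bounded : exists N : nat, forall n : int,
  (N < `|n|)%N -> rep_zero (null_rep R (d n)).
Proof.
have [N HN] := db; exists N => n /HN dn; apply/rep_zeroP => v.
by rewrite rdim_null.
Qed.

Definition nullc : cplx R :=
  @Cplx R (fun n => null_rep R (d n)) _ nullc_diff2 nullc_bounded.

End NullComplex.

Lemma rdim0_eq (M : rep R) v (x : M v) : rdim M v = 0%N -> x = 0.
Proof. by move=> /vspace_dim_eq0. Qed.

Lemma arrow_neq v w : arrow v w -> v != w.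
Proof.
move=> /existsP[i /andP[/eqP e _]]; apply/eqP => vw; move: e; rewrite vw; lia.
Qed.

Lemma arrow_level v w : arrow v w -> level w = (level v).+1.
Proof.
move=> /existsP[i /andP[/eqP e /forallP h]]; rewrite /level (bigD1 i)//= e.
rewrite [in RHS](bigD1 i)//= addSn; congr (_ + _).+1.
by apply: eq_bigr => j ji; have := h j; rewrite ji => /eqP ->.
Qed.

(** Shifts of a simple object, described by dimensions alone. This determines them up to isomorphism
    in the derived category, as no arrow or differential leads from the place (n, v) to itself. *)
Definition concentrated (n : int) v X :=
  forall m w, rdim (X m) w = (m == n) && (w == v).

Lemma concentrated_iso n v X Y :
  concentrated n v X -> concentrated n v Y -> T_iso X Y.
Proof.
have map0 W : concentrated n v W -> forall m u w (a : arrow u w) x, rep_map (W m) a x = 0.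
  move=> cW m u w a x; have := arrow_neq a; have [wv uw|wv _] := eqVneq w v; last first.
    by apply: rdim0_eq; rewrite cW (negPf wv) andbF.
  have -> : x = 0; last by rewrite linear0.
  by apply: rdim0_eq; rewrite cW -wv (negPf uw) andbF.
have diff0 W : concentrated n v W -> forall m u x, cdiff W m u x = 0.
  move=> cW m u x; have [mn|mn] := eqVneq m n; last first.
    by rewrite (_ : x = 0) ?linear0//; apply: rdim0_eq; rewrite cW (negPf mn).
  by apply: rdim0_eq; rewrite cW mn; case: eqP => //; lia.
move=> cX cY; apply: T_iso_of_dim; [exact: map0|exact: map0|exact: diff0|exact: diff0|].
by move=> m w; rewrite cX cY.
Qed.

Lemma concentrated_ex n v : exists X, concentrated n v X.
Proof.
have db : exists N : nat, forall m : int, (N < `|m|)%N -> forall w, (m == n) && (w == v) = 0%N :> nat.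
  by exists `|n|%N => m mn w; case: eqP mn => // ->; rewrite ltnn.
by exists (nullc db) => m w; rewrite rdim_null.
Qed.

Lemma concentrated_stalk v : concentrated 0 v (stalk (simple R v)).
Proof.
move=> m w; rewrite /stalk /=; case: eqP => _; rewrite rdim_null//.
Qed.

Lemma concentrated_shift n v X : concentrated (n + 1) v X -> concentrated n v (Defs.shift X).
Proof. by move=> cX m w; rewrite cX (inj_eq (addIr _)). Qed.

Lemma zero_db : exists N : nat, forall n : int, (N < `|n|)%N -> forall v : vertex, 0%N = 0%N.
Proof. by exists 0%N. Qed.

Definition zeroc : cplx R := nullc zero_db.

Lemma zeroc_eq0 n v (x : zeroc n v) : x = 0.
Proof. by apply: rdim0_eq; rewrite rdim_null. Qed.

Fact zero_hom_comm X Y n v (x : X n v) :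
  rhom0 (X (n + 1)) (Y (n + 1)) v (cdiff X n v x) = cdiff Y n v (rhom0 (X n) (Y n) v x).
Proof. by rewrite /= !lfunE /= linear0. Qed.

Definition zero_hom X Y : chom X Y := CHom (@zero_hom_comm X Y).

Lemma T_iso_zero X : (forall n v x, cdiff X (n + 1) v x = 0 -> exists y, x = cdiff X n v y) ->
  T_iso X zeroc.
Proof.
move=> ac; exists X, (cid_hom X), (zero_hom X zeroc); split; first exact: quasi_iso_id.
move=> n v; split=> [x /ac//|y _]; exists 0; first by rewrite linear0.
by exists 0; rewrite [RHS]linear0; exact: (@zeroc_eq0 (n + 1)).
Qed.

Section KHom.
Variable Z : cplx R -> C.
Hypothesis ZK : K_hom Z.

Lemma coneE A B (f : chom A B) n v (p : cone f n v) :
  cdiff (cone f) n v p = (- cdiff A (n + 1) v p.1, f (n + 1) v p.1 + cdiff B n v p.2).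
Proof. by rewrite /= lfunE. Qed.

Lemma K_cone A B (f : chom A B) : Z (cone f) = Z B + Z (Defs.shift A).
Proof. by apply: ZK; exists A, B, f; split; exact: T_iso_refl. Qed.

Lemma K_zeroc : Z zeroc = 0.
Proof.
have zz A : (forall n v (x : A n v), x = 0) -> T_iso A zeroc.
  by move=> A0; apply: T_iso_zero => n v x _; exists 0; rewrite linear0; exact: A0.
have : triangle zeroc zeroc zeroc.
  exists zeroc, zeroc, (zero_hom zeroc zeroc); split.
  - exact: T_iso_refl.
  - by apply: zz => n v [x y]; rewrite (zeroc_eq0 x) (zeroc_eq0 y).
  - by apply: zz => n v x; exact: (@zeroc_eq0 (n + 1)).
by move=> /ZK/esym/eqP; rewrite -subr_eq0 addrK => /eqP.
Qed.

(** Additivity is given on triangles only, so the isomorphism is turned into a triangle X -> Y -> 0: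
    the cone of 0 -> W is quasi-isomorphic to W by y |-> (0, y). *)
Lemma K_T_iso X Y : T_iso X Y -> Z X = Z Y.
Proof.
move=> [W [f [g [qf qg]]]].
pose i_fun n v (y : W n v) : cone (zero_hom zeroc W) n v := (0, y).
have i_lin n v : linear (@i_fun n v).
  move=> k x y; suff -> : i_fun n v (k *: x + y) = (k *: 0 + 0, k *: x + y) by [].
  by rewrite /i_fun scaler0 addr0.
pose i_hom n v : 'Hom(W n v, cone (zero_hom zeroc W) n v) :=
  linfun (HB.pack (@i_fun n v) (GRing.isLinear.Build C _ _ _ _ (@i_lin n v)) : {linear _ -> _}).
have iE n v y : i_hom n v y = (0, y) by rewrite lfunE.
have ic n v w (a : arrow v w) (x : W n v) :
    i_hom n w (rep_map (W n) a x) = rep_map (cone (zero_hom zeroc W) n) a (i_hom n v x).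
  rewrite !iE /= lfunE /= /pair_map /=; congr (_, _); by rewrite linear0.
have id_ n v (x : W n v) : RHom (ic (n + 1)) v (cdiff W n v x) =
    cdiff (cone (zero_hom zeroc W)) n v (RHom (ic n) v x).
  by rewrite coneE /= !iE /= !linear0 add0r.
have qi : quasi_iso (CHom id_).
  move=> n v; split=> [x dx [[a b]]|[a b]].
    by rewrite coneE /= iE => -[_]; rewrite !lfunE /= add0r => ->; exists b.
  rewrite coneE /= => -[_]; rewrite !lfunE /= add0r => db.
  exists b => //; exists 0; rewrite linear0 iE.
  by rewrite (zeroc_eq0 a) [LHS]subrr.
have : triangle X Y zeroc.
  exists zeroc, W, (zero_hom zeroc W); split.
  - by exists W, (cid_hom W), f; split => //; exact: quasi_iso_id.
  - by exists W, (CHom id_), g.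
  - apply: T_iso_zero => n v x _; exists 0; rewrite linear0; exact: (@zeroc_eq0 (n + 1 + 1)).
by move=> /ZK ->; rewrite K_zeroc addr0.
Qed.

(** The cone of the identity is acyclic. *)
Lemma K_shift X : Z (Defs.shift X) = - Z X.
Proof.
apply/eqP; rewrite -addr_eq0 addrC -(K_cone (cid_hom X)) (@K_T_iso _ zeroc) ?K_zeroc//.
apply: T_iso_zero => n v [x y]; rewrite coneE => -[] /= /eqP.
rewrite oppr_eq0 => /eqP dx; rewrite id_lfunE => e.
exists (y, 0); rewrite coneE /= id_lfunE linear0 addr0; congr (_, _).
by apply/eqP; rewrite -addr_eq0; apply/eqP.
Qed.

(** The map (x, y) |-> g y from the cone of f to W is a quasi-isomorphism; the two bullets under
    [qh] chase injectivity and surjectivity on cohomology. *)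
Lemma K_exact X Y W (f : chom X Y) (g : chom Y W) :
  (forall n, rep_exact (f n) (g n)) -> Z Y = Z X + Z W.
Proof.
move=> ex.
pose h_fun n v (p : cone f n v) : W n v := g n v p.2.
have h_lin n v : linear (@h_fun n v) by move=> k x y; rewrite /h_fun linearP.
pose h_hom n v : 'Hom(cone f n v, W n v) :=
  linfun (HB.pack (@h_fun n v) (GRing.isLinear.Build C _ _ _ _ (@h_lin n v)) : {linear _ -> _}).
have hE n v p : h_hom n v p = g n v p.2 by rewrite lfunE.
have gf n v x : g n v (f n v x) = 0.
  by have [_ _ h] := ex n v; apply/h; exists x.
have hc n v w (a : arrow v w) (p : cone f n v) :
    h_hom n w (rep_map (cone f n) a p) = rep_map (W n) a (h_hom n v p).
  by rewrite !hE /= lfunE /= rhom_comm.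
have hd n v (p : cone f n v) : RHom (hc (n + 1)) v (cdiff (cone f) n v p) =
    cdiff W n v (RHom (hc n) v p).
  by rewrite /= !hE -chom_comm coneE /= linearD /= gf add0r.
have qh : quasi_iso (CHom hd).
  move=> n v; split.
  - move=> [x y]; rewrite coneE => -[] /= /eqP; rewrite oppr_eq0 => /eqP dx e [w0].
    rewrite hE /= => gy; have [_ gs gk] := ex n v; have [fi1 _ gk1] := ex (n + 1) v.
    have [y' ey'] := gs w0.
    have : g (n + 1) v (y - cdiff Y n v y') = 0.
      by rewrite linearB /= chom_comm ey' gy subrr.
    move=> /gk1[x' ex']; exists (x', y'); rewrite coneE /=.
    have ey : f (n + 1) v x' + cdiff Y n v y' = y by rewrite -ex' subrK.
    rewrite ey; congr (_, _).
    have [fi2 _ _] := ex (n + 1 + 1) v; apply: fi2.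
    rewrite linearN /= chom_comm -ex' linearB /= cdiff2 subr0.
    by apply/eqP; rewrite -addr_eq0; apply/eqP.
  - move=> w0 dw; have [fi1 gs gk] := ex (n + 1) v; have [y ey] := gs w0.
    have [fi2 _ gk2] := ex (n + 1 + 1) v.
    have : g (n + 1 + 1) v (cdiff Y (n + 1) v y) = 0 by rewrite chom_comm ey.
    move=> /gk2[x ex']; exists (- x, y); last first.
      by exists 0; rewrite hE /= ey subrr linear0.
    rewrite coneE /= linearN opprK linearN /= -ex' addNr; congr (_, _).
    have [fi3 _ _] := ex (n + 1 + 1 + 1) v; apply: fi3.
    by rewrite chom_comm -ex' cdiff2 linear0.
have e : Z (cone f) = Z W.
  by apply: K_T_iso; exists (cone f), (cid_hom _), (CHom hd); split => //; exact: quasi_iso_id.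
by move: e; rewrite K_cone K_shift => <-; rewrite addrC subrK.
Qed.

End KHom.

End Complexes.

(** * Homomorphisms from the Grothendieck group *)

Section Devissage.
Variable R : realType.
Local Notation C := R[i].
Implicit Types X Y W A B : cplx R.

Section Subcomplex.
Variables (X : cplx R) (U : forall n v, {vspace X n v}).
Hypothesis closed : forall n v w (a : arrow v w) x,
  x \in U n v -> rep_map (X n) a x \in U n w.
Hypothesis closedd : forall n v x, x \in U n v -> cdiff X n v x \in U (n + 1) v.

Definition subc_diff (n : int) v : 'Hom(subvs_of (U n v), subvs_of (U (n + 1) v)) :=
  linfun (vsproj (U (n + 1) v) \o cdiff X n v \o vsval).

Lemma subc_diffE n v x : vsval (subc_diff n v x) = cdiff X n v (vsval x).
Proof. by rewrite lfunE /= vsprojK// closedd// subvsP. Qed.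

Fact subc_diff_comm n v w (a : arrow v w) (x : subrep (@closed n) v) :
  subc_diff n w (rep_map (subrep (@closed n)) a x) =
  rep_map (subrep (@closed (n + 1))) a (subc_diff n v x).
Proof.
apply/val_inj => /=; rewrite subc_diffE (sub_mapE (@closed n)).
by rewrite (sub_mapE (@closed (n + 1))) subc_diffE rhom_comm.
Qed.

Definition subc_rhom n : rhom (subrep (@closed n)) (subrep (@closed (n + 1))) :=
  @RHom R (subrep (@closed n)) (subrep (@closed (n + 1))) (subc_diff n) (@subc_diff_comm n).

Fact subc_diff2 n v x : subc_rhom (n + 1) v (subc_rhom n v x) = 0.
Proof. by apply/val_inj; rewrite /= !subc_diffE cdiff2. Qed.

Fact subc_bounded : exists N : nat, forall n : int,
  (N < `|n|)%N -> rep_zero (subrep (@closed n)).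
Proof.
have [N HN] := cbounded X; exists N => n /HN Xn v x.
by apply/val_inj; rewrite /= (Xn v (vsval x)).
Qed.

Definition subc : cplx R := Cplx subc_diff2 subc_bounded.

Definition quoc_diff (n : int) v : 'Hom(subvs_of (U n v)^C, subvs_of (U (n + 1) v)^C) :=
  linfun (coset_map (U (n + 1) v) \o cdiff X n v \o vsval).

Lemma quoc_diffE n v y :
  quoc_diff n v (coset_map (U n v) y) = coset_map (U (n + 1) v) (cdiff X n v y).
Proof.
rewrite lfunE /=; apply/esym/eqP; rewrite -subr_eq0 -!linearB /=; apply/eqP/coset_eq0.
by apply: closedd; exact: coset_sub.
Qed.

Fact quoc_diff_comm n v w (a : arrow v w) (x : quorep (@closed n) v) :
  quoc_diff n w (rep_map (quorep (@closed n)) a x) =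
  rep_map (quorep (@closed (n + 1))) a (quoc_diff n v x).
Proof.
rewrite -(coset_val x) /= (quo_mapE (@closed n)) !quoc_diffE.
by rewrite (quo_mapE (@closed (n + 1))) rhom_comm.
Qed.

Definition quoc_rhom n : rhom (quorep (@closed n)) (quorep (@closed (n + 1))) :=
  @RHom R (quorep (@closed n)) (quorep (@closed (n + 1))) (quoc_diff n) (@quoc_diff_comm n).

Fact quoc_diff2 n v x : quoc_rhom (n + 1) v (quoc_rhom n v x) = 0.
Proof. by rewrite /= -(coset_val x) !quoc_diffE cdiff2 linear0. Qed.

Fact quoc_bounded : exists N : nat, forall n : int,
  (N < `|n|)%N -> rep_zero (quorep (@closed n)).
Proof.
have [N HN] := cbounded X; exists N => n /HN Xn v x.
by rewrite -(coset_val x) (Xn v (vsval x)) linear0.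
Qed.

Definition quoc : cplx R := Cplx quoc_diff2 quoc_bounded.

Fact subc_incl_comm n v (x : subc n v) :
  sub_incl (@closed (n + 1)) v (cdiff subc n v x) = cdiff X n v (sub_incl (@closed n) v x).
Proof.
transitivity (vsval (subc_diff n v x)); first by rewrite /= lfunE.
by rewrite subc_diffE; congr (cdiff X n v _); rewrite /= lfunE.
Qed.

Fact quoc_proj_comm n v (x : X n v) :
  quo_proj (@closed (n + 1)) v (cdiff X n v x) = cdiff quoc n v (quo_proj (@closed n) v x).
Proof.
transitivity (quoc_diff n v (coset_map (U n v) x)); first by rewrite quoc_diffE /= lfunE.
by rewrite /=; congr (quoc_diff n v _); rewrite lfunE.
Qed.

Lemma K_sub_quo (Z : cplx R -> C) : K_hom Z -> Z X = Z subc + Z quoc.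
Proof.
move=> ZK; apply: (K_exact ZK (f := @CHom R subc X (fun n => sub_incl (@closed n)) subc_incl_comm)
  (g := @CHom R X quoc (fun n => quo_proj (@closed n)) quoc_proj_comm)) => n.
exact: sub_quo_exact.
Qed.

Lemma rdim_subc n v : rdim (subc n) v = \dim (U n v).
Proof. exact: rdim_sub. Qed.

Lemma rdim_quoc n v : rdim (quoc n) v = (rdim (X n) v - \dim (U n v))%N.
Proof. exact: rdim_quo. Qed.

End Subcomplex.

Section Vanishing.
Variable Z : cplx R -> C.
Hypothesis ZK : K_hom Z.
Hypothesis Z0 : forall v, Z (stalk (simple R v)) = 0.

Lemma K_concentrated n v X : concentrated n v X -> Z X = 0.
Proof.
have pos (k : nat) Y : concentrated k v Y -> Z Y = 0.
  elim: k Y => [|k IH] Y cY.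
    by rewrite (K_T_iso ZK (concentrated_iso cY (concentrated_stalk R v))).
  apply/eqP; rewrite -oppr_eq0 -K_shift//; apply/eqP/IH/concentrated_shift.
  by have -> : k%:Z + 1 = k.+1%:Z by lia.
have neg (k : nat) Y : concentrated (- k%:Z) v Y -> Z Y = 0.
  elim: k Y => [|k IH] Y cY; first exact: (pos 0%N).
  have [Y' cY'] := concentrated_ex R (- k%:Z) v.
  have cs : concentrated (- k.+1%:Z) v (Defs.shift Y').
    by apply: concentrated_shift; rewrite intS opprD addrAC addNr add0r.
  by rewrite (K_T_iso ZK (concentrated_iso cY cs)) K_shift// (IH _ cY') oppr0.
by case: (intP n) => [|k|k] cX; [exact: (pos 0%N)|exact: (pos k.+1)|exact: (neg k.+1)].
Qed.

Definition total (N : nat) X : nat :=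
  (\sum_(k < N.*2.+1) \sum_(v : vertex) rdim (X (k%:Z - N%:Z)%R) v)%N.

(** Induction on the total dimension. In the lowest nonzero degree, take a nonzero vertex of lowest
    level: no nonzero arrow or differential ends there, so a hyperplane at this place and everything
    elsewhere form a subcomplex, whose quotient is a shifted simple object. *)
Lemma K_vanish X : Z X = 0.
Proof.
have [N HN] := cbounded X.
have [T] := ubnP (total N X); elim: T X HN => // T IH X HN totX.
have [allz|] := pselect (forall n v, rdim (X n) v = 0%N).
  rewrite (@K_T_iso _ _ ZK X (zeroc R)) ?K_zeroc//.
  apply: T_iso_zero => n v x _; exists 0; rewrite linear0; exact: rdim0_eq.
move=> nz.
have out n v : (N < `|n|)%N -> rdim (X n) v = 0%N by move=> /HN /rep_zeroP; exact.
have win n v : rdim (X n) v <> 0%N -> exists2 k : nat, (k < N.*2.+1)%N & n = k%:Z - N%:Z.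
  move=> h; have nN : (`|n| <= N)%N by rewrite leqNgt; apply/negP => /(out n v).
  by exists `|(n + N%:Z)%R|%N; lia.
pose P k := [exists v, rdim (X (k%:Z - N%:Z)) v != 0%N].
have exP : exists k, P k.
  apply: contrapT => h; apply: nz => n v; apply: contrapT => nv.
  have [k kN nk] := win _ _ nv; apply: h; exists k.
  by apply/existsP; exists v; rewrite -nk; exact/eqP.
case: (ex_minnP exP) => k0 /existsP[v1 hv1] kmin.
pose n : int := k0%:Z - N%:Z.
case: (@arg_minnP _ v1 (fun v => rdim (X n) v != 0%N) level hv1) => v vn vmin.
have k0N : (k0 < N.*2.+1)%N.
  by have [k kN] := win n v (elimN eqP vn); rewrite /n; lia.
have nmin m w : m < n -> rdim (X m) w = 0%N.
  move=> mn; apply: contrapT => h; have [k kN mk] := win _ _ h.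
  have /kmin : P k by apply/existsP; exists w; rewrite -mk; exact/eqP.
  by move: mn; rewrite mk /n; lia.
pose U m w : {vspace X m w} := if (m == n) && (w == v) then hyper (X m w) else fullv.
have closed m u w (a : arrow u w) x : x \in U m u -> rep_map (X m) a x \in U m w.
  rewrite {2}/U; case: ifP => [/andP[/eqP mn /eqP wv]|_ _]; last exact: memvf.
  move=> _; have -> : x = 0; last by rewrite linear0 mem0v.
  apply: rdim0_eq; rewrite mn; apply: contrapT => /eqP /vmin.
  by rewrite -wv (arrow_level a) ltnn.
have closedd m w x : x \in U m w -> cdiff X m w x \in U (m + 1) w.
  rewrite {2}/U; case: ifP => [/andP[/eqP mn _]|_ _]; last exact: memvf.
  move=> _; have -> : x = 0; last by rewrite linear0 mem0v.
  by apply: rdim0_eq; apply: nmin; rewrite -mn; lia.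
have dq m w : rdim (quoc closed closedd m) w = (m == n) && (w == v).
  rewrite rdim_quoc /U; case: ifP => [/andP[/eqP mn /eqP wv]|_]; last by rewrite subnn.
  by rewrite dim_hyper -/(rdim (X m) w) mn wv; move: vn; case: (rdim _ _) => // d _; rewrite subSnn.
have ds m w : (rdim (X m) w = rdim (subc closed closedd m) w + ((m == n) && (w == v)))%N.
  by rewrite -(dq m w) rdim_quoc rdim_subc subnKC// dimvS// subvf.
rewrite (K_sub_quo closed closedd ZK) (@K_concentrated n v _ dq) addr0.
apply: IH.
  move=> m mN; apply/rep_zeroP => w; have := out m w mN; rewrite ds; lia.
apply: (@leq_trans (total N X)); last by rewrite -ltnS.
rewrite /total.
rewrite [leqRHS](eq_bigr (fun k : 'I_N.*2.+1 =>
  \sum_(w : vertex) rdim (subc closed closedd (k%:Z - N%:Z)%R) w +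
  \sum_(w : vertex) ((k%:Z - N%:Z == n)%R && (w == v)))%N); last first.
  by move=> k _; rewrite -big_split; apply: eq_bigr => w _; exact: ds.
rewrite big_split /= -addn1 leq_add2l (bigD1 (Ordinal k0N))//= (bigD1 v)//= !eqxx/=.
by rewrite -addnA leq_addr.
Qed.

End Vanishing.

End Devissage.

(** * Euler characteristics at the vertices as coordinates on the Grothendieck group *)

Section EulerCharacteristic.
Variable R : realType.
Local Notation C := R[i].
Implicit Types X Y W A B : cplx R.

Definition zsupp (f : int -> int) := exists N : nat, forall n, (N < `|n|)%N -> f n = 0.
Definition zsum (f : int -> int) : int := \sum_(n \in [set: int]) f n.

Definition window (N : nat) : seq int := [seq k%:Z - N%:Z | k <- iota 0 N.*2.+1].

Lemma mem_window N n : (n \in window N) = (`|n| <= N)%N.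
Proof.
apply/mapP/idP => [[k]|nN]; first by rewrite mem_iota; lia.
exists `|(n + N%:Z)%R|%N; rewrite ?mem_iota; lia.
Qed.

Lemma zsum_window f N : (forall n, (N < `|n|)%N -> f n = 0) ->
  zsum f = \sum_(n <- window N) f n.
Proof.
move=> h; rewrite /zsum (fsbigE (window N)); last 3 first.
- by rewrite map_inj_uniq ?iota_uniq// => i j; lia.
- by [].
- by move=> n _; rewrite mem_window -ltnNge => /h.
by apply: eq_bigl => n; rewrite in_setT.
Qed.

Lemma zsumD f g : zsupp f -> zsupp g -> zsum (fun n => f n + g n) = zsum f + zsum g.
Proof.
move=> [N fN] [M gM].
have f0 n : (maxn N M < `|n|)%N -> f n = 0 by rewrite gtn_max => /andP[/fN].
have g0 n : (maxn N M < `|n|)%N -> g n = 0 by rewrite gtn_max => /andP[_ /gM].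
rewrite (zsum_window f0) (zsum_window g0) (@zsum_window _ (maxn N M)) ?big_split//.
by move=> n nm; rewrite f0// g0.
Qed.

Lemma zsumN f : zsum (fun n => - f n) = - zsum f.
Proof.
rewrite -[RHS]mulN1r /zsum mulr_fsumr.
by apply: eq_fsbigr => n _; rewrite mulN1r.
Qed.

Lemma zsum_shift f : zsum (fun n => f (n + 1)) = zsum f.
Proof.
rewrite /zsum [RHS](reindex_fsbigT (fun n : int => n + 1))//.
by exists (fun n => n - 1) => n; rewrite ?addrK ?subrK.
Qed.

Definition sg (n : int) : int := (-1) ^+ `|n|%N.

Lemma sgS n : sg (n + 1) = - sg n.
Proof.
case: n => n; first by rewrite /sg addrC -intS exprS mulN1r.
have -> : Negz n + 1 = - n%:Z by lia.
by rewrite /sg abszN /= exprS mulN1r opprK.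
Qed.

Definition chi (v : vertex) X : int := zsum (fun n => sg n * (rdim (X n) v)%:Z).

Lemma zsupp_rdim v X : zsupp (fun n => (rdim (X n) v)%:Z).
Proof. by have [N HN] := cbounded X; exists N => n /HN/rep_zeroP ->. Qed.

Lemma zsupp_mul s f : zsupp f -> zsupp (fun n => s n * f n).
Proof. by move=> [N H]; exists N => n /H ->; rewrite mulr0. Qed.

Lemma chi_shift v X : chi v (Defs.shift X) = - chi v X.
Proof.
rewrite /chi -zsumN -[RHS]zsum_shift; apply: eq_fsbigr => n _.
by rewrite sgS mulNr opprK.
Qed.

Lemma chi_stalk v (Q : rep R) : chi v (stalk Q) = (rdim Q v)%:Z.
Proof.
rewrite /chi (@zsum_window _ 0) /=.
  by rewrite /window /= big_seq1 subrr /= /sg mul1r.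
move=> n n0; rewrite /stalk /=; case: eqP n0 => // [->//|_ _].
by rewrite rdim_null mulr0.
Qed.

Lemma chi_cone v A B (f : chom A B) : chi v (cone f) = chi v B + chi v (Defs.shift A).
Proof.
rewrite /chi -zsumD; [|exact/zsupp_mul/zsupp_rdim|exact/zsupp_mul/zsupp_rdim].
apply: eq_fsbigr => n _; rewrite -mulrDr -PoszD addnC; congr (_ * Posz _).
by rewrite /rdim !dimvf.
Qed.

Section QuasiIso.
Variables (X Y : cplx R) (f : chom X Y) (v : vertex).
Hypothesis qf : quasi_iso f.

Let z W (n : int) := \dim (lker (cdiff W n v)).
Let b W (n : int) := \dim (limg (cdiff W n v)).

Lemma cohomology_dim n : (z Y (n + 1) + b X n = z X (n + 1) + b Y n)%N.
Proof.
have [fi fs] := qf n v.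
have kP W m x : reflect (cdiff W m v x = 0) (x \in lker (cdiff W m v)).
  by rewrite memv_ker; exact: eqP.
have bP W m x : reflect (exists y, x = cdiff W m v y) (x \in limg (cdiff W m v)).
  apply: (iffP memv_imgP) => [[y _ ->]|[y ->]]; first by exists y.
  by exists y => //; exact: memvf.
have BK W : (limg (cdiff W n v) <= lker (cdiff W (n + 1) v))%VS.
  by apply/subvP => x /bP[y ->]; apply/kP; exact: cdiff2.
apply: (@dim_quasi_iso _ _ _ (f (n + 1) v)) => //.
- by move=> x /kP dx; apply/kP; rewrite -chom_comm dx linear0.
- by move=> x /bP[y ->]; apply/bP; exists (f n v y); rewrite chom_comm.
- by move=> x /kP dx /bP h; apply/bP; exact: fi.
- by move=> y /kP/fs[x /kP dx /bP h]; exists x.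
Qed.

Lemma chi_quasi_iso : chi v X = chi v Y.
Proof.
have rE W n : rdim (W n) v = (z W n + b W n)%N.
  by rewrite /rdim -(limg_ker_dim (cdiff W n v) fullv) capfv.
have sz W : zsupp (fun n => (z W n)%:Z).
  by have [N HN] := cbounded W; exists N => n /HN/rep_zeroP/(_ v); rewrite rE; lia.
have sb W : zsupp (fun n => (b W n)%:Z).
  by have [N HN] := cbounded W; exists N => n /HN/rep_zeroP/(_ v); rewrite rE; lia.
have sz1 W : zsupp (fun n => (z W (n + 1))%:Z).
  by have [N HN] := sz W; exists N.+1 => n nN; apply: HN; lia.
(* Boundaries coming from degree n are paired with cycles in degree n + 1, so that each summand is,
   up to sign, the dimension of a cohomology space. *)
have chiE W : chi v W = zsum (fun n => sg n * ((b W n)%:Z - (z W (n + 1))%:Z)).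
  transitivity (zsum (fun n => sg n * (b W n)%:Z) + zsum (fun n => sg n * (z W n)%:Z)).
    rewrite -zsumD; [|exact: zsupp_mul|exact: zsupp_mul].
    by apply: eq_fsbigr => n _; rewrite rE PoszD mulrDr addrC.
  rewrite -[X in _ + X = _]zsum_shift -zsumD; [|exact: zsupp_mul|].
    by apply: eq_fsbigr => n _; rewrite sgS mulNr mulrBr.
  exact: (zsupp_mul _ (sz1 W)).
rewrite !chiE; apply: eq_fsbigr => n _; congr (_ * _).
have /(congr1 Posz) := cohomology_dim n; rewrite !PoszD.
move: (Posz (b X n)) (Posz (z X (n + 1))) (Posz (b Y n)) (Posz (z Y (n + 1))) => *; lia.
Qed.

End QuasiIso.

Lemma chi_T_iso v X Y : T_iso X Y -> chi v X = chi v Y.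
Proof.
by move=> [W [f [g [qf qg]]]]; rewrite -(chi_quasi_iso v qf) (chi_quasi_iso v qg).
Qed.

Lemma chi_triangle v X Y W : triangle X Y W -> chi v Y = chi v X + chi v W.
Proof.
move=> [A [B [f [BX cY sW]]]].
by rewrite -(chi_T_iso v cY) chi_cone (chi_T_iso v BX) (chi_T_iso v sW).
Qed.

(** The difference of the two sides is additive and vanishes on the simple objects, so [K_vanish]
    applies to it. *)
Lemma K_hom_chi (Z : cplx R -> C) : K_hom Z -> forall X,
  Z X = \sum_v (chi v X)%:~R * Z (stalk (simple R v)).
Proof.
move=> ZK X; apply/eqP; rewrite -subr_eq0; apply/eqP.
pose D Y := Z Y - \sum_v (chi v Y)%:~R * Z (stalk (simple R v)).
apply: (@K_vanish R D) => [Y1 Y2 Y3 T|u]; rewrite /D.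
  rewrite (ZK _ _ _ T) addrACA -opprD -big_split; congr (_ - _).
  by apply: eq_bigr => v _; rewrite (chi_triangle v T) intrD mulrDl.
rewrite (bigD1 u)//= chi_stalk rdim_null eqxx mul1r big1 ?addr0 ?subrr// => v vu.
by rewrite chi_stalk rdim_null (negPf vu) mul0r.
Qed.

End EulerCharacteristic.

(** * Stability conditions with phases depending on the level *)

Definition polar (R : realType) (m phi : R) : R[i] := m%:C%C * cexp (0 +i* phi)%C.

Lemma polarE (R : realType) (m phi : R) :
  polar m phi = ((m * cos phi) +i* (m * sin phi))%C.
Proof.
rewrite /polar /cexp /= expR0; apply/eqP; rewrite eq_complex /=.
by apply/andP; split; apply/eqP; ring.
Qed.

Section LevelStability.
Variable R : realType.
Local Notation C := R[i].
Implicit Types M N Q E : rep R.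

Lemma level_le v : (level v <= 15)%N.
Proof.
rewrite /level (leq_trans (leq_sum _ (fun i _ => (leq_ord (v i) : v i <= 3)%N)))//.
by rewrite sum_nat_const card_ord.
Qed.

Definition at_level j Q := ~ rep_zero Q /\ forall v, level v != j -> rdim Q v = 0%N.

Lemma nonzeroP Q : ~ rep_zero Q <-> exists v, rdim Q v != 0%N.
Proof.
split=> [h|[v /eqP h] /rep_zeroP/(_ v)//].
apply: contrapT => h'; apply: h; apply/rep_zeroP => v; apply: contrapT => /eqP h.
by apply: h'; exists v.
Qed.

(** Meant for objects living in a single level, where any vertex with a nonzero space gives the same
    answer; 0 is the default for the zero representation. *)
Definition lev Q : nat := if [pick v | rdim Q v != 0%N] is Some v then level v else 0.

Lemma at_level_lev j Q : at_level j Q -> lev Q = j.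
Proof.
move=> [/nonzeroP[u hu] h]; rewrite /lev; case: pickP => [v hv|/(_ u)]; last by rewrite hu.
by apply/eqP; apply: contraNT hv => /h ->.
Qed.

Lemma at_level_le j Q : at_level j Q -> (j <= 15)%N.
Proof.
move=> [/nonzeroP[u hu] h]; have [<-|/h e] := eqVneq (level u) j; first exact: level_le.
by rewrite e in hu.
Qed.

Lemma at_level_eq0 j Q v (x : Q v) : at_level j Q -> level v != j -> x = 0.
Proof. by move=> [_ h] /h; exact: rdim0_eq. Qed.

Lemma at_level_map0 j Q v w (a : arrow v w) x : at_level j Q -> rep_map Q a x = 0.
Proof.
move=> Qj; have [vj|vj] := eqVneq (level v) j.
  by apply: (at_level_eq0 _ Qj); rewrite (arrow_level a) vj; lia.
by rewrite (at_level_eq0 x Qj vj) linear0.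
Qed.

Lemma at_level_simple s : at_level (level s) (simple R s).
Proof.
split; first by apply/nonzeroP; exists s; rewrite rdim_null eqxx.
by move=> v vs; rewrite rdim_null; have [e|//] := eqVneq v s; rewrite e eqxx in vs.
Qed.

(** If j' is not j + 1, the extension vanishes at level j + 1, where the arrows from level j end; so
    linear sections of g chosen at the vertices commute with all arrows and split it. *)
Lemma Ext1_at_level j j' Q Q' : at_level j Q -> at_level j' Q' -> Ext1_neq0 Q Q' -> j' = j.+1.
Proof.
move=> Qj Qj' [E [f [g [ex nsplit]]]]; apply: contrapT => jj; apply: nsplit.
have hc v w (a : arrow v w) (x : Q v) :
    (g w)^-1%VF (rep_map Q a x) = rep_map E a ((g v)^-1%VF x).
  have [vj|vj] := eqVneq (level v) j; last first.
    by rewrite (at_level_eq0 x Qj vj) !linear0.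
  rewrite (at_level_map0 a x Qj) linear0; apply/esym/rdim0_eq.
  rewrite (rdim_exact ex) Qj.2 ?Qj'.2//; rewrite (arrow_level a) vj.
    by apply/eqP => e; apply: jj.
  by lia.
exists (RHom hc) => v x; have [_ gs _] := ex v; apply: limg_lfunVK.
by have [y <-] := gs x; exact: memv_img (memvf y).
Qed.

Lemma Hom_at_level j j' Q Q' : at_level j Q -> at_level j' Q' -> j != j' -> Hom_eq0 Q Q'.
Proof.
move=> Qj Qj' jj f v x; have [vj|vj] := eqVneq (level v) j.
  by apply: (at_level_eq0 _ Qj'); rewrite vj.
by rewrite (at_level_eq0 x Qj vj) linear0.
Qed.

(** Arrows raise the level, so the part of E above its lowest level is a subrepresentation, with
    quotient in that level; the quotients thus appear in order of increasing level. The number 16 is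
    one more than the top level. *)
Lemma level_filtration d k E : (k + d = 16)%N -> ~ rep_zero E ->
  (forall v, (level v < k)%N -> rdim E v = 0%N) ->
  exists (n : nat) (F Q : nat -> rep R) (l : nat -> nat),
    [/\ F 0%N = E, rep_zero (F n),
        (forall i, (i < n)%N -> rep_ext (F i.+1) (F i) (Q i) /\ at_level (l i) (Q i)),
        (forall i, (i < n)%N -> (k <= l i)%N)
      & forall i, (i.+1 < n)%N -> (l i < l i.+1)%N].
Proof.
elim: d k E => [|d IH] k E kd E0 Ek.
  case: E0; apply/rep_zeroP => v; by apply: Ek; have := level_le v; lia.
have kd1 : (k.+1 + d = 16)%N by rewrite -kd addnS.
have [noneq|] := pselect (forall v, level v = k -> rdim E v = 0%N).
  have Ek1 v : (level v < k.+1)%N -> rdim E v = 0%N.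
    by rewrite ltnS leq_eqVlt => /orP[/eqP/noneq//|/Ek].
  have [n [F [Q [l [F0 Fn FQ kl ll]]]]] := IH k.+1 E kd1 E0 Ek1.
  by exists n, F, Q, l; split=> // i /kl; exact: ltnW.
move=> hk.
pose U v : {vspace E v} := if level v == k then 0%VS else fullv.
have closed v w (a : arrow v w) x : x \in U v -> rep_map E a x \in U w.
  rewrite {2}/U; case: ifP => [/eqP wk|_ _]; last exact: memvf.
  move=> _; rewrite (_ : x = 0) ?linear0 ?mem0v//.
  by apply: rdim0_eq; apply: Ek; rewrite -wk (arrow_level a).
have dq v : rdim (quorep closed) v = if level v == k then rdim E v else 0%N.
  by rewrite rdim_quo /U; case: ifP => _; rewrite ?dimv0 ?subn0 ?subnn.
have ds v : rdim (subrep closed) v = if level v == k then 0%N else rdim E v.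
  by rewrite rdim_sub /U; case: ifP => _; rewrite ?dimv0.
have Qk : at_level k (quorep closed).
  split; last by move=> v vk; rewrite dq (negPf vk).
  move=> /rep_zeroP z; apply: hk => v vk; have := z v; by rewrite dq vk eqxx.
have ext : rep_ext (subrep closed) E (quorep closed).
  by exists (sub_incl closed), (quo_proj closed); exact: sub_quo_exact.
have [z|nz] := pselect (rep_zero (subrep closed)).
  exists 1%N, (fun i => if i is 0%N then E else subrep closed), (fun=> quorep closed), (fun=> k).
  by split=> // i; rewrite ltnS leqn0 => /eqP ->.
have sk v : (level v < k.+1)%N -> rdim (subrep closed) v = 0%N.
  by rewrite ds ltnS leq_eqVlt; case: eqP => //= _ /Ek.
have [n [F [Q [l [F0 Fn FQ kl ll]]]]] := IH k.+1 _ kd1 nz sk.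
exists n.+1, (fun i => if i is i'.+1 then F i' else E),
  (fun i => if i is i'.+1 then Q i' else quorep closed),
  (fun i => if i is i'.+1 then l i' else k).
split=> //.
- by case=> [_|i]; [rewrite F0|rewrite ltnS => /FQ].
- by case=> [|i]//; rewrite ltnS => /kl/ltnW.
- by case=> [|i]; rewrite ltnS; [exact: kl|exact: ll].
Qed.

(** * The stability condition of a family of masses and phases *)

Section Construction.
Variables (m phi : nat -> R).
Hypothesis m_gt0 : forall j, (j <= 15)%N -> 0 < m j.
Hypothesis phi_lt : forall j k, (j < k)%N -> (k <= 15)%N -> phi j < phi k.
Hypothesis phi_step : forall j, (j < 15)%N -> phi j.+1 - phi j < pi.

Definition lcharge (j : nat) : C := polar (m j) (phi j).

Definition std_charge (X : cplx R) : C := \sum_v (chi v X)%:~R * lcharge (level v).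

Definition std_ss Q := exists j, at_level j Q.

Definition std_phase Q := phi (lev Q).

Lemma std_K : K_hom std_charge.
Proof.
move=> X Y W T; rewrite /std_charge -big_split; apply: eq_bigr => v _.
by rewrite (chi_triangle v T) intrD mulrDl.
Qed.

Lemma std_charge_simple s : std_charge (stalk (simple R s)) = lcharge (level s).
Proof.
rewrite /std_charge (bigD1 s)//= chi_stalk rdim_null eqxx mul1r big1 ?addr0// => v vs.
by rewrite chi_stalk rdim_null (negPf vs) mul0r.
Qed.

Lemma std_neq0 Q : std_ss Q -> ~ rep_zero Q.
Proof. by move=> [j []]. Qed.

Lemma at_level_iso j Q Q' : at_level j Q -> rep_iso Q Q' -> at_level j Q'.
Proof.
move=> [/nonzeroP[u hu] h] i; split; last by move=> v /h; rewrite (rdim_iso i).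
by apply/nonzeroP; exists u; rewrite -(rdim_iso i).
Qed.

Lemma std_iso Q Q' : std_ss Q -> rep_iso Q Q' -> std_ss Q'.
Proof. by move=> [j Qj] i; exists j; exact: at_level_iso i. Qed.

Lemma std_ss_charge Q : std_ss Q ->
  exists2 r : R, 0 < r & std_charge (stalk Q) = polar r (std_phase Q).
Proof.
move=> [j Qj]; pose d := (\sum_v rdim Q v)%N.
have d0 : (0 < d)%N.
  have [/nonzeroP[u hu] _] := Qj; rewrite /d (bigD1 u)//= addn_gt0 lt0n hu//.
exists (d%:R * m j); first by rewrite mulr_gt0 ?ltr0n// m_gt0// (at_level_le Qj).
rewrite /std_charge /std_phase (at_level_lev Qj).
transitivity (\sum_v (rdim Q v)%:R * lcharge j).
  apply: eq_bigr => v _; rewrite chi_stalk -pmulrn.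
  by have [->//|/Qj.2 ->] := eqVneq (level v) j; rewrite !mul0r.
by rewrite -mulr_suml -natr_sum -/d /lcharge /polar mulrA rmorphM /= rmorph_nat.
Qed.

Lemma std_ext1 Q Q' : std_ss Q -> std_ss Q' -> Ext1_neq0 Q Q' ->
  `|std_phase Q - std_phase Q'| < pi.
Proof.
move=> [j Qj] [j' Qj'] e; have jj := Ext1_at_level Qj Qj' e.
rewrite /std_phase (at_level_lev Qj) (at_level_lev Qj') jj distrC.
have j15 : (j < 15)%N by have := at_level_le Qj'; rewrite jj.
by rewrite ger0_norm ?phi_step// subr_ge0 ltW// phi_lt.
Qed.

Lemma std_hom Q Q' : std_ss Q -> std_ss Q' -> std_phase Q < std_phase Q' -> Hom_eq0 Q' Q.
Proof.
move=> [j Qj] [j' Qj']; rewrite /std_phase (at_level_lev Qj) (at_level_lev Qj') => lt.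
by apply: (Hom_at_level Qj' Qj); apply: contraTneq lt => ->; rewrite ltxx.
Qed.

Lemma std_filtration E : ~ rep_zero E ->
  exists (n : nat) (F Q : nat -> rep R),
    [/\ F 0%N = E, rep_zero (F n),
        (forall i, (i < n)%N -> rep_ext (F i.+1) (F i) (Q i) /\ std_ss (Q i))
      & forall i, (i.+1 < n)%N -> std_phase (Q i) < std_phase (Q i.+1)].
Proof.
have h v : (level v < 0)%N -> rdim E v = 0%N by [].
move=> E0; have [n [F [Q [l [F0 Fn FQ _ ll]]]]] := @level_filtration 16 0 E erefl E0 h.
exists n, F, Q; split=> // i.
  by move=> /FQ[? ?]; split=> //; exists (l i).
move=> i1n; have [_ q1] := FQ _ i1n; have [_ q0] := FQ _ (ltnW i1n).
rewrite /std_phase (at_level_lev q0) (at_level_lev q1); apply: phi_lt; first exact: ll.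
exact: at_level_le q1.
Qed.

Definition std : stability R :=
  Stability std_K std_neq0 std_iso std_ss_charge std_ext1 std_hom std_filtration.

(** Arrows act by zero within one level, so a line at a vertex is a subobject; unless it is
    everything, its quotient is nonzero of the same phase. Conversely, dimension one leaves no room
    for two nonzero pieces. *)
Lemma std_stable Q : stable std Q <-> exists s, rep_iso Q (simple R s).
Proof.
split=> [[[j Qj] nex]|[s i]].
  have [/nonzeroP[v hv] _] := Qj; have vj : level v = j.
    by apply/eqP; apply: contraNT hv => /Qj.2 ->.
  exists v; apply: rep_iso_of_dim => [u w a x|u w a x|u].
  - exact: at_level_map0 Qj.
  - exact: at_level_map0 (at_level_simple v).
  rewrite rdim_null; apply: contrapT => hu; apply: nex.
  pose U u : {vspace Q u} := if u == v then <[vpick {:Q u}]>%VS else 0%VS.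
  have closed u1 w (a : arrow u1 w) x : x \in U u1 -> rep_map Q a x \in U w.
    by rewrite (at_level_map0 a x Qj) mem0v.
  have dU w : \dim (U w) = (w == v).
    rewrite /U; case: eqP => [->|_]; last by rewrite dimv0.
    by rewrite dim_vline vpick0 -dimv_eq0 hv.
  have subj : at_level j (subrep closed).
    split; first by apply/nonzeroP; exists v; rewrite rdim_sub dU eqxx.
    by move=> w wj; rewrite rdim_sub dU; have [e|//] := eqVneq w v; rewrite e vj eqxx in wj.
  have quoj : at_level j (quorep closed).
    split; last by move=> w /Qj.2 wj; rewrite rdim_quo wj.
    apply/nonzeroP; exists u; rewrite rdim_quo dU; apply/eqP => e; apply: hu.
    by move: e hv; case: eqP => [->|_]; lia.
  have phiE M : at_level j M -> phase std M = phase std Q.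
    by move=> Mj; rewrite /= /std_phase (at_level_lev Mj) (at_level_lev Qj).
  exists (subrep closed), (quorep closed); split.
  - by exists j.
  - by exists j.
  - exact: phiE.
  - exact: phiE.
  - by exists (sub_incl closed), (quo_proj closed); exact: sub_quo_exact.
have dQ := rdim_iso i.
have Qs : at_level (level s) Q.
  have [_ hs] := at_level_simple s; split; last by move=> v /hs; rewrite dQ.
  by apply/nonzeroP; exists s; rewrite dQ rdim_null eqxx.
split; first by exists (level s).
move=> [Q' [Q'' [/std_neq0/nonzeroP[v' h'] /std_neq0/nonzeroP[v'' h''] _ _ [f [g ex]]]]].
have d := rdim_exact ex; have d1 := d v'; have d2 := d v''.
move: d1 d2 h' h''; rewrite !dQ !rdim_null.
case: (v' =P s) => [->|_]; last by lia.
by case: (v'' =P s) => [->|_]; lia.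
Qed.

Lemma std_phase_simple Q s : rep_iso Q (simple R s) -> phase std Q = phi (level s).
Proof.
move=> i; rewrite /= /std_phase (@at_level_lev (level s))//.
have [_ hs] := at_level_simple s; split; last by move=> v /hs; rewrite (rdim_iso i).
by apply/nonzeroP; exists s; rewrite (rdim_iso i) rdim_null eqxx.
Qed.

(* These signs are how different phases are seen to give different hearts. *)
Lemma std_tilt_chi p X : tilt std p X ->
  forall v, if p < phi (level v) then 0 <= chi v X else chi v X <= 0.
Proof.
elim=> {X} [v|Q [j Qj]|Q [j Qj]|X Y W _ IX _ IW T v].
- by rewrite chi_stalk rdim_null; case: ifP.
- rewrite /= /std_phase (at_level_lev Qj) => pj v; rewrite chi_stalk.
  by case: ifP => // pv; have [vj|/Qj.2 ->//] := eqVneq (level v) j; rewrite vj pj in pv.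
- rewrite /= /std_phase (at_level_lev Qj) => pj v; rewrite chi_shift chi_stalk.
  case: ifP => [pv|_]; last by rewrite oppr_le0.
  by have [vj|/Qj.2 ->//] := eqVneq (level v) j; rewrite vj ltNge pj in pv.
- have := IX v; have := IW v; rewrite (chi_triangle v T); case: ifP => _ h1 h2.
    exact: addr_ge0.
  by rewrite -(addr0 0); exact: lerD.
Qed.

(** The hearts are separated at the smaller of the two phases: there exactly one of them contains s
    shifted, and the Euler characteristic at s has the wrong sign for the other. *)
Lemma std_wall tau s : ss tau (simple R s) -> phase tau (simple R s) != phi (level s) ->
  second_kind_wall_crossing tau std.
Proof.
move=> ts; rewrite neq_lt => /orP[lt|lt].
  exists (phase tau (simple R s)) => h.
  have /h/std_tilt_chi/(_ s) := tilt_le ts (lexx _).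
  by rewrite lt chi_shift chi_stalk rdim_null eqxx.
exists (phi (level s)) => h.
have /h/std_tilt_chi/(_ s) := tilt_gt ts lt.
by rewrite ltxx chi_stalk rdim_null eqxx.
Qed.

End Construction.

Lemma rep_iso_sym M N : rep_iso M N -> rep_iso N M.
Proof.
move=> [f fb].
have inj v : injective (f v) by have [g fK _] := fb v; exact: can_inj fK.
have ker0 v : lker (f v) == 0%VS by exact/lker0P.
have fK v : cancel (f v) (f v)^-1%VF by exact: lker0_lfunK.
have gK v : cancel (f v)^-1%VF (f v).
  by move=> y; have [h hK hK'] := fb v; rewrite -{1}(hK' y) fK hK'.
have gc v w (a : arrow v w) (y : N v) :
    (f w)^-1%VF (rep_map N a y) = rep_map M a ((f v)^-1%VF y).
  by apply: (inj w); rewrite gK rhom_comm gK.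
by exists (RHom gc) => v; exists (f v).
Qed.

(** An isomorphism is a nonzero map in both directions, so [ss_hom] excludes both strict
    inequalities. *)
Lemma phase_iso (sigma : stability R) Q Q' :
  ss sigma Q -> rep_iso Q Q' -> phase sigma Q = phase sigma Q'.
Proof.
have le M N : ss sigma M -> ss sigma N -> rep_iso M N -> phase sigma M <= phase sigma N.
  move=> sM sN [f fb]; rewrite leNgt; apply/negP => /(ss_hom sN sM)/(_ f) f0.
  case: (ss_neq0 sM) => v x; have [g fK _] := fb v; apply: (can_inj fK).
  by rewrite f0 linear0.
move=> sQ i; have sQ' := ss_iso sQ i.
by apply/eqP; rewrite eq_le !le//; exact: rep_iso_sym.
Qed.

End LevelStability.

(** * Extensions of simple representations *)

Section SimpleExtension.
Variable R : realType.
Local Notation C := R[i].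
Variables v w : vertex.

(** The matrix of ones has size (u == v) by (u' == w): it is the 1 by 1 identity when u = v and u' =
    w, and empty otherwise. *)
Definition ext_map (u u' : vertex) (p : 'rV[C]_(u == v) * 'rV[C]_(u == w)) :
    'rV[C]_(u' == v) * 'rV[C]_(u' == w) := (0, p.1 *m const_mx 1).

Fact ext_map_linear u u' : linear (@ext_map u u').
Proof.
move=> k x y; congr (_, _) => /=; first by rewrite scaler0 addr0.
by rewrite mulmxDl scalemxAl.
Qed.

HB.instance Definition _ u u' :=
  GRing.isLinear.Build C ('rV[C]_(u == v) * 'rV[C]_(u == w))%type
    ('rV[C]_(u' == v) * 'rV[C]_(u' == w))%type _ _ (@ext_map_linear u u').

Fact ext_rep_square u a b u' (_ : arrow u a) (_ : arrow a u') (_ : arrow u b)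
    (_ : arrow b u') (x : 'rV[C]_(u == v) * 'rV[C]_(u == w)) :
  linfun (@ext_map a u') (linfun (@ext_map u a) x) =
  linfun (@ext_map b u') (linfun (@ext_map u b) x).
Proof. by rewrite !lfunE /= /ext_map /= !mul0mx. Qed.

Definition ext_rep : rep R :=
  @Rep R (fun u => ('rV[C]_(u == v) * 'rV[C]_(u == w))%type)
    (fun u u' _ => linfun (@ext_map u u')) ext_rep_square.

Definition ext_inl (u : vertex) (y : 'rV[C]_(u == w)) :
  'rV[C]_(u == v) * 'rV[C]_(u == w) := (0, y).

Fact ext_inl_linear u : linear (@ext_inl u).
Proof. by move=> k x y; congr (_, _) => /=; rewrite scaler0 addr0. Qed.

HB.instance Definition _ u :=
  GRing.isLinear.Build C 'rV[C]_(u == w)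
    ('rV[C]_(u == v) * 'rV[C]_(u == w))%type _ _ (@ext_inl_linear u).

Fact ext_sub_comm u u' (a : arrow u u') (x : simple R w u) :
  linfun (@ext_inl u') (rep_map (simple R w) a x) =
  rep_map ext_rep a (linfun (@ext_inl u) x).
Proof. by rewrite /= !lfunE /= /ext_inl /ext_map /= mul0mx. Qed.

Fact ext_quo_comm u u' (a : arrow u u') (x : ext_rep u) :
  linfun (@fst 'rV[C]_(u' == v) 'rV[C]_(u' == w)) (rep_map ext_rep a x) =
  rep_map (simple R v) a (linfun (@fst 'rV[C]_(u == v) 'rV[C]_(u == w)) x).
Proof. by rewrite /= !lfunE. Qed.

Definition ext_sub : rhom (simple R w) ext_rep :=
  @RHom R (simple R w) ext_rep (fun u => linfun (@ext_inl u)) ext_sub_comm.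

Definition ext_quo : rhom ext_rep (simple R v) :=
  @RHom R ext_rep (simple R v)
    (fun u => linfun (@fst 'rV[C]_(u == v) 'rV[C]_(u == w))) ext_quo_comm.

(** A splitting would commute with the arrow from v to w, which acts by zero on the simple object at
    v but not on [ext_rep]. *)
Lemma Ext1_simple : arrow v w -> Ext1_neq0 (simple R v) (simple R w).
Proof.
move=> a; exists ext_rep, ext_sub, ext_quo; split.
  move=> u; split=> [x y|z|[y1 y2]] /=.
  - by rewrite !lfunE => -[].
  - by exists (z, 0); rewrite lfunE.
  - rewrite lfunE /=; split=> [->|[x]]; first by exists y2; rewrite lfunE.
    by rewrite lfunE => -[].
move=> [h hK]; have := rhom_comm h a (const_mx 1).
have := hK v (const_mx 1); rewrite /= !lfunE /= /ext_map => ->.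
(* Summing the entries avoids naming an index of the row, whose length w == w does not compute. *)
rewrite linear0 => -[] /(congr1 (fun A : 'rV_(w == w) => \sum_i A 0 i)) /eqP.
rewrite big1 => [|i _]; last by rewrite mxE.
rewrite eq_sym (eq_bigr (fun=> (v == v)%:R)) => [|i _].
  by rewrite sumr_const card_ord !eqxx oner_eq0.
rewrite mxE (eq_bigr (fun=> 1)) => [|k _]; last by rewrite !mxE mulr1.
by rewrite sumr_const card_ord.
Qed.

End SimpleExtension.

Lemma rep_iso_refl (R : realType) (M : rep R) : rep_iso M M.
Proof. by exists (id_rhom M) => v; exists id => x; rewrite /= id_lfunE. Qed.

(* The coordinates are raised to 3 one after the other. *)
Definition vert (j : nat) : vertex := [ffun i : 'I_5 => inord (minn 3 (j - 3 * i))].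

Lemma vertE j (i : 'I_5) : vert j i = minn 3 (j - 3 * i) :> nat.
Proof. by rewrite ffunE inordK// ltnS geq_minl. Qed.

Lemma level_vert j : (j <= 15)%N -> level (vert j) = j.
Proof.
by move=> j15; rewrite /level !big_ord_recl big_ord0 !vertE /= /bump /=; lia.
Qed.

Lemma arrow_vert j : (j < 15)%N -> arrow (vert j) (vert j.+1).
Proof.
(* The coordinate raised in passing from j to j + 1 is the one of index j %/ 3. *)
move=> j15; have j5 : (j %/ 3 < 5)%N by lia.
apply/existsP; exists (Ordinal j5); rewrite !vertE /=; apply/andP; split; first by lia.
apply/forallP => i; apply/implyP; rewrite -!val_eqE /= !vertE /= => ij; lia.
Qed.

(** * Polar form and lifting of arguments *)

Section Polar.
Variable R : realType.
Local Notation C := R[i].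

Lemma cross_polar (m phi m' phi' : R) :
  cross (polar m phi) (polar m' phi') = m * m' * sin (phi' - phi).
Proof. by rewrite !polarE /cross /= sinB; ring. Qed.

Lemma dot_polar (m phi m' phi' : R) :
  dot (polar m phi) (polar m' phi') = m * m' * cos (phi' - phi).
Proof. by rewrite !polarE /dot /= cosB; ring. Qed.

Lemma polar_upper (a b : R) : 0 < b ->
  exists r t, [/\ 0 < r, 0 < t < pi, a = r * cos t & b = r * sin t].
Proof.
move=> b0; pose r := Num.sqrt (a ^+ 2 + b ^+ 2).
have s0 : 0 < a ^+ 2 + b ^+ 2 by rewrite ltr_wpDl ?sqr_ge0// exprn_gt0.
have r0 : 0 < r by rewrite sqrtr_gt0.
have r2 : r ^+ 2 = a ^+ 2 + b ^+ 2 by rewrite sqr_sqrtr// ltW.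
have ab : 1 - (a / r) ^+ 2 = (b / r) ^+ 2.
  by rewrite !expr_div_n r2; field; rewrite gt_eqF.
have ar : (a / r) ^+ 2 < 1 by rewrite -subr_gt0 ab exprn_gt0// divr_gt0.
have /andP[h1 h2] : -1 < a / r < 1.
  by rewrite -ltr_norml -(@ltr_pXn2r _ 2) ?nnegrE// ?expr1n ?real_normK ?num_real.
exists r, (acos (a / r)); split=> //.
- by rewrite acos_gt0 ?acos_ltpi ?h1 ?h2 ?(ltW h1) ?(ltW h2).
- by rewrite acosK ?in_itv /= ?(ltW h1) ?(ltW h2)//; field; rewrite gt_eqF.
- rewrite sin_acos ?(ltW h1) ?(ltW h2)// ab sqrtr_sqr ger0_norm ?divr_ge0 ?ltW//.
  by field; rewrite gt_eqF.
Qed.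

(** Rotated by - phi, the point z lies in the open upper half-plane, where [polar_upper] supplies an
    angle between 0 and pi. *)
Lemma polar_next (m phi : R) (z : C) : 0 < m -> 0 < cross (polar m phi) z ->
  exists m' phi', [/\ 0 < m', z = polar m' phi' & phi < phi' < phi + pi].
Proof.
move=> m0; rewrite polarE; case: z => x y c0.
have b0 : 0 < cos phi * y - sin phi * x.
  by move: c0; rewrite /cross /= -!mulrA -mulrBr pmulr_rgt0.
have [r [t [r0 /andP[t0 tpi] ea eb]]] := polar_upper (cos phi * x + sin phi * y) b0.
exists r, (phi + t); split=> //; last by rewrite ltrDl t0 ltrD2l.
have cs := cos2Dsin2 phi.
rewrite polarE cosD sinD; congr (_ +i* _)%C.
  transitivity (cos phi * (r * cos t) - sin phi * (r * sin t)); last by ring.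
  by rewrite -ea -eb -[LHS]mulr1 -cs; ring.
transitivity (sin phi * (r * cos t) + cos phi * (r * sin t)); last by ring.
by rewrite -ea -eb -[LHS]mulr1 -cs; ring.
Qed.

(** A nonzero z lies to the left of one of the directions 0, pi, pi / 2, - pi / 2, and [polar_next]
    starts from that direction. *)
Lemma polar_exists (z z' : C) : 0 < cross z z' -> exists m phi : R, 0 < m /\ z = polar m phi.
Proof.
move=> c; suff [phi p] : exists phi, 0 < cross (polar 1 phi) z.
  by have [m [phi' [m0 -> _]]] := polar_next ltr01 p; exists m, phi'.
case: z c => x y c.
have [y0|y0|y0] := ltgtP y 0.
- by exists pi; rewrite polarE /cross /= cospi sinpi; lra.
- by exists 0; rewrite polarE /cross /= cos0 sin0; lra.
have [x0|x0|x0] := ltgtP x 0.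
- by exists (pi / 2); rewrite polarE /cross /= cos_pihalf sin_pihalf; lra.
- by exists (- (pi / 2)); rewrite polarE /cross /= cosN sinN cos_pihalf sin_pihalf; lra.
by move: c; rewrite /cross x0 y0 /=; lra.
Qed.

(** The phase chosen for the next charge depends on the one chosen before, so index, mass and phase
    are produced together by dependent choice. *)
Lemma polar_lift (Z : nat -> C) : (forall j, 0 < cross (Z j) (Z j.+1)) ->
  exists m phi : nat -> R, forall j,
    [/\ 0 < m j, Z j = polar (m j) (phi j), phi j < phi j.+1 & phi j.+1 - phi j < pi].
Proof.
move=> hZ; pose X := {p : nat * (R * R) | 0 < p.2.1 /\ Z p.1 = polar p.2.1 p.2.2}.
pose next (p q : X) := (sval q).1 = (sval p).1.+1 /\
  (sval p).2.2 < (sval q).2.2 < (sval p).2.2 + pi.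
have ex (p : X) : {q : X | next p q}.
  apply: cid; case: p => -[j [m phi]] /= [m0 Zj].
  have := hZ j; rewrite {1}Zj => /(polar_next m0)[m' [phi' [m'0 Z' lt]]].
  by exists (exist _ (j.+1, (m', phi')) (conj m'0 Z')).
have [m [phi [m0 Z0]]] := polar_exists (hZ 0%N).
have [f [f0 fS]] := dependent_choice ex (exist _ (0%N, (m, phi)) (conj m0 Z0)).
have fj j : (sval (f j)).1 = j.
  by elim: j => [|j IH]; [rewrite f0|rewrite (fS j).1 IH].
exists (fun j => (sval (f j)).2.1), (fun j => (sval (f j)).2.2) => j.
have [p0 Zp] := svalP (f j); have [_ /andP[l1 l2]] := fS j.
by split=> //; [rewrite -{1}(fj j)|rewrite ltrBlDl].
Qed.

End Polar.

Lemma simple_stable (R : realType) (Zx : nat -> R[i]) (sigma : stability R) s :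
  quintic_type Zx sigma -> ss sigma (simple R s).
Proof.
by move=> [_ st _ _]; have [] : stable sigma (simple R s) by apply/st; exists s; exact: rep_iso_refl.
Qed.

Lemma quintic_type_polar (R : realType) (Zx : nat -> R[i]) (sigma : stability R) :
  quintic_type Zx sigma -> exists m phi : nat -> R,
  [/\ forall j, (j <= 15)%N -> 0 < m j,
      forall j k, (j < k)%N -> (k <= 15)%N -> phi j < phi k,
      forall j, (j < 15)%N -> phi j.+1 - phi j < pi,
      forall s, Defs.charge sigma (stalk (simple R s)) = polar (m (level s)) (phi (level s))
    & forall s, phase sigma (simple R s) = phi (level s)].
Proof.
move=> qt; have ssim s := simple_stable s qt; case: qt => hZ _ hp hlt.
pose phi j := phase sigma (simple R (vert j)).
have phs s : phase sigma (simple R s) = phi (level s).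
  by apply: hp; rewrite level_vert// level_le.
have /choice[m hm] j : exists m, 0 < m /\ Defs.charge sigma (stalk (simple R (vert j))) = polar m (phi j).
  by have [m m0 e] := ss_charge (ssim (vert j)); exists m.
exists m, phi; split=> //.
- by move=> j _; have [] := hm j.
- by move=> j k jk k15; apply: hlt; rewrite !level_vert//; lia.
- move=> j j15; apply: le_lt_trans (ss_ext1 (ssim _) (ssim _) (@Ext1_simple R _ _ (arrow_vert j15))).
  by rewrite distrC ler_norm.
by move=> s; rewrite hZ -(level_vert (level_le s)) -hZ (hm (level s)).2 level_vert// level_le.
Qed.

(** * Deformation by interpolation *)

Section Interpolation.
Variable R : realType.
Local Notation C := R[i].

(** A deformation is a function on all of R; clamping the parameter keeps every interpolated family
    inside the convex space. *)
Definition clamp (t : R) : R := Num.max 0 (Num.min 1 t).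

Lemma clamp_itv t : 0 <= clamp t <= 1.
Proof. by rewrite /clamp le_max lexx ge_max ler01 ge_min lexx. Qed.

Lemma clamp0 : clamp 0 = 0.
Proof. by rewrite /clamp min_r ?ler01// maxxx. Qed.

Lemma clamp1 : clamp 1 = 1.
Proof. by rewrite /clamp minxx max_r ?ler01. Qed.

Lemma continuous_clamp : continuous clamp.
Proof.
move=> t; apply: continuous_max; first exact: cst_continuous.
by apply: continuous_min; [exact: cst_continuous|].
Qed.

Definition interp (a b : nat -> R) (t : R) (j : nat) : R :=
  (1 - clamp t) * a j + clamp t * b j.

Lemma interp0 a b : interp a b 0 = a.
Proof. by apply/funext => j; rewrite /interp clamp0; ring. Qed.

Lemma interp1 a b : interp a b 1 = b.
Proof. by apply/funext => j; rewrite /interp clamp1; ring. Qed.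

Lemma continuous_interp a b j : continuous (fun t => interp a b t j).
Proof.
move=> t; apply: cvgD; apply: cvgM; try exact: cvg_cst; last exact: continuous_clamp.
by apply: cvgB; [exact: cvg_cst|exact: continuous_clamp].
Qed.

Lemma convex_lt (c a a' b b' : R) : 0 <= c <= 1 -> a < a' -> b < b' ->
  (1 - c) * a + c * b < (1 - c) * a' + c * b'.
Proof.
move=> /andP[c0 c1] aa bb; have [->|cn] := eqVneq c 0; first by rewrite !mul0r !addr0 subr0 !mul1r.
apply: ler_ltD; first by rewrite ler_wpM2l// ?subr_ge0// ltW.
by rewrite ltr_pM2l// lt_def cn.
Qed.

Section Family.
Variables m0 phi0 m1 phi1 : nat -> R.
Hypothesis m0_gt0 : forall j, (j <= 15)%N -> 0 < m0 j.
Hypothesis phi0_lt : forall j k, (j < k)%N -> (k <= 15)%N -> phi0 j < phi0 k.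
Hypothesis phi0_step : forall j, (j < 15)%N -> phi0 j.+1 - phi0 j < pi.
Hypothesis m1_gt0 : forall j, (j <= 15)%N -> 0 < m1 j.
Hypothesis phi1_lt : forall j k, (j < k)%N -> (k <= 15)%N -> phi1 j < phi1 k.
Hypothesis phi1_step : forall j, (j < 15)%N -> phi1 j.+1 - phi1 j < pi.

Lemma interp_gt0 t j : (j <= 15)%N -> 0 < interp m0 m1 t j.
Proof.
move=> j15; have := convex_lt (clamp_itv t) (m0_gt0 j15) (m1_gt0 j15).
by rewrite !mulr0 addr0.
Qed.

Lemma interp_lt t j k : (j < k)%N -> (k <= 15)%N -> interp phi0 phi1 t j < interp phi0 phi1 t k.
Proof. by move=> jk k15; exact: convex_lt (clamp_itv t) (phi0_lt jk k15) (phi1_lt jk k15). Qed.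

Lemma interp_step t j : (j < 15)%N -> interp phi0 phi1 t j.+1 - interp phi0 phi1 t j < pi.
Proof.
move=> j15; have := convex_lt (clamp_itv t) (phi0_step j15) (phi1_step j15).
by rewrite /interp; lra.
Qed.

Definition std_path (t : R) : stability R := std (interp_gt0 t) (interp_lt t) (interp_step t).

Lemma continuous_std_charge X :
  continuous (fun t => complex.Re (Defs.charge (std_path t) X)) /\
  continuous (fun t => complex.Im (Defs.charge (std_path t) X)).
Proof.
have scaleE (k : int) (z : C) : k%:~R * z = ((k%:~R * complex.Re z) +i* (k%:~R * complex.Im z))%C.
  case: z => x y; rewrite -(rmorph_int (real_complex R)); apply/eqP; rewrite eq_complex /=.
  by apply/andP; split; apply/eqP; ring.
split=> t0.
  have -> : (fun t => complex.Re (Defs.charge (std_path t) X)) = (fun t =>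
      \sum_v (chi v X)%:~R * (interp m0 m1 t (level v) * cos (interp phi0 phi1 t (level v)))).
    apply/funext => t; rewrite /= /std_charge.
    rewrite (big_morph (@complex.Re R) (id1 := 0) (op1 := +%R))//; last by case=> ? ? [].
    by apply: eq_bigr => v _; rewrite scaleE /lcharge polarE.
  apply: cvg_bigsum => v; apply: cvgM; first exact: cvg_cst.
  apply: cvgM; first exact: continuous_interp.
  by apply: continuous_comp; [exact: continuous_interp|exact: continuous_cos].
have -> : (fun t => complex.Im (Defs.charge (std_path t) X)) = (fun t =>
    \sum_v (chi v X)%:~R * (interp m0 m1 t (level v) * sin (interp phi0 phi1 t (level v)))).
  apply/funext => t; rewrite /= /std_charge.
  rewrite (big_morph (@complex.Im R) (id1 := 0) (op1 := +%R))//; last by case=> ? ? [].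
  by apply: eq_bigr => v _; rewrite scaleE /lcharge polarE.
apply: cvg_bigsum => v; apply: cvgM; first exact: cvg_cst.
apply: cvgM; first exact: continuous_interp.
by apply: continuous_comp; [exact: continuous_interp|exact: continuous_sin].
Qed.

(** The value at 0 must be sigma itself and not the [std] with its masses and phases. The two have
    the same charge, the same stable objects and the same phases on these, which is all that
    continuity refers to. *)
Lemma std_deformation (sigma : stability R) :
  (forall s, Defs.charge sigma (stalk (simple R s)) = polar (m0 (level s)) (phi0 (level s))) ->
  (forall Q, stable sigma Q <-> exists s, rep_iso Q (simple R s)) ->
  (forall s, phase sigma (simple R s) = phi0 (level s)) ->
  deformation sigma (std_path 1) (fun t => if t == 0 then sigma else std_path t).
Proof.
move=> hc hs hp; set sigma_ := fun t : R => _.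
have chE t X : Defs.charge (sigma_ t) X = Defs.charge (std_path t) X.
  rewrite /sigma_; case: eqP => // ->; rewrite (K_hom_chi (@charge_K _ sigma)).
  by apply: eq_bigr => v _; rewrite hc interp0 interp0.
have stE t Q : stable (sigma_ t) Q <-> exists s, rep_iso Q (simple R s).
  by rewrite /sigma_; case: eqP => // _; exact: std_stable.
have phE t Q s : rep_iso Q (simple R s) -> phase (sigma_ t) Q = interp phi0 phi1 t (level s).
  move=> i; rewrite /sigma_; case: eqP => [->|_]; last exact: std_phase_simple.
  have [sQ _] : stable sigma Q by apply/hs; exists s.
  by rewrite (phase_iso sQ i) hp interp0.
split=> [||X|Q].
- by rewrite /sigma_ eqxx.
- by rewrite /sigma_ oner_eq0.
- have [cR cI] := continuous_std_charge X.
  have -> : (fun t => complex.Re (Defs.charge (sigma_ t) X)) =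
      fun t => complex.Re (Defs.charge (std_path t) X).
    by apply/funext => t; rewrite chE.
  have -> : (fun t => complex.Im (Defs.charge (sigma_ t) X)) =
      fun t => complex.Im (Defs.charge (std_path t) X).
    by apply/funext => t; rewrite chE.
  by split; exact: continuous_subspaceT.
have [[s i]|no] := pselect (exists s, rep_iso Q (simple R s)).
  have -> : (fun t => phase (sigma_ t) Q) = fun t => interp phi0 phi1 t (level s).
    by apply/funext => t; exact: phE.
  exact/continuous_subspaceT/continuous_interp.
(* Here Q is stable for no t, so the subspace is empty and the constant 0 agrees with the phase on
   it. *)
apply: (@subspace_eq_continuous _ _ _ (fun=> 0)); last exact/continuous_subspaceT/cst_continuous.
by move=> t; rewrite inE => -[_ /stE].
Qed.

End Family.
End Interpolation.

Theorem corollary1p3 (R : realType) :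
  exists2 B : R, 0 < B &
    forall eps : R, 0 < eps ->
    forall sigma : stability R, S_inf B sigma ->
    exists2 sigma' : stability R, S_0 eps sigma' &
      (exists sigma_ : R -> stability R, deformation sigma sigma' sigma_) /\
      second_kind_wall_crossing sigma sigma' /\
      (forall (r theta : R) (r_gt0 : 0 < r),
         second_kind_wall_crossing (dilation_rotation sigma theta r_gt0) sigma').
Proof.
exists 1; first exact: ltr01.
move=> eps eps0 sigma [u0 _ qt].
have [m0 [phi0 [m0_gt0 phi0_lt phi0_step hc hp]]] := quintic_type_polar qt.
have ssim s := simple_stable s qt; have [_ hs _ _] := qt.
have d0 : 0 < sin (phi0 5 - phi0 4).
  by apply: sin_gt0_pi; rewrite subr_gt0 phi0_lt// phi0_step.
(* With the cosine and sine of the old step as t and s, the last condition reads sin (new step - old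
   step) < 0 up to a positive factor, so the two steps differ. *)
have [u [ueps hcross hstep]] := lcsl_phases (cos (phi0 5 - phi0 4)) eps0 d0.
have [m1 [phi1 hpol]] := polar_lift hcross.
have m1_gt0 j : (j <= 15)%N -> 0 < m1 j by have [] := hpol j.
have phi1_lt j k : (j < k)%N -> (k <= 15)%N -> phi1 j < phi1 k.
  move=> jk _; elim: k jk => // k IH; rewrite ltnS leq_eqVlt; have [_ _ l _] := hpol k.
  by move=> /orP[/eqP -> //|/IH h]; exact: lt_trans h l.
have phi1_step j : (j < 15)%N -> phi1 j.+1 - phi1 j < pi by have [] := hpol j.
pose path := std_path m0_gt0 phi0_lt phi0_step m1_gt0 phi1_lt phi1_step.
have phase1 s : phase (path 1) (simple R s) = phi1 (level s).
  by rewrite /path /std_path (std_phase_simple _ _ _ (rep_iso_refl (simple R s))) interp1.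
(* A rotation by theta moves the phases at levels 4 and 5 by the same amount, so at least one of the
   two differs from the new phase; theta = 0 gives the case of sigma itself. *)
have wall theta tau : (forall s, ss tau (simple R s)) ->
    (forall s, phase tau (simple R s) = phi0 (level s) + theta) ->
    second_kind_wall_crossing tau (path 1).
  move=> tss tph.
  have [e4|n4] := eqVneq (phi0 4 + theta) (phi1 4); last first.
    by apply: (std_wall _ _ _ (tss (vert 4))); rewrite tph level_vert// interp1.
  have [e5|n5] := eqVneq (phi0 5 + theta) (phi1 5); last first.
    by apply: (std_wall _ _ _ (tss (vert 5))); rewrite tph level_vert// interp1.
  have e : phi1 5 - phi1 4 = phi0 5 - phi0 4 by rewrite -e4 -e5; ring.
  have [_ Z4 _ _] := hpol 4; have [_ Z5 _ _] := hpol 5.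
  by move: hstep; rewrite Z4 Z5 cross_polar dot_polar e mulrAC ltxx.
exists (path 1).
  exists u => //; split=> [s|Q|s s' e|s s' lt].
  - rewrite /= std_charge_simple interp1 interp1; have [_ -> _ _] := hpol (level s).
    by [].
  - exact: std_stable.
  - by rewrite !phase1 e.
  - by rewrite !phase1 phi1_lt// level_le.
split; first by exists (fun t => if t == 0 then sigma else path t); exact: std_deformation.
split; first by apply: (wall 0) => // s; rewrite addr0.
by move=> r theta r_gt0; apply: (wall theta) => // s; rewrite -hp.
Qed.
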